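(* Let $0<\alpha<\infty$ and let $\varphi_\alpha(s)=\frac12+\alpha\,\frac{1-2^{-s}}{1+2^{-s}}$. The reproducing kernel thesis for the symbol $\varphi_\alpha$, i.e. the equality \[\sup_{w\in\mathbb{C}_{1/2}}\frac{\|\mathscr{C}_{\varphi_\alpha}\mathscr{K}_w\|_{\mathscr{H}^2}}{\|\mathscr{K}_w\|_{\mathscr{H}^2}}=\|\mathscr{C}_{\varphi_\alpha}\|,\] holds if and only if $N(K_\alpha)=0$. In particular, the reproducing kernel thesis for $\varphi_\alpha$ holds for all $0<\alpha\leq1$ and fails for all $2\leq\alpha<\infty$.
   Context: For $\theta\in\mathbb{R}$, $\mathbb{C}_\theta=\{s=\sigma+it:\sigma>\theta\}$. $\mathscr{H}^2$ is the Hilbert space of Dirichlet series $f(s)=\sum_{n=1}^\infty x(n)n^{-s}$ with square summable coefficients, with norm $\|f\|_{\mathscr{H}^2}^2=\sum_{n=1}^\infty|x(n)|^2$; it is a space of analytic functions on $\mathbb{C}_{1/2}$. The reproducing kernel of $\mathscr{H}^2$ at $w\in\mathbb{C}_{1/2}$ is $\mathscr{K}_w(s)=\zeta(s+\overline{w})=\sum_{n=1}^\infty n^{-s-\overline{w}}$, where $\zeta$ is the Riemann zeta function, so that $f(w)=\langle f,\mathscr{K}_w\rangle_{\mathscr{H}^2}$ for all $f\in\mathscr{H}^2$. For an analytic $\varphi\colon\mathbb{C}_{1/2}\to\mathbb{C}_{1/2}$, the composition operator is $\mathscr{C}_\varphi f=f\circ\varphi$. It is known that $\mathscr{C}_{\varphi_\alpha}$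 is a bounded operator from $\mathscr{H}^2$ to itself for every $\alpha>0$; $\|\mathscr{C}_{\varphi_\alpha}\|$ denotes its operator norm. For $\alpha>0$, $K_\alpha$ denotes the bounded self-adjoint operator on $\ell^2(\mathbb{N})$, $\mathbb{N}=\{1,2,\ldots\}$, given by the infinite matrix \[K_\alpha=\left(\frac{(nm)^{-\frac12+\alpha}}{[\max(n,m)]^{2\alpha}}\right)_{n,m=1}^\infty ,\] and $N(K_\alpha)$ denotes the total number of eigenvalues of $K_\alpha$ (which is finite, and all eigenvalues are simple and lie in $(\tfrac2\alpha,\infty)$). *)

(* Defs.v *)
From mathcomp Require Import all_boot all_order all_algebra.
From mathcomp Require Import all_classical all_reals all_analysis.
From mathcomp Require Import complex.
Import Order.TTheory GRing.Theory Num.Theory.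
Import numFieldNormedType.Exports.

Set Implicit Arguments.
Unset Strict Implicit.
Unset Printing Implicit Defensive.

Local Open Scope classical_set_scope.
Local Open Scope ring_scope.
Local Open Scope complex_scope.

Section complex_series.
Variable R : realType.
Implicit Types (s z l : R[i]) (u : nat -> R[i]) (n : nat).

Definition cexp z : R[i] :=
  (expR (complex.Re z))%:C * (cos (complex.Im z) +i* sin (complex.Im z)).

(* Principal power n^s = exp (s log n); only meaningful for 0 < n. *)
Definition cpow n s : R[i] := cexp (s * (ln (n%:R : R))%:C).

(* The copy R[i]^o carries the topology given by the complex modulus. *)
Definition cseries_to u l : Prop :=
  series (u : nat -> R[i]^o) @ \oo --> (l : R[i]^o).

Definition cseries_sum u : R[i] := limn (series (u : nat -> R[i]^o)).

Definition half_plane (theta : R) : set R[i] :=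
  [set s | theta < complex.Re s].

(* The Dirichlet series of zeta: this is the Riemann zeta function on
   half_plane 1, where the series converges, and is used only there. *)
Definition zeta s : R[i] := cseries_sum (fun k => cpow k.+1 (- s)).

End complex_series.

(* Sequences indexed by {1, 2, ...} are encoded as x : nat -> R[i], with
   x k standing for the entry of index k.+1. *)
Section ell2.
Variable R : realType.
Implicit Types x : nat -> R[i].

Definition l2norm x : \bar R :=
  sqrte (\sum_(0 <= k <oo) (ComplexField.Normc.normc (x k) ^+ 2)%:E)%E.

Definition ell2 : set (nat -> R[i]) := [set x | (l2norm x < +oo)%E].

(* lambda is an eigenvalue of the operator on ell2 with matrix A; the n-th
   entry of A x is the sum of the series of the A n m * x m. *)
Definition eigenvalue_ell2 (A : nat -> nat -> R) (lambda : R[i]) : Prop :=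
  exists x, [/\ ell2 x, (exists k, x k != 0) &
    forall n, cseries_to (fun m => (A n m)%:C * x m) (lambda * x n)].

(* +oo when there are infinitely many eigenvalues. Eigenvalues are counted
   without multiplicity. *)
Definition eigenvalue_number (A : nat -> nat -> R) : \bar R :=
  counting (eigenvalue_ell2 A).

End ell2.

Section hardy_space.
Variable R : realType.
Implicit Types (f phi : R[i] -> R[i]) (w : R[i]).

(* Elements of H2 are functions on half_plane (1/2); they are represented by
   total functions, whose values elsewhere play no role. *)
Definition H2_coeffs f : set (nat -> R[i]) :=
  [set x | ell2 x /\ forall s, half_plane 2^-1 s ->
     cseries_to (fun k => x k * cpow k.+1 (- s)) (f s)].

Definition H2 : set (R[i] -> R[i]) := [set f | exists x, H2_coeffs f x].

(* The coefficients of a Dirichlet series are determined by its sum, so the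
   choice made by xget is immaterial. *)
Definition H2_coef f : nat -> R[i] := xget (fun=> 0) (H2_coeffs f).

Definition H2norm f : \bar R :=
  if `[< H2 f >] then l2norm (H2_coef f) else +oo%E.

Definition repr_kernel w : R[i] -> R[i] := fun s => zeta (s + w^*).

Definition comp_op phi f : R[i] -> R[i] := f \o phi.

(* As H2norm is +oo outside H2, this is +oo unless comp_op phi maps H2 to
   itself and is bounded. *)
Definition comp_op_norm phi : \bar R :=
  ereal_sup [set H2norm (comp_op phi f) | f in [set f | H2norm f <= 1]%E].

Definition repr_kernel_thesis phi : Prop :=
  ereal_sup [set (H2norm (comp_op phi (repr_kernel w)) /
                  H2norm (repr_kernel w))%E | w in half_plane 2^-1]
  = comp_op_norm phi.

End hardy_space.

Definition phi_symbol (R : realType) (alpha : R) (s : R[i]) : R[i] :=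
  2^-1 + alpha%:C * ((1 - cpow 2 (- s)) / (1 + cpow 2 (- s))).

Definition Kmatrix (R : realType) (alpha : R) (i j : nat) : R :=
  let n := i.+1 in let m := j.+1 in
  (n * m)%N%:R `^ (- 2^-1 + alpha) / (maxn n m)%:R `^ (2 * alpha).

(* Main.v *)
Require Import Defs.
From mathcomp Require Import all_boot all_order all_algebra.
From mathcomp Require Import all_classical all_reals all_analysis.
From mathcomp Require Import complex.
From mathcomp Require Import ring lra.
Import Order.TTheory GRing.Theory Num.Theory.
Import numFieldNormedType.Exports.
Local Open Scope ring_scope.

(** Put z = 2^(-s) and A = (1 - z) / (1 + z), so that n^(-phi(s)) is
    n^(-1/2) exp (- b A) with b = alpha ln n.  The coefficients c_k(b) of the
    powers of z in exp (- b A) are combinations of Laguerre functions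
    ([generating_function]), and the sum of the c_k(b) c_k(g) is
    exp (- |b - g|) ([gram_cvg]).  Hence f o phi is a Dirichlet series over the
    powers of 2, and since exp (- alpha |ln n - ln m|) / sqrt (n m) is the
    entry K(n,m) of the matrix, its squared norm is the quadratic form Q(x) of
    K at the coefficients x of f ([comp_H2norm]).  The norm of the composition
    operator is therefore the supremum of the square root of Q(x) / |x|^2,
    while the reproducing kernel thesis concerns the sequences
    n^(- 1/2 - de), de > 0, only: a kernel has coefficients of such moduli,
    and K has positive entries ([kernel_qlim_le]).  On these sequences the
    quotient is at least 2/alpha - O(de) ([qform_kseq_lower]).

    The matrix is a Green matrix: K x = lambda x is a two-term recursion for
    the sums S_n of the m^(alpha - 1/2) x_m over m <= n and the tails T_n of
    the series of the m^(- 1/2 - alpha) x_m.  With mu = 1/lambda it is solved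
    by shooting from S_0 = 0, T_0 = 1.  If T never becomes negative, the
    positive solution S gives Q(x) <= |x|^2 / mu through a discrete Picone
    identity ([picone], [qform_le]).  There are two cases ([dichotomy]).

    In the critical case T is nonnegative for mu = alpha/2.  Then Q(x) is at
    most (2/alpha) |x|^2, the kernels reach this bound as de tends to 0, and
    the thesis holds.  There is no eigenvalue ([no_eigenvalue]): one above
    2/alpha contradicts the bound, and for lambda <= 2/alpha the recursion is
    a small perturbation of a rotation, or of its degenerate limit, and has no
    nonzero solution tending to 0.

    In the subcritical case the largest mu for which T is nonnegative is
    smaller than alpha/2.  Its solution is square summable, hence an
    eigenvector of K for 1/mu ([ground_eigen]), and it attains the norm
    ([ground_rayleigh]).  The kernels stay away from this value
    ([kernel_gap]): otherwise the Picone identity makes the eigenvector a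
    limit of multiples of kernels, that is, a power sequence n^q, which
    satisfies the recursion for no exponent ([power_sequence_absurd]).  So the
    thesis fails and there is an eigenvalue.

    For alpha <= 1 the shooting solution remains in an explicit cone, which is
    the critical case ([admissible_small]); for alpha >= 2 a vector with two
    entries violates the bound 2/alpha ([large_not_critical]). *)

Set Implicit Arguments.
Unset Strict Implicit.
Unset Printing Implicit Defensive.

Local Open Scope classical_set_scope.
Local Open Scope ring_scope.

(** * Powers of integers and power sums *)

Section powers.
Variable R : realType.
Implicit Types (a b c p u s : R) (n m N : nat).

(** The exponential form makes all laws of exponents, negative ones included,
    instances of the additivity of the exponential. *)
Definition npow a n : R := expR (a * ln n%:R).

Lemma npow_gt0 a n : 0 < npow a n. Proof. exact: expR_gt0. Qed.
Lemma npow_ge0 a n : 0 <= npow a n. Proof. exact: expR_ge0. Qed.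
Lemma npow_neq0 a n : npow a n != 0. Proof. by rewrite gt_eqF ?npow_gt0. Qed.

Lemma npowD a b n : npow (a + b) n = npow a n * npow b n.
Proof. by rewrite /npow mulrDl expRD. Qed.

(** In applications the equation between the three exponents is left to ring;
    rewriting with [npowD] would require a prior normalization of the exponent. *)
Lemma npow_split a b c n : c = a + b -> npow c n = npow a n * npow b n.
Proof. by move=> ->; exact: npowD. Qed.

Lemma npowN a n : npow (- a) n = (npow a n)^-1.
Proof. by rewrite /npow mulNr expRN. Qed.

Lemma npow0 n : npow 0 n = 1. Proof. by rewrite /npow mul0r expR0. Qed.

Lemma npow1 n : (0 < n)%N -> npow 1 n = n%:R.
Proof. by move=> n0; rewrite /npow mul1r lnK// posrE ltr0n. Qed.

Lemma npow_1 a : npow a 1 = 1. Proof. by rewrite /npow ln1 mulr0 expR0. Qed.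

Lemma npow_sqr a n : npow a n ^+ 2 = npow (2 * a) n.
Proof. by rewrite expr2 -npowD mulr2n mulrDl mul1r. Qed.

Lemma npow_le a m n : 0 <= a -> (0 < m)%N -> (m <= n)%N -> npow a m <= npow a n.
Proof.
move=> a0 m0 mn; rewrite ler_expR ler_wpM2l// ler_ln ?posrE ?ltr0n ?ler_nat//.
exact: leq_trans mn.
Qed.

Lemma npow_lt a m n : 0 < a -> (0 < m)%N -> (m < n)%N -> npow a m < npow a n.
Proof.
move=> a0 m0 mn; rewrite ltr_expR ltr_pM2l// ltr_ln ?posrE ?ltr0n ?ltr_nat//.
exact: leq_trans mn.
Qed.

Lemma npow_powR a n : (0 < n)%N -> n%:R `^ a = npow a n.
Proof. by move=> n0; rewrite /powR pnatr_eq0 gtn_eqF. Qed.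

Definition lnstep n : R := ln n.+1%:R - ln n%:R.

Lemma expR_lnstep n : (0 < n)%N -> expR (lnstep n) = 1 + n%:R^-1.
Proof.
move=> n0; rewrite expRB !lnK ?posrE ?ltr0n//.
by rewrite -natr1 mulrDl divff ?mul1r// pnatr_eq0 -lt0n.
Qed.

Lemma expR_Nlnstep n : (0 < n)%N -> expR (- lnstep n) = 1 - n.+1%:R^-1.
Proof.
move=> n0; rewrite expRN expRB !lnK ?posrE ?ltr0n// invf_div.
by field; rewrite ?nat1r ?natr1 pnatr_eq0.
Qed.

Lemma lnstep_le n : (0 < n)%N -> lnstep n <= n%:R^-1.
Proof.
by move=> n0; have := expR_ge1Dx (lnstep n); rewrite expR_lnstep// lerD2l.
Qed.

Lemma lnstep_ge n : (0 < n)%N -> n.+1%:R^-1 <= lnstep n.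
Proof.
move=> n0; have := expR_ge1Dx (- lnstep n); rewrite expR_Nlnstep// lerD2l.
by rewrite lerN2.
Qed.

Lemma lnstep_ge0 n : (0 < n)%N -> 0 <= lnstep n.
Proof. by move=> n0; apply: le_trans (lnstep_ge n0); rewrite invr_ge0. Qed.

Lemma npowS a n : npow a n.+1 = npow a n * expR (a * lnstep n).
Proof. by rewrite /npow /lnstep -expRD; congr expR; ring. Qed.

Lemma npowSN a n : npow a n = npow a n.+1 * expR (- (a * lnstep n)).
Proof. by rewrite npowS -mulrA -expRD subrr expR0 mulr1. Qed.

(** Bernoulli's inequality (1 + t)^p <= 1 + p t with 1 + t = exp u. It follows
    from exp y >= 1 + y at y = (1 - p) u and y = - p u, with the weights p and 1
    - p. *)
Lemma expR_bernoulli_le p u : 0 <= p <= 1 -> expR (p * u) <= 1 + p * (expR u - 1).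
Proof.
move=> /andP[p0 p1].
have e0 := expR_ge0 (p * u).
have -> : expR u = expR (p * u) * expR ((1 - p) * u).
  by rewrite -expRD -mulrDl addrC subrK mul1r.
have h1 : expR (p * u) * (1 + (1 - p) * u) <= expR (p * u) * expR ((1 - p) * u).
  by apply: ler_wpM2l => //; exact: expR_ge1Dx.
have h2 : expR (p * u) * (1 - p * u) <= 1.
  rewrite -[leRHS](expRxMexpNx_1 (p * u)).
  by apply: ler_wpM2l => //; exact: expR_ge1Dx.
have h1' := ler_wpM2l p0 h1; have p1' : 0 <= 1 - p by lra.
have := lerD h1' (ler_wpM2l p1' h2); lra.
Qed.

Lemma expR_bernoulli_ge p u : 1 <= p -> 1 + p * (expR u - 1) <= expR (p * u).
Proof.
move=> p1; have p0 : 0 < p by lra.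
have := @expR_bernoulli_le p^-1 (p * u).
rewrite mulrA mulVf ?mul1r ?gt_eqF// invr_ge0 ltW//= invf_le1// => /(_ p1).
move=> H; have : p * expR u <= p * (1 + p^-1 * (expR (p * u) - 1)).
  by rewrite ler_pM2l.
by rewrite mulrDr mulrA divff ?gt_eqF// mul1r => ?; lra.
Qed.

(** A term of the sum is compared with the integral of s t^(- s - 1) over a unit
    interval; the sums are then estimated by telescoping. *)
Lemma npow_step_le s n : 0 < s ->  (0 < n)%N ->
  npow (- s) n - npow (- s) n.+1 <= s * npow (- s - 1) n.
Proof.
move=> s0 n0; rewrite npowS npowD npowN (npowN 1) npow1// mulNr.
have h := expR_ge1Dx (- (s * lnstep n)).
have h2 : s * lnstep n <= s * n%:R^-1 by rewrite ler_pM2l// lnstep_le.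
rewrite -[X in X - _]mulr1 -mulrBr mulrCA ler_pM2l ?invr_gt0 ?npow_gt0//.
lra.
Qed.

Lemma npow_step_ge s n : 0 < s ->  (0 < n)%N ->
  s * npow (- s - 1) n.+1 <= npow (- s) n - npow (- s) n.+1.
Proof.
move=> s0 n0; rewrite (npowSN (- s) n) npowD npowN (npowN 1) npow1// mulNr opprK.
have h := expR_ge1Dx (s * lnstep n).
have h2 : s * n.+1%:R^-1 <= s * lnstep n by rewrite ler_pM2l// lnstep_ge.
rewrite -[X in _ <= _ - X]mulr1 -mulrBr mulrCA ler_pM2l ?invr_gt0 ?npow_gt0//.
by apply: (le_trans h2); lra.
Qed.

Lemma sum_npow_le s N : 0 < s -> \sum_(k < N) npow (- s - 1) k.+1 <= 1 + s^-1.
Proof.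
move=> s0; case: N => [|N].
  by rewrite big_ord0 addr_ge0// invr_ge0 ltW.
suff : \sum_(k < N.+1) npow (- s - 1) k.+1 <= 1 + s^-1 * (1 - npow (- s) N.+1).
  have : 0 <= s^-1 * npow (- s) N.+1 by rewrite mulr_ge0 ?npow_ge0// invr_ge0 ltW.
  lra.
elim: N => [|N IH]; first by rewrite big_ord1 !npow_1 subrr mulr0 addr0.
rewrite big_ord_recr /=.
have := @npow_step_ge s N.+1 s0 isT.
rewrite -(ler_pM2l (_ : 0 < s^-1)) ?invr_gt0// mulrA mulVf ?gt_eqF// mul1r; lra.
Qed.

Lemma sum_npow_ge s N : 0 < s ->
  s^-1 * (1 - npow (- s) N.+1) <= \sum_(k < N) npow (- s - 1) k.+1.
Proof.
move=> s0; elim: N => [|N IH]; first by rewrite big_ord0 npow_1 subrr mulr0.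
rewrite big_ord_recr /=.
have := @npow_step_le s N.+1 s0 isT.
rewrite -(ler_pM2l (_ : 0 < s^-1)) ?invr_gt0// [leRHS]mulrA mulVf ?gt_eqF// mul1r; lra.
Qed.

(** Comparison of p t^(p - 1) with its integral over a unit interval. The
    function changes its monotonicity at p = 1, hence two pairs of lemmas. *)
Lemma npow_pstep_ge p n : 1 <= p -> (0 < n)%N ->
  p * npow (p - 1) n <= npow p n.+1 - npow p n.
Proof.
move=> p1 n0; rewrite npowS npowD (npowN 1) npow1//.
have := @expR_bernoulli_ge p (lnstep n) p1; rewrite expR_lnstep// => h.
rewrite -[X in _ - X]mulr1 -mulrBr mulrCA ler_pM2l ?npow_gt0//; lra.
Qed.

Lemma npow_pstep_le p n : 1 <= p -> (0 < n)%N ->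
  npow p n.+1 - npow p n <= p * npow (p - 1) n.+1.
Proof.
move=> p1 n0; rewrite (npowSN p n) npowD (npowN 1) npow1//.
have := @expR_bernoulli_ge p (- lnstep n) p1; rewrite expR_Nlnstep// mulrN => h.
rewrite -[X in X - _]mulr1 -mulrBr mulrCA ler_pM2l ?npow_gt0//.
move: h; move: (n.+1%:R^-1) => y h; lra.
Qed.

Lemma npow_qstep_le p n : 0 < p <= 1 -> (0 < n)%N ->
  npow p n.+1 - npow p n <= p * npow (p - 1) n.
Proof.
move=> /andP[p0 p1] n0; rewrite npowS npowD (npowN 1) npow1//.
have := @expR_bernoulli_le p (lnstep n); rewrite expR_lnstep// ltW// p1 => /(_ isT) h.
rewrite -[X in _ - X]mulr1 -mulrBr mulrCA ler_pM2l ?npow_gt0//; lra.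
Qed.

Lemma npow_qstep_ge p n : 0 < p <= 1 -> (0 < n)%N ->
  p * npow (p - 1) n.+1 <= npow p n.+1 - npow p n.
Proof.
move=> /andP[p0 p1] n0; rewrite (npowSN p n) npowD (npowN 1) npow1//.
have := @expR_bernoulli_le p (- lnstep n); rewrite expR_Nlnstep// mulrN ltW// p1.
move=> /(_ isT) h.
rewrite -[X in _ <= X - _]mulr1 -mulrBr mulrCA ler_pM2l ?npow_gt0//.
move: h; move: (n.+1%:R^-1) => y h; lra.
Qed.

Lemma sum_npow_p_ge p N : 0 < p ->
  npow p N.+1 - 1 <= p * \sum_(k < N.+1) npow (p - 1) k.+1.
Proof.
move=> p0; have [p1|/ltW p1] := leP p 1.
  apply: (@le_trans _ _ (npow p N.+2 - 1)).
    by rewrite lerD2r npow_le// ltW.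
  elim: N => [|N IH].
    rewrite big_ord1 npow_1; have := @npow_qstep_le p 1.
    by rewrite p0 p1 !npow_1 => /(_ isT isT); lra.
  rewrite big_ord_recr /= mulrDr.
  by have := @npow_qstep_le p N.+2; rewrite p0 p1 => /(_ isT isT); lra.
elim: N => [|N IH]; first by rewrite big_ord1 !npow_1 subrr mulr1 ltW.
rewrite big_ord_recr /= mulrDr.
have := @npow_pstep_le p N.+1 p1 isT; lra.
Qed.

Lemma sum_npow_p_le p N : 1 <= p ->
  p * \sum_(k < N.+1) npow (p - 1) k.+1 <= npow p N.+1 + p * npow (p - 1) N.+1.
Proof.
move=> p1; elim: N => [|N IH]; first by rewrite big_ord1 !npow_1; lra.
rewrite big_ord_recr /= mulrDr.
have := @npow_pstep_ge p N.+1 p1 isT; lra.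
Qed.

(** For p <= 1 this is comparison with the integral, for p >= 1 each term is at
    most the last one. *)
Lemma sum_npow_p_bnd p : 0 < p -> exists2 C : R, 0 < C & forall N,
  \sum_(k < N.+1) npow (p - 1) k.+1 <= C * npow p N.+1.
Proof.
move=> p0; have [p1|/ltW p1] := leP p 1.
  exists (p^-1) => [|N]; first by rewrite invr_gt0.
  rewrite -(ler_pM2l p0) mulrA mulfV ?gt_eqF// mul1r.
  elim: N => [|N IH]; first by rewrite big_ord1 !npow_1 mulr1.
  rewrite big_ord_recr /= mulrDr.
  by have := @npow_qstep_ge p N.+1; rewrite p0 p1 => /(_ isT isT); lra.
exists 1 => // N; rewrite mul1r.
have -> : npow p N.+1 = \sum_(k < N.+1) npow (p - 1) N.+1.
  by rewrite sumr_const card_ord -mulr_natr -npow1// -npowD subrK.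
by apply: ler_sum => k _; rewrite npow_le// ?subr_ge0.
Qed.

End powers.

(** * The quadratic form and the shooting solution *)

Section quadratic_form.
Variables (R : realType) (al : R).
Implicit Types (x : nat -> R) (mu : R) (n N : nat).

(** The entries factor over the larger and the smaller index; this makes the
    matrix the Green matrix of a second order recursion. *)
Definition kern (i j : nat) : R :=
  npow (- 2^-1 - al) (maxn i j).+1 * npow (al - 2^-1) (minn i j).+1.

Lemma kernC i j : kern i j = kern j i.
Proof. by rewrite /kern maxnC minnC. Qed.

Lemma kern_le i j : (j <= i)%N ->
  kern i j = npow (- 2^-1 - al) i.+1 * npow (al - 2^-1) j.+1.
Proof. by move=> ji; rewrite /kern (maxn_idPl ji) (minn_idPr ji). Qed.

(** The sums S_n, in which the quadratic form becomes diagonal. *)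
Definition wsum x n : R := \sum_(k < n) npow (al - 2^-1) k.+1 * x k.

Lemma wsum0 x : wsum x 0 = 0. Proof. by rewrite /wsum big_ord0. Qed.

Lemma wsumS x n : wsum x n.+1 = wsum x n + npow (al - 2^-1) n.+1 * x n.
Proof. by rewrite /wsum big_ord_recr. Qed.

Definition qform x N : R := \sum_(i < N) \sum_(j < N) kern i j * (x i * x j).

Lemma qform0 x : qform x 0 = 0. Proof. by rewrite /qform big_ord0. Qed.

(** The terms of the new row and column are multiples of x_N x_m with the weight
    of the smaller index m, so that they add up to the cross term of the square
    of S_(N+1). *)
Lemma qformS x N : qform x N.+1 =
  qform x N + npow (- (2 * al)) N.+1 * (wsum x N.+1 ^+ 2 - wsum x N ^+ 2).
Proof.
have row : \sum_(j < N) kern N j * (x N * x j) =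
    npow (- 2^-1 - al) N.+1 * x N * wsum x N.
  rewrite /wsum mulr_sumr; apply: eq_bigr => j _.
  by rewrite kern_le ?(ltnW (ltn_ord j))//; ring.
have split : qform x N.+1 = qform x N +
    \sum_(j < N) kern N j * (x N * x j) * 2 + kern N N * (x N * x N).
  rewrite /qform big_ord_recr /= big_ord_recr /= addrA; congr (_ + _).
  under eq_bigr do rewrite big_ord_recr /=.
  rewrite big_split /= -addrA; congr (_ + _).
  rewrite -big_split /=; apply: eq_bigr => j _.
  by rewrite kernC [x j * x N]mulrC; ring.
rewrite split -mulr_suml row kern_le// wsumS -addrA; congr (_ + _).
have e1 : npow (- 2^-1 - al) N.+1 =
    npow (- (2 * al)) N.+1 * npow (al - 2^-1) N.+1.
  by rewrite -npowD; have -> : - (2 * al) + (al - 2^-1) = - 2^-1 - al by ring.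
by rewrite e1; ring.
Qed.

(** The form is a sum of squares with positive weights, because n^(- 2 al)
    decreases. *)
Lemma sum_by_parts x N : qform x N.+1 =
  \sum_(n < N) (npow (- (2 * al)) n.+1 - npow (- (2 * al)) n.+2) * wsum x n.+1 ^+ 2
  + npow (- (2 * al)) N.+1 * wsum x N.+1 ^+ 2.
Proof.
elim: N => [|N IH].
  by rewrite qformS qform0 big_ord0 wsum0; ring.
by rewrite qformS IH big_ord_recr /=; ring.
Qed.

End quadratic_form.

Section shooting.
Variables (R : realType) (al : R).
Hypothesis al0 : 0 < al.
Implicit Types (x : nat -> R) (mu : R) (n N : nat).

(** The eigenvalue equation K x = x / mu as a recursion for S_n and T_n, the
    tail of the series of the m^(- 1/2 - al) x_m over m > n. The common
    increment is expressed by g = n^(1/2 - al) x_n / mu, which equals n^(- 2 al)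
    S + T. Up to a factor, (0, 1) is the only initial value. *)
Fixpoint shoot mu n : R * R :=
  if n is m.+1 then
    let S := (shoot mu m).1 in let T := (shoot mu m).2 in
    let g := npow (- (2 * al)) n * S + T in
    (S + mu * npow (2 * al - 1) n * g, T - mu * npow (- 1) n * g)
  else (0, 1).

Definition Sm mu n := (shoot mu n).1.
Definition Tm mu n := (shoot mu n).2.
Definition gm mu n := npow (- (2 * al)) n.+1 * Sm mu n + Tm mu n.

Lemma SmS mu n : Sm mu n.+1 = Sm mu n + mu * npow (2 * al - 1) n.+1 * gm mu n.
Proof. by []. Qed.

Lemma TmS mu n : Tm mu n.+1 = Tm mu n - mu * npow (- 1) n.+1 * gm mu n.
Proof. by []. Qed.

Lemma Sm0 mu : Sm mu 0 = 0. Proof. by []. Qed.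
Lemma Tm0 mu : Tm mu 0 = 1. Proof. by []. Qed.

(** g may be computed before or after the step: the changes of n^(- 2 al) S and
    of T cancel. *)
Lemma gm_post mu n : gm mu n = npow (- (2 * al)) n.+1 * Sm mu n.+1 + Tm mu n.+1.
Proof.
rewrite SmS TmS -(_ : npow (- (2 * al)) n.+1 * npow (2 * al - 1) n.+1 = npow (- 1) n.+1).
  by rewrite /gm; ring.
by rewrite -npowD addrA addNr add0r.
Qed.

Lemma gm_step mu n : gm mu n - gm mu n.+1 =
  (npow (- (2 * al)) n.+1 - npow (- (2 * al)) n.+2) * Sm mu n.+1.
Proof. by rewrite gm_post /gm; ring. Qed.

Lemma shoot_cont n (mu0 : R) :
  ((fun mu => Sm mu n) @ mu0 --> Sm mu0 n) /\ ((fun mu => Tm mu n) @ mu0 --> Tm mu0 n).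
Proof.
elim: n => [|n [IS IT]]; first by split; exact: cvg_cst.
have Ig : (fun mu => gm mu n) @ mu0 --> gm mu0 n.
  by apply: cvgD => //; apply: cvgM => //; exact: cvg_cst.
by split; [apply: cvgD|apply: cvgB] => //; apply: cvgM => //;
  apply: cvgM; (exact: cvg_id || exact: cvg_cst).
Qed.

(** A nonnegative T keeps the solution S positive. The parameter is the inverse
    of a spectral parameter, so that small mu are admissible. *)
Definition admissible mu := forall n, 0 <= Tm mu n.

Section admissible.
Variable mu : R.
Hypotheses (mu0 : 0 <= mu) (adm : admissible mu).

Lemma adm_Sm_ge0 n : 0 <= Sm mu n.
Proof.
elim: n => [|n IH]; first by rewrite Sm0.
rewrite SmS addr_ge0// !mulr_ge0 ?npow_ge0//.
by rewrite addr_ge0// mulr_ge0 ?npow_ge0.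
Qed.

Lemma adm_gm_ge0 n : 0 <= gm mu n.
Proof. by rewrite addr_ge0// mulr_ge0 ?npow_ge0 ?adm_Sm_ge0. Qed.

Lemma adm_Sm_gt0 n : 0 < mu -> 0 < Sm mu n.+1.
Proof.
move=> mup; elim: n => [|n IH].
  by rewrite SmS Sm0 add0r /gm Sm0 Tm0 !npow_1 mulr0 add0r !mulr1.
rewrite SmS ltr_wpDr// mulr_ge0 ?adm_gm_ge0// mulr_ge0 ?npow_ge0//.
Qed.

Lemma adm_gm_gt0 n : 0 < mu -> 0 < gm mu n.
Proof.
case: n => [|n] mup.
  by rewrite /gm Sm0 Tm0 !npow_1 mulr0 add0r.
by rewrite /gm ltr_wpDr// mulr_gt0 ?npow_gt0 ?adm_Sm_gt0.
Qed.

Lemma adm_Tm_gt0 n : 0 < Tm mu n.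
Proof.
move: mu0; rewrite le_eqVlt => /predU1P[e|mup].
  suff -> : Tm mu n = 1 by [].
  by elim: n => [|n IH]; rewrite ?Tm0// TmS IH -e !mul0r subr0.
apply: le_lt_trans (adm n.+1) _.
by rewrite TmS gtrBl !mulr_gt0 ?npow_gt0// adm_gm_gt0.
Qed.

Hypothesis mup : 0 < mu.

(** The defect in Picone's identity. For n > 0 it vanishes if and only if the
    sums of x at n and n + 1 are proportional to those of the solution. *)
Definition picone_rem x n : R := npow (1 - 2 * al) n.+1 * (Sm mu n.+1 * Sm mu n) *
  (wsum al x n.+1 / Sm mu n.+1 - wsum al x n / Sm mu n) ^+ 2.

(** Write x_n^2 as n^(1 - 2 al) (S_n - S_(n-1))^2 and complete the cross term to
    the square of the difference of the quotients S_n / u_n, where u = Sm. The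
    recursion of u turns the remaining coefficients of S_n^2 into those of
    [sum_by_parts], up to a boundary term. *)
Lemma picone x N : \sum_(k < N.+1) x k ^+ 2 =
  mu * (\sum_(n < N) (npow (- (2 * al)) n.+1 - npow (- (2 * al)) n.+2) * wsum al x n.+1 ^+ 2
  + gm mu N / Sm mu N.+1 * wsum al x N.+1 ^+ 2)
  + \sum_(k < N) picone_rem x k.+1.
Proof.
elim: N => [|N IH].
  rewrite !big_ord0 big_ord1 wsumS wsum0 SmS Sm0 !npow_1.
  have g0 : gm mu 0 != 0 by rewrite gt_eqF ?adm_gm_gt0.
  by field; rewrite g0 gt_eqF.
rewrite big_ord_recr /= IH [in RHS]big_ord_recr [X in _ = _ + X]big_ord_recr /=.
have u1 : Sm mu N.+1 != 0 by rewrite gt_eqF ?adm_Sm_gt0.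
have u2 : Sm mu N.+2 != 0 by rewrite gt_eqF ?adm_Sm_gt0.
have -> : x N.+1 ^+ 2 = npow (1 - 2 * al) N.+2 * (wsum al x N.+2 - wsum al x N.+1) ^+ 2.
  rewrite wsumS [_ + _ * _]addrC addrK exprMn npow_sqr mulrA -npowD.
  have -> : 1 - 2 * al + 2 * (al - 2^-1) = 0 by field.
  by rewrite npow0 mul1r.
have eg : mu * gm mu N.+1 = npow (1 - 2 * al) N.+2 * (Sm mu N.+2 - Sm mu N.+1).
  have e : npow (1 - 2 * al) N.+2 * npow (2 * al - 1) N.+2 = 1.
    by rewrite -npowD addrA subrK subrr npow0.
  by rewrite SmS -[LHS]mul1r -[X in X * _ = _]e; ring.
have es := gm_step mu N.
rewrite /picone_rem.
move: es eg; set D := (npow (- (2 * al)) N.+1 - _).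
set g1 := gm mu N.+1; set g0 := gm mu N.
set w := npow (1 - 2 * al) N.+2.
set a := wsum al x N.+2; set b := wsum al x N.+1.
move: u1 u2; set u1 := Sm mu N.+1; set u2 := Sm mu N.+2 => u1n u2n es eg.
have -> : g0 = g1 + D * u1 by rewrite -es; ring.
have -> : g1 = mu^-1 * (w * (u2 - u1)) by rewrite -eg mulrA mulVf ?mul1r ?gt_eqF.
field; rewrite u1n u2n gt_eqF//.
Qed.

Lemma picone_rem_ge0 x n : 0 <= picone_rem x n.
Proof.
apply: mulr_ge0; last exact: sqr_ge0.
by apply: mulr_ge0; [exact: npow_ge0|apply: mulr_ge0; exact: adm_Sm_ge0].
Qed.

(** By [gm_post] and T >= 0, the boundary term in Picone's identity is at least
    that of the form. *)
Lemma qform_le_rem x N :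
  mu * qform al x N.+1 + \sum_(k < N) picone_rem x k.+1 <= \sum_(k < N.+1) x k ^+ 2.
Proof.
rewrite picone lerD2r ler_wpM2l// sum_by_parts lerD2l ler_wpM2r ?sqr_ge0//.
rewrite ler_pdivlMr ?adm_Sm_gt0// gm_post lerDl; exact: adm.
Qed.

Lemma qform_le x N : mu * qform al x N <= \sum_(k < N) x k ^+ 2.
Proof.
case: N => [|N]; first by rewrite qform0 mulr0 big_ord0.
apply: le_trans (qform_le_rem x N); rewrite lerDl sumr_ge0// => k _.
exact: picone_rem_ge0.
Qed.

End admissible.
End shooting.

(** * Critical and subcritical parameters *)

Section dichotomy.
Variables (R : realType) (al : R).
Hypothesis al0 : 0 < al.
Implicit Types (x : nat -> R) (mu m : R) (n N : nat).
Local Notation Sm := (Sm al).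
Local Notation Tm := (Tm al).
Local Notation gm := (gm al).
Local Notation admissible := (admissible al).

(** Inside this cone the solution cannot lose the positivity of T. *)
Definition cone mu n := Sm mu n <= npow (2 * al) n * Tm mu n.

Definition cone_rate mu n := npow (2 * al) n * (1 + 2 * mu * n.+1%:R^-1) <=
  npow (2 * al) n.+1 * (1 - 2 * mu * n.+1%:R^-1).

(** With X = (n + 1)^(2 al) T and y = 1 / (n + 1), a step moves the amount mu y
    (S + X) from X to S. The cone is reached again when (1 + 2 mu y) S <= (1 - 2
    mu y) X, and X gains the factor ((n + 1) / n)^(2 al) over the value in the
    previous cone condition. *)
Lemma cone_step mu n : 0 <= mu -> cone_rate mu n -> 0 <= Sm mu n -> cone mu n ->
  cone mu n.+1.
Proof.
move=> mu0 hr S0 hc; rewrite /cone SmS TmS.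
set y : R := n.+1%:R^-1; set S := Sm mu n; set T := Tm mu n.
have y0 : 0 <= y by rewrite invr_ge0.
set X := npow (2 * al) n.+1 * T.
have ey : npow (- 1) n.+1 = y by rewrite npowN npow1.
have -> : npow (2 * al - 1) n.+1 = y * npow (2 * al) n.+1 by rewrite npowD ey mulrC.
have eg : npow (2 * al) n.+1 * gm mu n = S + X.
  by rewrite /gm mulrDr mulrA -npowD subrr npow0 mul1r.
have -> : npow (2 * al) n.+1 * (T - mu * npow (- 1) n.+1 * gm mu n) = X - mu * y * (S + X).
  by rewrite ey -eg /X; ring.
rewrite -mulrA -[_ * _ * gm mu n]mulrA eg.
suff : (1 + 2 * mu * y) * S <= (1 - 2 * mu * y) * X by lra.
have k0 : 0 <= 1 - 2 * mu * y.
  rewrite -(pmulr_rge0 _ (npow_gt0 (2 * al) n.+1)).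
  apply: le_trans hr; rewrite mulr_ge0 ?npow_ge0//.
  by rewrite addr_ge0// mulr_ge0// mulr_ge0.
rewrite -(ler_pM2l (npow_gt0 (2 * al) n)).
have h1 : npow (2 * al) n * ((1 + 2 * mu * y) * S) <=
    npow (2 * al) n.+1 * (1 - 2 * mu * y) * S by rewrite mulrA ler_wpM2r.
apply: (le_trans h1).
have -> : npow (2 * al) n * ((1 - 2 * mu * y) * X) =
  npow (2 * al) n.+1 * (1 - 2 * mu * y) * (npow (2 * al) n * T) by rewrite /X; ring.
by rewrite ler_wpM2l// mulr_ge0 ?npow_ge0.
Qed.

Lemma cone_forever mu n0 : 0 <= mu -> 0 <= Sm mu n0 -> cone mu n0 ->
  (forall n, (n0 <= n)%N -> cone_rate mu n) ->
  forall n, (n0 <= n)%N -> 0 <= Tm mu n.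
Proof.
move=> mu0 S0 c0 hr.
suff H n : (n0 <= n)%N -> 0 <= Sm mu n /\ cone mu n.
  move=> n /H[Sn cn]; rewrite -(pmulr_rge0 _ (npow_gt0 (2 * al) n)).
  exact: le_trans cn.
elim: n => [|n IH]; first by rewrite leqn0 => /eqP e; rewrite -e.
rewrite leq_eqVlt => /predU1P[<- //|]; rewrite ltnS => nn.
have [Sn cn] := IH nn; split; last by apply: cone_step => //; exact: hr.
have Tn : 0 <= Tm mu n.
  rewrite -(pmulr_rge0 _ (npow_gt0 (2 * al) n)); exact: le_trans cn.
by rewrite SmS addr_ge0// !mulr_ge0 ?npow_ge0// addr_ge0// mulr_ge0 ?npow_ge0.
Qed.

(** For 2 mu < al the growth 1 + 2 al y of the power exceeds the loss, which is
    1 + 4 mu y to first order, for small y = 1 / (n + 1); the bound on n depends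
    only on a majorant m of 2 mu. *)
Lemma cone_rate_large mu m n : 0 <= mu -> 2 * mu <= m -> m < al -> (0 < n)%N ->
  al * m <= (al - m) * n.+1%:R -> cone_rate mu n.
Proof.
move=> mu0 mum mal n0 hn; rewrite /cone_rate npowS -[X in _ <= X]mulrA ler_pM2l ?npow_gt0//.
have := lnstep_ge R n0; have : al * m * n.+1%:R^-1 <= al - m.
  by rewrite ler_pdivrMr.
have : 0 < (n.+1%:R^-1 : R) by rewrite invr_gt0.
move: (n.+1%:R^-1 : R) => y y0 hy hl.
have m0 : 0 <= m by lra.
have e1 : 1 + 2 * al * y <= expR (2 * al * lnstep R n).
  apply: le_trans (expR_ge1Dx _); rewrite lerD2l ler_wpM2l//; lra.
have hmy : 2 * mu * y <= m * y by rewrite ler_wpM2r// ltW.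
have my1 : m * y <= 1.
  by rewrite -(ler_pM2l al0) mulrA; lra.
have : (1 + 2 * al * y) * (1 - m * y) <= expR (2 * al * lnstep R n) * (1 - 2 * mu * y).
  have aly : 0 <= al * y by rewrite mulr_ge0 ?ltW.
  by apply: ler_pM => //; lra.
apply: le_trans.
have : al * m * y * y <= (al - m) * y by rewrite ler_wpM2r// ltW.
lra.
Qed.

(** At mu = al / 2 both sides agree to first order in y = 1 / (n + 1);
    Bernoulli's inequality (1 - y)^al <= 1 - al y, valid for al <= 1, decides. *)
Lemma cone_rate_small n : al <= 1 -> (0 < n)%N -> cone_rate (al / 2) n.
Proof.
move=> al1 n0; rewrite /cone_rate (npowSN (2 * al) n) -[X in X <= _]mulrA ler_pM2l ?npow_gt0//.
have -> : 2 * (al / 2) = al by field.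
have -> : - (2 * al * lnstep R n) = al * (- lnstep R n) + al * (- lnstep R n) by ring.
rewrite expRD.
have := @expR_bernoulli_le R al (- lnstep R n).
rewrite expR_Nlnstep// al1 ltW// => /(_ isT).
have : (n.+1%:R^-1 : R) <= 1 by rewrite invf_le1// ler1n.
have : 0 <= (n.+1%:R^-1 : R) by rewrite invr_ge0.
move: (n.+1%:R^-1 : R) => y y0 y1.
have := expR_ge0 (al * (- lnstep R n)).
move: (expR _) => E E0 hE.
have ay : 0 <= al * y <= 1.
  by rewrite mulr_ge0 ?(ltW al0)//= mulr_ile1 ?(ltW al0).
have hE' : E <= 1 - al * y by lra.
move: ay hE'; move: (al * y) => z /andP[z0 z1] hE'.
have : E * E <= (1 - z) * (1 - z) by apply: ler_pM.
nra.
Qed.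

Lemma cone_init mu : al <= 1 -> 0 <= mu -> mu <= 2^-1 -> cone mu 1 /\ 0 <= Sm mu 1.
Proof.
move=> al1 mu0 mu1; rewrite /cone SmS TmS Sm0 Tm0 /gm Sm0 Tm0 !npow_1.
by split; lra.
Qed.

(** The solution is in the cone from n = 1 on. *)
Lemma admissible_small : al <= 1 -> admissible (al / 2).
Proof.
move=> al1 [|n]; first by rewrite Tm0.
have h0 : 0 <= al / 2 by rewrite divr_ge0 ?ltW.
have h1 : al / 2 <= 2^-1 by lra.
have [c S] := cone_init al1 h0 h1.
apply: (@cone_forever (al / 2) 1) => // k k1.
by apply: cone_rate_small.
Qed.

(** The last clause keeps the solution outside the cone for large n; this forces
    T to tend to 0, and the solution to be square summable. *)
Definition subcritical mu := [/\ 0 < mu, mu < al / 2, admissible mu &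
  exists2 n0, (0 < n0)%N & forall n, (n0 <= n)%N -> npow (2 * al) n * Tm mu n <= Sm mu n].

(** A solution strictly inside the cone at a large n remains so for slightly
    larger parameters, by continuity; T is positive up to n by continuity and
    after n by the cone. *)
Lemma admissible_open mu m n : 0 <= mu -> 2 * mu < m -> m < al -> admissible mu ->
  (0 < n)%N -> al * m <= (al - m) * n.+1%:R ->
  Sm mu n < npow (2 * al) n * Tm mu n ->
  exists2 mu', mu < mu' & mu' <= al / 2 /\ admissible mu'.
Proof.
move=> mu0 mum mal adm n0 hn hc.
have N1 : \forall mu' \near mu, forall k : 'I_n.+1, 0 < Tm mu' k.
  apply: (@filter_forall _ _ (fun (k : 'I_n.+1) mu' => 0 < Tm mu' k) (nbhs mu)) => k.
  have [_ cT] := shoot_cont al k mu.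
  exact: (cvgr_gt _ cT _ (adm_Tm_gt0 mu0 adm k)).
have N2 : \forall mu' \near mu, 0 < npow (2 * al) n * Tm mu' n - Sm mu' n.
  have [cS cT] := shoot_cont al n mu.
  have c : (fun mu' => npow (2 * al) n * Tm mu' n - Sm mu' n) @ mu -->
     npow (2 * al) n * Tm mu n - Sm mu n.
    by apply: cvgB => //; apply: cvgM => //; exact: cvg_cst.
  by apply: (cvgr_gt _ c _); rewrite subr_gt0.
have N3 : \forall mu' \near mu, mu' < m / 2.
  by apply: (@cvgr_lt R R (nbhs mu) _ id mu); [exact: cvg_id|lra].
have : \forall mu' \near mu^'+, [/\ forall k : 'I_n.+1, 0 < Tm mu' k,
   0 < npow (2 * al) n * Tm mu' n - Sm mu' n, mu' < m / 2 & mu < mu'].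
  near=> mu'; split.
  - by near: mu'; exact: cvg_at_right_filter N1.
  - by near: mu'; exact: cvg_at_right_filter N2.
  - by near: mu'; exact: cvg_at_right_filter N3.
  - by near: mu'; exact: nbhs_right_gt.
move=> /(@filter_ex _ _ (at_right_proper_filter mu))[mu' [hT hC hm hmu]].
exists mu' => //; split; first lra.
have mu'0 : 0 <= mu' by lra.
have Tpos k : (k <= n)%N -> 0 <= Tm mu' k.
  by move=> kn; have := hT (Ordinal (kn : (k < n.+1)%N)) => /ltW.
have Spos k : (k <= n)%N -> 0 <= Sm mu' k.
  elim: k => [|k IH] kn; first by rewrite Sm0.
  rewrite SmS addr_ge0 ?IH ?(ltnW kn)// !mulr_ge0 ?npow_ge0// addr_ge0//.
    by rewrite mulr_ge0 ?npow_ge0 ?IH// ltnW.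
  by rewrite Tpos// ltnW.
move=> k; have [kn|nk] := leqP k n; first exact: Tpos.
apply: (@cone_forever mu' n) => //; last exact: ltnW.
- exact: Spos.
- by rewrite /cone; lra.
- move=> j nj; apply: (@cone_rate_large _ m) => //; first lra.
    exact: leq_trans nj.
  apply: (le_trans hn); rewrite ler_wpM2l ?ler_nat//; lra.
Unshelve. all: by end_near. Qed.

(** The supremum of the admissible parameters below al / 2 is admissible, since
    the condition is closed. If it is below al / 2, then by [admissible_open]
    its solution is never inside the cone at a large n. *)
Lemma dichotomy : admissible (al / 2) \/ exists mu, subcritical mu.
Proof.
have [|nadm] := pselect (admissible (al / 2)); [by left|right].
pose L := [set mu | [/\ 0 <= mu, mu <= al / 2 & admissible mu]].
have L0 : L 0.
  split => [//||n]; first by rewrite divr_ge0 ?ltW.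
  suff -> : Tm 0 n = 1 by [].
  by elim: n => [|n IH]; rewrite ?Tm0// TmS IH !mul0r subr0.
have hL : has_sup L.
  by split; [exists 0|exists (al / 2) => mu []].
pose mu := sup L; exists mu.
have mu_ub nu : L nu -> nu <= mu by move=> Lnu; apply: ub_le_sup => //; case: hL.
have mu0 : 0 <= mu by exact: mu_ub.
have mu1 : mu <= al / 2 by apply: ge_sup; [exists 0|move=> nu []].
have adm : admissible mu.
  move=> n; rewrite leNgt; apply/negP => Tneg.
  have [_ cT] := shoot_cont al n mu.
  have [e /= e0 he] := (nbhs_ballP mu _).1 (cvgr_lt _ cT _ Tneg).
  have [nu Lnu hnu] := sup_adherent e0 hL.
  have : Tm nu n < 0.
    apply: he; rewrite /ball /= ger0_norm ?subr_ge0 ?mu_ub//.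
    by rewrite ltrBlDr addrC -ltrBlDr.
  by rewrite ltNge; case: Lnu => _ _ ->.
have mu2 : mu < al / 2.
  rewrite lt_neqAle mu1 andbT; apply/eqP => e; apply: nadm; rewrite -e; exact: adm.
(* Any m strictly between 2 mu and al would do. *)
pose m := (2 * mu + al) / 2.
pose n0 := (Num.truncn (al * m / (al - m))).+1.
have hn0 n : (n0 <= n)%N -> al * m <= (al - m) * n.+1%:R.
  move=> nn; have dm : 0 < al - m by rewrite /m; lra.
  rewrite [leRHS]mulrC -ler_pdivrMr//.
  have : al * m / (al - m) < n0%:R by rewrite /n0; exact: truncnS_gt.
  move=> /ltW h; apply: (le_trans h); rewrite ler_nat; exact: leq_trans nn (leqnSn n).
have key n : (n0 <= n)%N -> npow (2 * al) n * Tm mu n <= Sm mu n.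
  move=> nn; rewrite leNgt; apply/negP => hc.
  have [|||mu' lt [le' adm']] := @admissible_open mu m n mu0 _ _ adm _ (hn0 _ nn) hc.
  - by rewrite /m; lra.
  - by rewrite /m; lra.
  - exact: leq_trans nn.
  have : L mu' by split => //; lra.
  by move=> /mu_ub; lra.
split => //; last by exists n0.
rewrite lt_neqAle mu0 andbT; apply/negP => /eqP e.
have := key n0 (leqnn _); rewrite -e.
have -> : Tm 0 n0 = 1.
  by elim: n0 {hn0 key} => [|n IH]; rewrite ?Tm0// TmS IH !mul0r subr0.
have -> : Sm 0 n0 = 0.
  by elim: n0 {hn0 key} => [|n IH]; rewrite ?Sm0// SmS IH !mul0r addr0.
by rewrite mulr1 leNgt npow_gt0.
Qed.

End dichotomy.

(** * Square summable sequences *)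

Section sequences.
Variable R : realType.
Implicit Types (x u v : nat -> R) (n N K : nat).

Lemma cvg0P u : u @ \oo --> 0 <->
  forall e : R, 0 < e -> exists K, forall n, (K <= n)%N -> `|u n| <= e.
Proof.
split=> [/cvgr0Pnorm_le h e e0|h].
  by have [K _ hK] := h e e0; exists K => n Kn; exact: hK.
apply/cvgr0Pnorm_le => e e0; have [K hK] := h e e0.
by exists K => // n /= Kn; exact: hK.
Qed.

Lemma npow_cvg0 (s : R) : 0 < s -> (fun n => npow (- s) n) @ \oo --> 0.
Proof.
move=> s0; apply/cvg0P => e e0.
exists (Num.truncn (expR (- ln e / s))).+1 => n hn.
rewrite ger0_norm ?npow_ge0// -[leRHS]lnK ?posrE// ler_expR mulNr lerNl.
rewrite mulrC -ler_pdivrMr// -ler_expR lnK ?posrE ?ltr0n ?(leq_trans _ hn)//.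
rewrite ltW// (lt_le_trans (truncnS_gt _))// ler_nat//.
Qed.

Definition l2 x := exists C, forall N, \sum_(k < N) x k ^+ 2 <= C.

Lemma l2_cvg x : l2 x -> cvgn (fun N => \sum_(k < N) x k ^+ 2).
Proof.
move=> [C hC]; apply: nondecreasing_is_cvgn; last by exists C => _ [N _ <-].
by apply/nondecreasing_seqP => N; rewrite big_ord_recr lerDl sqr_ge0.
Qed.

Lemma l2_tail x (e : R) : l2 x -> 0 < e -> exists K, forall n, (K <= n)%N ->
  \sum_(K <= k < n) x k ^+ 2 <= e.
Proof.
move=> /l2_cvg cx e0.
have /cvgrPdist_le h := cx; have [K _ hK] := h (e / 2) ltac:(lra).
exists K => n Kn.
have := hK n Kn; have := hK K (leqnn K) => /=.
have -> : \sum_(k < n) x k ^+ 2 = \sum_(k < K) x k ^+ 2 + \sum_(K <= k < n) x k ^+ 2.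
  by rewrite -!(big_mkord xpredT (fun k => x k ^+ 2)) -big_cat_nat.
rewrite !ler_norml; lra.
Qed.

Lemma l2_ge0 x C N : (forall N, \sum_(k < N) x k ^+ 2 <= C) ->
  0 <= C.
Proof. by move=> /(_ 0%N); rewrite big_ord0. Qed.

End sequences.

Section averages.
Variables (R : realType) (al : R).
Hypothesis al0 : 0 < al.
Implicit Types (x : nat -> R).

(** Split the sum at K. The first part is killed by n^(- al). For the second,
    the weighted Cauchy-Schwarz inequality 2 A X <= h A^2 + X^2 / h bounds it by
    the tail of the squares of x, because the sum of the m^(2 al - 1) is of
    order n^(2 al). *)
Lemma wsum_small x : l2 x -> (fun n => npow (- al) n * wsum al x n) @ \oo --> 0.
Proof.
move=> xl2; apply/cvg0P => e e0.
have [|C C0 hC] := @sum_npow_p_bnd R (2 * al); first by rewrite mulr_gt0.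
pose d := e / 2; have d0 : 0 < d by rewrite /d; lra.
pose h := d / C; have h0 : 0 < h by rewrite divr_gt0.
have [K hK] := l2_tail xl2 (mulr_gt0 h0 d0).
have cK : (fun n => npow (- al) n * wsum al x K) @ \oo --> 0.
  by rewrite -(mul0r (wsum al x K)); apply: cvgMr_tmp; exact: npow_cvg0.
have [K2 hK2] := (cvg0P _).1 cK d d0.
exists (maxn K.+1 K2) => n; rewrite geq_max => /andP[Kn K2n].
have -> : wsum al x n = wsum al x K + \sum_(K <= k < n) npow (al - 2^-1) k.+1 * x k.
  by rewrite /wsum -!(big_mkord xpredT (fun k => npow (al - 2^-1) k.+1 * x k)) -big_cat_nat// ltnW.
rewrite mulrDr (le_trans (ler_normD _ _))//.
have -> : e = d + d by rewrite /d; lra.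
apply: lerD; first exact: hK2.
rewrite normrM ger0_norm ?npow_ge0//.
have step k : npow (- al) n * `|npow (al - 2^-1) k.+1 * x k| <=
   2^-1 * (h * npow (- (2 * al)) n * npow (2 * al - 1) k.+1 + h^-1 * x k ^+ 2).
  rewrite normrM ger0_norm ?npow_ge0// mulrA.
  have -> : npow (- (2 * al)) n = npow (- al) n ^+ 2 by rewrite npow_sqr mulrN.
  have -> : npow (2 * al - 1) k.+1 = npow (al - 2^-1) k.+1 ^+ 2.
    by rewrite npow_sqr; have -> : 2 * (al - 2^-1) = 2 * al - 1 by field.
  rewrite -[h * _ * _]mulrA -exprMn -[x k ^+ 2]real_normK ?num_real//.
  move: (_ * npow (al - 2^-1) k.+1) `|x k| => A X.
  rewrite -subr_ge0; have -> : 2^-1 * (h * A ^+ 2 + h^-1 * X ^+ 2) - A * X =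
     2^-1 * h^-1 * (h * A - X) ^+ 2 by field; rewrite gt_eqF.
  by rewrite mulr_ge0 ?sqr_ge0// mulr_ge0// invr_ge0 ltW.
apply: (@le_trans _ _ (\sum_(K <= k < n) npow (- al) n * `|npow (al - 2^-1) k.+1 * x k|)).
  by rewrite -mulr_sumr ler_wpM2l ?npow_ge0// ler_norm_sum.
apply: (le_trans (ler_sum _ (fun k _ => step k))).
rewrite -mulr_sumr big_split /= -!mulr_sumr.
have h1 : \sum_(K <= k < n) npow (2 * al - 1) k.+1 <= C * npow (2 * al) n.
  case: n Kn {K2n step} => // n Kn; apply: le_trans (hC n).
  rewrite -(big_mkord xpredT (fun k => npow (2 * al - 1) k.+1)).
  rewrite [leRHS](big_cat_nat (leq0n K) (ltnW Kn))/= lerDr sumr_ge0// => k _.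
  exact: npow_ge0.
have h2 := hK n (ltnW Kn).
have h3 : h * npow (- (2 * al)) n * \sum_(K <= k < n) npow (2 * al - 1) k.+1 <= d.
  have -> : d = h * npow (- (2 * al)) n * (C * npow (2 * al) n).
    by rewrite npowN /h; field; rewrite ?npow_neq0 ?(gt_eqF C0).
  by rewrite ler_wpM2l// mulr_ge0 ?npow_ge0// ltW.
have h4 : h^-1 * \sum_(K <= k < n) x k ^+ 2 <= d.
  by rewrite mulrC ler_pdivrMr// mulrC.
lra.
Qed.

End averages.

(** * The ground state of a subcritical parameter *)

Section ground_state.
Variables (R : realType) (al mu : R).
Hypothesis al0 : 0 < al.
Hypothesis sub : subcritical al mu.
Implicit Types (n k N : nat).
Local Notation Sm := (Sm al mu).
Local Notation Tm := (Tm al mu).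
Local Notation gm := (gm al mu).

Let mup : 0 < mu. Proof. by case: sub. Qed.
Let mu0 : 0 <= mu. Proof. exact: ltW. Qed.
Let adm : admissible al mu. Proof. by case: sub. Qed.

(** The sequence x whose sums S_n are the shooting solution. *)
Definition ground k : R := mu * npow (al - 2^-1) k.+1 * gm k.

Lemma ground_gt0 k : 0 < ground k.
Proof. by rewrite /ground !mulr_gt0 ?npow_gt0// adm_gm_gt0. Qed.

Lemma wsum_ground n : wsum al ground n = Sm n.
Proof.
elim: n => [|n IH]; first by rewrite wsum0 Sm0.
rewrite wsumS IH SmS /ground; congr (_ + _).
have -> : 2 * al - 1 = (al - 2^-1) + (al - 2^-1) by field.
by rewrite (npowD (al - 2^-1) (al - 2^-1)); ring.
Qed.

Let a n : R := npow (- al) n * Sm n.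

Lemma a_sqr n : a n ^+ 2 = npow (- (2 * al)) n * Sm n ^+ 2.
Proof. by rewrite /a exprMn npow_sqr mulrN. Qed.

(** Outside the cone g <= 2 n^(- 2 al) S, so that S grows at most by the factor
    1 / (1 - 2 mu / (n + 1)). As 2 mu < al, this is less than the growth of
    n^al, and a = n^(- al) S decreases at the rate of a multiple of 1/n. *)
Lemma ground_decay : exists n1, forall n, (n1 <= n)%N ->
  Tm n.+1 <= npow (- (2 * al)) n.+1 * Sm n.+1 /\
  (al - 2 * mu) * (n.+1%:R^-1 * a n.+1 ^+ 2) <= a n ^+ 2 - a n.+1 ^+ 2.
Proof.
case: (sub) => _ mual _ [n0 n00 hn0].
have al1 := al0; have mup1 := mup.
pose d := al - 2 * mu; have d0 : 0 < d by rewrite /d; lra.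
pose n1 := maxn n0 (Num.truncn (4 * al * (2 * mu) / d)).+1.
exists n1 => n n1n.
have hT : Tm n.+1 <= npow (- (2 * al)) n.+1 * Sm n.+1.
  rewrite -(ler_pM2l (npow_gt0 (2 * al) n.+1)) mulrA -npowD subrr npow0 mul1r.
  by apply: hn0; rewrite (leq_trans _ (leqnSn n))// (leq_trans _ n1n)// leq_maxl.
split => //.
have n_gt0 : (0 < n)%N by rewrite (leq_trans n00)// (leq_trans _ n1n)// leq_maxl.
have hy : 4 * al * (2 * mu) * (n.+1%:R^-1) <= d.
  rewrite ler_pdivrMr// [leRHS]mulrC -ler_pdivrMr//.
  apply: (@le_trans _ _ n1%:R); last by rewrite ler_nat (leq_trans n1n).
  apply: (@le_trans _ _ (Num.truncn (4 * al * (2 * mu) / d)).+1%:R).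
    exact/ltW/truncnS_gt.
  by rewrite ler_nat leq_maxr.
have y0 : 0 <= (n.+1%:R^-1 : R) by rewrite invr_ge0.
have hl := lnstep_ge R n_gt0.
have S1 : Sm n.+1 * (1 - 2 * mu * n.+1%:R^-1) <= Sm n.
  have hg : gm n <= 2 * (npow (- (2 * al)) n.+1 * Sm n.+1).
    by rewrite gm_post; lra.
  have e : Sm n.+1 - Sm n = mu * npow (2 * al - 1) n.+1 * gm n.
    by rewrite SmS; ring.
  have : mu * npow (2 * al - 1) n.+1 * gm n <=
     mu * npow (2 * al - 1) n.+1 * (2 * (npow (- (2 * al)) n.+1 * Sm n.+1)).
    by rewrite ler_wpM2l// mulr_ge0 ?npow_ge0.
  have -> : mu * npow (2 * al - 1) n.+1 * (2 * (npow (- (2 * al)) n.+1 * Sm n.+1)) =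
     2 * mu * n.+1%:R^-1 * Sm n.+1.
    rewrite -(@npow1 R n.+1)// -npowN.
    rewrite (@npow_split _ (2 * al - 1) (- (2 * al)) (- 1)); last by ring.
    by ring.
  by rewrite -e; move: (n.+1%:R^-1 : R) => y; lra.
have Sp := adm_Sm_ge0 mu0 adm n.+1.
rewrite !a_sqr (npowSN (- (2 * al)) n) mulNr opprK -mulrA.
have e1 : 1 + 2 * al * n.+1%:R^-1 <= expR (2 * al * lnstep R n).
  apply: le_trans (expR_ge1Dx _); rewrite lerD2l ler_wpM2l//; lra.
move: y0 hy S1 e1; move: (n.+1%:R^-1 : R) => y y0 hy S1 e1.
set q := npow _ _; have q0 : 0 <= q by exact: npow_ge0.
have ym : 2 * mu * y <= 1.
  rewrite -(ler_pM2l al0); have : 0 <= al * (2 * mu * y) by rewrite !mulr_ge0 ?(ltW al0) ?mu0.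
  move: hy; rewrite /d; lra.
have z0 : 0 <= (1 - 2 * mu * y) by lra.
have S2 : Sm n.+1 ^+ 2 * (1 - 2 * mu * y) ^+ 2 <= Sm n ^+ 2.
  rewrite -exprMn ler_sqr ?nnegrE ?adm_Sm_ge0// mulr_ge0//.
have : (1 + 2 * al * y) * (Sm n.+1 ^+ 2 * (1 - 2 * mu * y) ^+ 2) <=
    expR (2 * al * lnstep R n) * Sm n ^+ 2.
  apply: ler_pM => //; last by rewrite mulr_ge0 ?sqr_ge0.
  by rewrite addr_ge0// !mulr_ge0// ltW.
have key : 1 + d * y <= (1 + 2 * al * y) * (1 - 2 * mu * y) ^+ 2.
  have hy' : 4 * al * (2 * mu) * y * y <= d * y by rewrite ler_wpM2r.
  have : 0 <= (2 * mu * y) ^+ 2 * (1 + 2 * al * y).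
    by rewrite mulr_ge0 ?sqr_ge0// addr_ge0// !mulr_ge0// ltW.
  rewrite /d in hy' *; lra.
have := ler_wpM2r (sqr_ge0 (Sm n.+1)) key.
move: (expR _) => E h1 h2.
have : d * y * Sm n.+1 ^+ 2 <= E * Sm n ^+ 2 - Sm n.+1 ^+ 2 by lra.
move=> /(ler_wpM2l q0); rewrite /d; lra.
Qed.

(** By [ground_decay] the squares of the entries are bounded by multiples of
    differences of a^2, which telescope. *)
Lemma ground_l2 : l2 ground.
Proof.
case: (sub) => _ mual _ _; have mup1 := mup.
pose d := al - 2 * mu; have d0 : 0 < d by rewrite /d; lra.
have [n1 h] := ground_decay.
have hx n : (n1 <= n)%N -> ground n ^+ 2 <= 4 * mu ^+ 2 / d * (a n ^+ 2 - a n.+1 ^+ 2).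
  move=> nn; have [hT] := h n nn; rewrite -/d => hd.
  have : 4 * mu ^+ 2 * (n.+1%:R^-1 * a n.+1 ^+ 2) <= 4 * mu ^+ 2 / d * (a n ^+ 2 - a n.+1 ^+ 2).
    rewrite -[leRHS]mulrA ler_wpM2l//; first by rewrite mulr_ge0 ?sqr_ge0.
    by rewrite [leRHS]mulrC ler_pdivlMr// mulrC.
  apply: le_trans.
  have hg : gm n <= 2 * (npow (- (2 * al)) n.+1 * Sm n.+1).
    by rewrite gm_post; lra.
  have g0 := adm_gm_ge0 mu0 adm n.
  rewrite /ground a_sqr !exprMn npow_sqr.
  have hg2 : gm n ^+ 2 <= (2 * (npow (- (2 * al)) n.+1 * Sm n.+1)) ^+ 2.
    by rewrite ler_sqr ?nnegrE// (le_trans g0).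
  have : mu ^+ 2 * npow (2 * (al - 2^-1)) n.+1 * gm n ^+ 2 <=
    mu ^+ 2 * npow (2 * (al - 2^-1)) n.+1 * (2 * (npow (- (2 * al)) n.+1 * Sm n.+1)) ^+ 2.
    by rewrite ler_wpM2l//; apply: mulr_ge0; [exact: sqr_ge0|exact: npow_ge0].
  move=> /le_trans; apply.
  rewrite -(@npow1 R n.+1)// -npowN.
  rewrite (@npow_split _ (2 * (al - 2^-1)) (- (2 * al)) (- 1)); last by field.
  by rewrite le_eqVlt; apply/orP; left; apply/eqP; ring.
exists (\sum_(k < n1) ground k ^+ 2 + 4 * mu ^+ 2 / d * a n1 ^+ 2) => N.
have c0 : 0 <= 4 * mu ^+ 2 / d.
  by apply: divr_ge0; [apply: mulr_ge0 => //; exact: sqr_ge0|exact: ltW].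
have [nN|/ltnW Nn] := leqP n1 N; last first.
  apply: (@le_trans _ _ (\sum_(k < n1) ground k ^+ 2)).
    rewrite -!(big_mkord xpredT (fun k => ground k ^+ 2)) [leRHS](big_cat_nat (leq0n N) Nn)/=.
    by rewrite lerDl sumr_ge0// => k _; exact: sqr_ge0.
  by rewrite lerDl mulr_ge0 ?sqr_ge0.
rewrite -!(big_mkord xpredT (fun k => ground k ^+ 2)) [leLHS](big_cat_nat (leq0n n1) nN)/=.
rewrite lerD2l.
apply: (@le_trans _ _ (4 * mu ^+ 2 / d * (a n1 ^+ 2 - a N ^+ 2))); last first.
  by rewrite ler_wpM2l// gerBl sqr_ge0.
rewrite -opprB -(telescope_sumr (fun k => a k ^+ 2) nN) -sumrN mulr_sumr.
rewrite big_nat [leRHS]big_nat; apply: ler_sum => k /andP[nk _].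
by rewrite opprB; exact: hx.
Qed.

Lemma ground_cvg0 : a @ \oo --> 0.
Proof.
have := wsum_small al0 ground_l2; rewrite /a.
by under eq_fun do rewrite wsum_ground.
Qed.

Lemma Tm_tail n M : (n <= M)%N ->
  Tm n - Tm M = \sum_(n <= k < M) npow (- 2^-1 - al) k.+1 * ground k.
Proof.
move=> nM; rewrite -opprB -(telescope_sumr Tm nM) -sumrN; apply: eq_bigr => k _.
rewrite TmS /ground opprB opprD opprK addrA subrr add0r.
rewrite (@npow_split _ (- 2^-1 - al) (al - 2^-1) (- 1)); last by field.
by ring.
Qed.

Lemma TmSm_le : \forall n \near \oo, Tm n <= npow (- (2 * al)) n * Sm n.
Proof.
have [n1 h] := ground_decay; exists n1.+1 => // -[//|n] /=; rewrite ltnS => nn.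
by have [] := h n nn.
Qed.

Lemma Tm_cvg0 : Tm @ \oo --> 0.
Proof.
apply: (@squeeze_cvgr _ _ _ _ (fun=> 0) (fun n => npow (- al) n * a n)).
- near=> n; rewrite (adm _)/= /a mulrA -npowD.
  have -> : - al - al = - (2 * al) by ring.
  by near: n; exact: TmSm_le.
- exact: cvg_cst.
- by rewrite -(mulr0 0); apply: cvgM; [exact: npow_cvg0|exact: ground_cvg0].
Unshelve. all: by end_near. Qed.

(** The Picone defect of the solution itself is zero, and the boundary term is
    mu T S, which tends to 0: the ground state attains the norm. *)
Lemma ground_rayleigh : (fun N => \sum_(k < N) ground k ^+ 2 - mu * qform al ground N)
  @ \oo --> 0.
Proof.
have e N : \sum_(k < N.+1) ground k ^+ 2 - mu * qform al ground N.+1 =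
    mu * (Tm N.+1 * Sm N.+1).
  rewrite (picone mu0 adm mup) sum_by_parts !wsum_ground.
  rewrite [X in _ + X - _]big1 => [|k _].
    rewrite addr0 gm_post; field; by rewrite gt_eqF ?adm_Sm_gt0.
  rewrite /picone_rem !wsum_ground !divff ?gt_eqF ?adm_Sm_gt0//.
  by rewrite subrr expr0n mulr0.
apply: (@cvg_trans _ ((fun N => mu * (Tm N * Sm N)) @ \oo)).
  by apply: near_eq_cvg; exists 1%N => // -[//|N] _; rewrite e.
have -> : nbhs (0 : R) = nbhs (mu * 0) by rewrite mulr0.
apply: cvgMl_tmp.
apply: (@squeeze_cvgr _ _ _ _ (fun=> 0) (fun n => a n * a n)).
- near=> n; rewrite mulr_ge0 ?adm_Sm_ge0//=.
  have -> : a n * a n = npow (- (2 * al)) n * Sm n * Sm n.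
    by rewrite -expr2 a_sqr; ring.
  rewrite ler_wpM2r ?adm_Sm_ge0//.
  by near: n; exact: TmSm_le.
- exact: cvg_cst.
- by rewrite -(mulr0 0); apply: cvgM; exact: ground_cvg0.
Unshelve. all: by end_near. Qed.

(** The row splits at the diagonal into a multiple of S and one of T_n - T_M. *)
Lemma ground_eigen n :
  (fun M => \sum_(m < M) kern al n m * ground m) @ \oo --> mu^-1 * ground n.
Proof.
have e M : (n < M)%N -> \sum_(m < M) kern al n m * ground m =
    npow (- 2^-1 - al) n.+1 * Sm n.+1 + npow (al - 2^-1) n.+1 * (Tm n.+1 - Tm M).
  move=> nM; rewrite -(big_mkord xpredT (fun m => kern al n m * ground m)).
  rewrite (big_cat_nat (leq0n n.+1) nM)/=; congr (_ + _).
    rewrite -wsum_ground /wsum mulr_sumr big_mkord; apply: eq_bigr => m _.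
    by rewrite kern_le -?mulrA// -ltnS.
  rewrite (Tm_tail nM) mulr_sumr [LHS]big_nat [RHS]big_nat; apply: eq_bigr => m /andP[nm _].
  by rewrite kernC kern_le ?(ltnW nm)//; ring.
have -> : mu^-1 * ground n = npow (- 2^-1 - al) n.+1 * Sm n.+1 + npow (al - 2^-1) n.+1 * (Tm n.+1 - 0).
  rewrite /ground !mulrA mulVf ?gt_eqF// mul1r gm_post subr0.
  rewrite (@npow_split _ (al - 2^-1) (- (2 * al)) (- 2^-1 - al)); last by field.
  by ring.
apply: (@cvg_trans _ ((fun M => npow (- 2^-1 - al) n.+1 * Sm n.+1 +
    npow (al - 2^-1) n.+1 * (Tm n.+1 - Tm M)) @ \oo)).
  by apply: near_eq_cvg; exists n.+1 => // M /= nM; rewrite e.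
apply: cvgD; first exact: cvg_cst.
by apply: cvgMl_tmp; apply: cvgB; [exact: cvg_cst|exact: Tm_cvg0].
Qed.

End ground_state.

(** * A linear system without decaying solutions *)

Section perturbation.
Variable R : realType.
Implicit Types (u c d : nat -> R) (n N M : nat) (B : R).

Lemma natr_inv_ge1 n (B : R) : 0 <= B -> (Num.truncn B < n)%N -> B * n%:R^-1 <= 1.
Proof.
move=> B0 Bn; rewrite ler_pdivrMr ?ltr0n ?(leq_ltn_trans _ Bn)// mul1r.
by rewrite (le_trans (ltW (truncnS_gt B)))// ler_nat.
Qed.

(** Makes sums of inverse squares telescope. *)
Lemma inv_sqr_step n : (0 < n)%N ->
  (n%:R^-1 : R) ^+ 2 <= 2 * (n%:R^-1 - n.+1%:R^-1).
Proof.
move=> n0; have hn : (1 : R) <= n%:R by rewrite ler1n.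
have n1 : (0 : R) < n%:R by rewrite ltr0n.
rewrite -[n.+1%:R]natr1; move: (n%:R : R) hn n1 => z z1 z0.
rewrite -subr_ge0.
have -> : 2 * (z^-1 - (z + 1)^-1) - z^-1 ^+ 2 = (z - 1) / (z ^+ 2 * (z + 1)).
  by field; rewrite ?gt_eqF//; lra.
rewrite divr_ge0//; first by lra.
by rewrite mulr_ge0 ?sqr_ge0//; lra.
Qed.

(** The increments are summed from infinity, where u vanishes. *)
Lemma tail_bound u B N : u @ \oo --> 0 -> (0 < N)%N -> 0 <= B ->
  (forall n, (N <= n)%N -> `|u n.+1 - u n| <= B * n%:R^-1 ^+ 2) ->
  forall n, (N <= n)%N -> `|u n| <= 2 * B * n%:R^-1.
Proof.
move=> u0 N0 B0 h n Nn.
have hM k : `|u n - u (n + k)%N| <= 2 * B * (n%:R^-1 - (n + k)%:R^-1).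
  elim: k => [|k IH]; first by rewrite addn0 !subrr normr0 mulr0.
  have -> : u n - u (n + k.+1)%N = (u n - u (n + k)%N) + (u (n + k)%N - u (n + k).+1).
    by rewrite addnS; ring.
  apply: (le_trans (ler_normD _ _)).
  have nk : (N <= n + k)%N by rewrite (leq_trans Nn)// leq_addr.
  have nk0 : (0 < n + k)%N by rewrite (leq_trans N0).
  have := h _ nk; rewrite distrC; move: (inv_sqr_step nk0) => /(ler_wpM2l B0).
  rewrite addnS; move: IH.
  move: (n%:R^-1 : R) ((n + k)%:R^-1 : R) ((n + k).+1%:R^-1 : R) => z w v; lra.
apply/ler_addgt0Pr => e e0.
have [K hK] := (cvg0P _).1 u0 e e0.
have := hM K; have := hK (n + K)%N (leq_addl _ _).
have -> : u n = (u n - u (n + K)%N) + u (n + K)%N by ring.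
have h0 : 0 <= 2 * B * (n + K)%:R^-1 by rewrite !mulr_ge0 ?invr_ge0.
move=> h1 h2; apply: (le_trans (ler_normD _ _)).
rewrite {1}(_ : u n - _ + _ - _ = u n - u (n + K)%N) in h2 *; last by ring.
move: h2 h1; rewrite mulrBr; lra.
Qed.

Section system.
Variables (c d : nat -> R) (al th K : R) (n0 : nat).
Hypotheses (al0 : 0 < al) (th0 : 0 <= th) (K0 : 0 <= K) (n00 : (0 < n0)%N).
Hypotheses (cv0 : c @ \oo --> 0) (dv0 : d @ \oo --> 0).
Hypothesis hc : forall n, (n0 <= n)%N ->
  `|c n.+1 - c n + al * n%:R^-1 * d n| <= K * n%:R^-1 ^+ 2 * (`|c n| + `|d n|).
Hypothesis hd : forall n, (n0 <= n)%N ->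
  `|d n.+1 - d n - th * n%:R^-1 * c n| <= K * n%:R^-1 ^+ 2 * (`|c n| + `|d n|).

(** For th > 0 the unperturbed system rotates along the ellipses th c^2 + al d^2
    = const. The perturbation multiplies this energy by a factor at least 1 - L
    / n^2; the product of these factors stays positive, so a solution that tends
    to 0 has zero energy. *)
Lemma elliptic_zero : 0 < th -> exists N, forall n, (N <= n)%N -> c n = 0 /\ d n = 0.
Proof.
move=> thp; have al1 := al0; have K1 := K0.
pose H n := th * c n ^+ 2 + al * d n ^+ 2.
have H0 n : 0 <= H n by rewrite addr_ge0// mulr_ge0 ?sqr_ge0// ltW.
pose L := 2 * K * (1 + (al + th) * (th^-1 + al^-1)).
have L0 : 0 <= L.
  by rewrite /L mulr_ge0 ?mulr_ge0// addr_ge0// mulr_ge0 ?addr_ge0 ?invr_ge0// ltW.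
have step n : (n0 <= n)%N -> (1 - L * n%:R^-1 ^+ 2) * H n <= H n.+1.
  move=> nn; have := hc nn; have := hd nn; have := H0 n; rewrite /H.
  move: (c n) (d n) (c n.+1) (d n.+1) (n%:R^-1 : R) => C D C' D' z HH h1 h2.
  set e1 := C' - C + _ in h2; set e2 := D' - D - _ in h1.
  have -> : C' = C - al * z * D + e1 by rewrite /e1; ring.
  have -> : D' = D + th * z * C + e2 by rewrite /e2; ring.
  have z2 : 0 <= z ^+ 2 := sqr_ge0 z.
  have b1 : th * C * e1 >= - (th * `|C| * (K * z ^+ 2 * (`|C| + `|D|))).
    rewrite lerNl -mulrN (le_trans (ler_norm _))// !normrM normrN ger0_norm//.
    by rewrite ler_wpM2l// mulr_ge0.
  have b2 : al * D * e2 >= - (al * `|D| * (K * z ^+ 2 * (`|C| + `|D|))).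
    rewrite lerNl -mulrN (le_trans (ler_norm _))// !normrM normrN (ger0_norm (ltW al0)).
    by rewrite ler_wpM2l// mulr_ge0// ltW.
  have s1 : 0 <= th * (- (al * z * D) + e1) ^+ 2 by rewrite mulr_ge0 ?sqr_ge0.
  have s2 : 0 <= al * (th * z * C + e2) ^+ 2 by rewrite mulr_ge0 ?sqr_ge0// ltW.
  have q : (`|C| + `|D|) * (th * `|C| + al * `|D|) <=
      (1 + (al + th) * (th^-1 + al^-1)) * (th * C ^+ 2 + al * D ^+ 2).
    rewrite -[C ^+ 2]real_normK ?num_real// -[D ^+ 2]real_normK ?num_real//.
    have := normr_ge0 C; have := normr_ge0 D.
    move: (`|C|) (`|D|) => X Y Y0 X0.
    have -> : (1 + (al + th) * (th^-1 + al^-1)) * (th * X ^+ 2 + al * Y ^+ 2) =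
      (th * X ^+ 2 + al * Y ^+ 2) + (al + th) * (X ^+ 2 + Y ^+ 2 +
         th / al * X ^+ 2 + al / th * Y ^+ 2).
      by field; rewrite !gt_eqF.
    have : (al + th) * (X * Y) <= (al + th) * (X ^+ 2 + Y ^+ 2 +
         th / al * X ^+ 2 + al / th * Y ^+ 2).
      apply: ler_wpM2l; first by lra.
      have : 0 <= th / al * X ^+ 2 by rewrite mulr_ge0 ?sqr_ge0 ?divr_ge0// ltW.
      have : 0 <= al / th * Y ^+ 2 by rewrite mulr_ge0 ?sqr_ge0 ?divr_ge0// ltW.
      have := sqr_ge0 (X - Y); nra.
    lra.
  have := ler_wpM2l (mulr_ge0 (mulr_ge0 (ler0n R 2) K0) z2) q.
  rewrite /L; lra.
pose N := maxn n0 (Num.truncn (4 * L)).+1.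
have main n k : (N <= n)%N -> (1 - 2 * L * (n%:R^-1 - (n + k)%:R^-1)) * H n <= H (n + k)%N.
  move=> Nn; elim: k => [|k IH]; first by rewrite addn0 subrr mulr0 subr0 mul1r.
  rewrite addnS; apply: le_trans (step (n + k)%N _); last first.
    by rewrite (leq_trans _ (leq_addr _ _))// (leq_trans _ Nn)// leq_maxl.
  have nk0 : (0 < n + k)%N by rewrite (leq_trans _ (leq_addr _ _))// (leq_trans _ Nn)// leq_max ltnS orbT.
  have n_0 : (0 < n)%N by rewrite (leq_trans _ Nn)// leq_max ltnS orbT.
  have hs := inv_sqr_step nk0.
  have hL : 4 * L * n%:R^-1 <= 1.
    by apply: natr_inv_ge1; [exact: mulr_ge0|exact: leq_trans (leq_maxr _ _) Nn].
  have hnk : ((n + k)%:R^-1 : R) <= n%:R^-1.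
    by rewrite lef_pV2 ?posrE ?ltr0n// ler_nat leq_addr.
  have hnk0 : (0 : R) <= (n + k)%:R^-1 by rewrite invr_ge0.
  have hn1 : (n%:R^-1 : R) <= 1 by rewrite invf_le1 ?ltr0n// ler1n.
  have hq : 0 <= 1 - L * (n + k)%:R^-1 ^+ 2.
    have : (n + k)%:R^-1 ^+ 2 <= (n%:R^-1 : R).
      by rewrite expr2 (le_trans (ler_pM _ _ hnk (le_trans hnk hn1)))// mulr1.
    move=> /(ler_wpM2l L0).
    have : 0 <= L * n%:R^-1 by rewrite mulr_ge0 ?invr_ge0.
    lra.
  apply: le_trans (ler_wpM2l hq IH).
  rewrite [leRHS]mulrA; apply: ler_wpM2r; first exact: H0.
  move: hs hL hnk hnk0 hq => /(ler_wpM2l L0).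
  move: (n%:R^-1 : R) hn1 ((n + k)%:R^-1 : R) ((n + k).+1%:R^-1 : R) => z z1 w v hs hL hnk hnk0 hq.
  have : 0 <= L * w ^+ 2 * (2 * L * (z - w)).
    apply: mulr_ge0; first by apply: mulr_ge0 => //; exact: sqr_ge0.
    by apply: mulr_ge0; [exact: mulr_ge0|rewrite subr_ge0].
  lra.
exists N => n Nn.
have Hn : H n = 0.
  apply/eqP; rewrite eq_le H0 andbT leNgt; apply/negP => Hp.
  have cH : H @ \oo --> 0.
    have -> : nbhs (0 : R) = nbhs (th * (0 * 0) + al * (0 * 0)) by rewrite !mul0r !mulr0 addr0.
    by apply: cvgD; apply: cvgMl_tmp; under eq_fun do rewrite expr2; exact: cvgM.
  have [|M hM] := (cvg0P _).1 cH (H n / 4); first by rewrite divr_gt0.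
  have := hM (n + M)%N (leq_addl _ _); rewrite ger0_norm// => h1.
  have := le_trans (main n M Nn) h1.
  have hL : 4 * L * n%:R^-1 <= 1.
    by apply: natr_inv_ge1; [exact: mulr_ge0|exact: leq_trans (leq_maxr _ _) Nn].
  have : 0 <= 2 * L * (n + M)%:R^-1 * H n.
    apply: mulr_ge0; last exact: H0.
    by apply: mulr_ge0; [exact: mulr_ge0|rewrite invr_ge0].
  have : 4 * L * n%:R^-1 * H n <= 1 * H n by apply: ler_wpM2r; first exact: H0.
  lra.
have h1 : 0 <= th * c n ^+ 2 by apply: mulr_ge0 => //; exact: sqr_ge0.
have h2 : 0 <= al * d n ^+ 2 by apply: mulr_ge0; [exact: ltW|exact: sqr_ge0].
move: Hn; rewrite /H => Hn.
have /eqP : th * c n ^+ 2 = 0 by lra.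
have /eqP : al * d n ^+ 2 = 0 by lra.
by rewrite !mulf_eq0 (gt_eqF al0) (gt_eqF thp) /= ?orbb ?sqrf_eq0 => /eqP -> /eqP ->.
Qed.

(** For th = 0 the energy no longer controls c. Instead, a common bound A of c
    and d beyond a fixed N improves to A / 2: the increments of d are O(A /
    n^2), so d = O(A / n), then the increments of c are O(A / n^2) as well. *)
Lemma parabolic_zero : th = 0 -> exists N, forall n, (N <= n)%N -> c n = 0 /\ d n = 0.
Proof.
move=> the; have al1 := al0; have K1 := K0.
pose Q := 2 * (4 * al * K + 2 * K) + 4 * K.
have Q0 : 0 <= Q by rewrite /Q; have : 0 <= al * K; [rewrite mulr_ge0// ltW|lra].
pose N := maxn n0 (Num.truncn (2 * Q)).+1.
have N0 : (0 < N)%N by rewrite leq_max n00.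
(* The halving step; N is chosen such that Q / n <= 1/2 beyond it. *)
have half A : 0 <= A -> (forall n, (N <= n)%N -> `|c n| <= A /\ `|d n| <= A) ->
    forall n, (N <= n)%N -> `|c n| <= A / 2 /\ `|d n| <= A / 2.
  move=> A0 hA.
  have hz n : (N <= n)%N -> 2 * Q * n%:R^-1 <= 1.
    by move=> Nn; apply: natr_inv_ge1; [exact: mulr_ge0|exact: leq_trans (leq_maxr _ _) Nn].
  have Dn n : (N <= n)%N -> `|d n| <= 2 * (2 * K * A) * n%:R^-1.
    apply: (tail_bound dv0 N0); first by apply: mulr_ge0 => //; exact: mulr_ge0.
    move=> k Nk; have := hd (leq_trans (leq_maxl _ _) Nk).
    rewrite the !mul0r subr0 => /le_trans; apply.
    have [h1 h2] := hA k Nk.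
    have : K * k%:R^-1 ^+ 2 * (`|c k| + `|d k|) <= K * k%:R^-1 ^+ 2 * (A + A).
      by apply: ler_wpM2l; [apply: mulr_ge0 => //; exact: sqr_ge0|exact: lerD].
    lra.
  have Cn n : (N <= n)%N -> `|c n| <= 2 * ((4 * al * K + 2 * K) * A) * n%:R^-1.
    have aK : 0 <= al * K by rewrite mulr_ge0// ltW.
    apply: (tail_bound cv0 N0); first by rewrite mulr_ge0//; lra.
    move=> k Nk; have h := hc (leq_trans (leq_maxl _ _) Nk).
    have [h1 h2] := hA k Nk; have h3 := Dn k Nk.
    have h4 : K * k%:R^-1 ^+ 2 * (`|c k| + `|d k|) <= K * k%:R^-1 ^+ 2 * (A + A).
      by apply: ler_wpM2l; [apply: mulr_ge0 => //; exact: sqr_ge0|exact: lerD].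
    have -> : c k.+1 - c k = (c k.+1 - c k + al * k%:R^-1 * d k) - al * k%:R^-1 * d k by ring.
    apply: (le_trans (ler_normB _ _)).
    have az : 0 <= al * (k%:R^-1 : R) by rewrite mulr_ge0 ?invr_ge0// ltW.
    have h5 : `|al * k%:R^-1 * d k| <= al * k%:R^-1 * (2 * (2 * K * A) * k%:R^-1).
      by rewrite normrM ger0_norm// ler_wpM2l.
    lra.
  move=> n Nn; have h1 := Dn n Nn; have h2 := Cn n Nn; have := hz n Nn.
  have z0 : (0 : R) <= n%:R^-1 by rewrite invr_ge0.
  move: h1 h2 z0; move: (n%:R^-1 : R) => z h1 h2 z0 hz1.
  have := ler_wpM2r A0 hz1.
  have p1 : 0 <= K * A * z by rewrite !mulr_ge0.
  have p2 : 0 <= al * (K * A * z) by rewrite mulr_ge0// ltW.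
  rewrite /Q; lra.
have bnd : exists2 A, 0 <= A & forall n, `|c n| <= A /\ `|d n| <= A.
  have [Ac hAc] := cvg_has_ub (cvgP _ cv0); have [Ad hAd] := cvg_has_ub (cvgP _ dv0).
  exists (Num.max 0 (Num.max Ac Ad)) => [|n]; first by rewrite le_max lexx.
  by rewrite !le_max (hAc `|c n|) ?(hAd `|d n|) ?orbT//; exists n.
have [A A0 hA] := bnd.
exists N => n Nn.
have it k : forall m, (N <= m)%N -> `|c m| <= A / 2 ^+ k /\ `|d m| <= A / 2 ^+ k.
  elim: k => [|k IH] m Nm; first by rewrite expr0 divr1.
  rewrite exprSr invfM mulrA; apply: half => //.
  by rewrite divr_ge0 ?exprn_ge0.
have z : (fun k => A / 2 ^+ k) @ \oo --> 0.
  have -> : nbhs (0 : R) = nbhs (A * 0) by rewrite mulr0.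
  apply: cvgMl_tmp; under eq_fun do rewrite -exprVn.
  by apply: cvg_expr; rewrite ger0_norm; lra.
split; apply/eqP; rewrite -normr_le0; apply/ler_addgt0Pr => e e0;
  have [k hk] := (cvg0P _).1 z e e0; have := hk k (leqnn k);
  rewrite ger0_norm ?divr_ge0 ?exprn_ge0// add0r; have [h1 h2] := it k n Nn;
  exact: le_trans.
Qed.

Lemma perturbed_zero : exists N, forall n, (N <= n)%N -> c n = 0 /\ d n = 0.
Proof.
have [e|] := eqVneq th 0; first exact: parabolic_zero.
by move=> hth; apply: elliptic_zero; rewrite lt_def hth.
Qed.

End system.
End perturbation.

(** * Absence of eigenvalues in the critical case *)

Section eigenvectors.
Variables (R : realType) (al : R).
Hypothesis al0 : 0 < al.
Implicit Types (x y T : nat -> R) (n N M : nat) (p q mu : R).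

Lemma squeezed_zero (u v : nat -> R) N : (forall n, u N <= u (N + n)%N) ->
  (forall n, u n <= v n) -> v @ \oo --> 0 -> u N <= 0.
Proof.
move=> mono uv v0; apply/ler_addgt0Pr => e e0; rewrite add0r.
have [K hK] := (cvg0P _).1 v0 e e0.
have h1 := mono K; have h2 := uv (N + K)%N; have := hK (N + K)%N (leq_addl _ _).
rewrite ler_norml; lra.
Qed.

Lemma sum_sqr_mono x N n : \sum_(k < N) x k ^+ 2 <= \sum_(k < N + n) x k ^+ 2.
Proof.
rewrite -!(big_mkord xpredT (fun k => x k ^+ 2)) [leRHS](big_cat_nat (leq0n N) (leq_addr n N))/=.
by rewrite lerDl sumr_ge0// => k _; exact: sqr_ge0.
Qed.

(** The two conditions determine the tails of the series of the m^(- 1/2 - al)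
    x_m over m > n. *)
Definition is_tail x T :=
  (forall n, T n.+1 = T n - npow (- 2^-1 - al) n.+1 * x n) /\ T @ \oo --> 0.

(** The weighted Cauchy-Schwarz inequality of [wsum_small], with the convergent
    sum of the m^(- 2 al - 1) in place of a partial sum. *)
Lemma tail_small x T : l2 x -> is_tail x T -> (fun n => npow al n * T n) @ \oo --> 0.
Proof.
move=> xl2 [TS T0]; apply/cvg0P => e e0; have al1 := al0.
pose s := 2 * al; have s0 : 0 < s by rewrite /s; lra.
pose h := e * s; have h0 : 0 < h by rewrite mulr_gt0.
have [K hK] := l2_tail xl2 (mulr_gt0 h0 e0).
exists (maxn K 1) => n; rewrite geq_max => /andP[Kn n0].
have bound M : `|npow al n * (T n - T (n + M)%N)| <= e.
  have -> : T n - T (n + M)%N = \sum_(n <= k < n + M) npow (- 2^-1 - al) k.+1 * x k.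
    elim: M => [|M IH]; first by rewrite addn0 big_geq// subrr.
    by rewrite addnS big_nat_recr ?leq_addr//= -IH TS; ring.
  have step k : npow al n * `|npow (- 2^-1 - al) k.+1 * x k| <=
     2^-1 * (h * npow s n * npow (- s - 1) k.+1 + h^-1 * x k ^+ 2).
    rewrite normrM ger0_norm ?npow_ge0// mulrA.
    have -> : npow s n = npow al n ^+ 2 by rewrite npow_sqr.
    have -> : npow (- s - 1) k.+1 = npow (- 2^-1 - al) k.+1 ^+ 2.
      by rewrite npow_sqr; have -> : 2 * (- 2^-1 - al) = - s - 1 by rewrite /s; field.
    rewrite -[h * _ * _]mulrA -exprMn -[x k ^+ 2]real_normK ?num_real//.
    move: (_ * npow (- 2^-1 - al) k.+1) `|x k| => A X.
    rewrite -subr_ge0; have -> : 2^-1 * (h * A ^+ 2 + h^-1 * X ^+ 2) - A * X =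
       2^-1 * h^-1 * (h * A - X) ^+ 2 by field; rewrite gt_eqF.
    by rewrite mulr_ge0 ?sqr_ge0// mulr_ge0// invr_ge0 ltW.
  rewrite normrM (ger0_norm (npow_ge0 al n)).
  apply: (@le_trans _ _ (\sum_(n <= k < n + M) npow al n * `|npow (- 2^-1 - al) k.+1 * x k|)).
    by rewrite -mulr_sumr ler_wpM2l ?npow_ge0// ler_norm_sum.
  apply: (le_trans (ler_sum _ (fun k _ => step k))).
  rewrite -mulr_sumr big_split /= -!mulr_sumr.
  have h1 : s * (\sum_(n <= k < n + M) npow (- s - 1) k.+1) <= npow (- s) n - npow (- s) (n + M).
    elim: M => [|M IH]; first by rewrite addn0 big_geq// mulr0 subrr.
    rewrite addnS big_nat_recr ?leq_addr//= mulrDr.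
    have := @npow_step_ge R s (n + M)%N s0 ltac:(by rewrite (leq_trans n0)// leq_addr).
    lra.
  have h1' : s * (\sum_(n <= k < n + M) npow (- s - 1) k.+1) <= npow (- s) n.
    by have := npow_ge0 (- s) (n + M); lra.
  have h2 : \sum_(n <= k < n + M) x k ^+ 2 <= h * e.
    apply: le_trans (hK (n + M)%N _); last by rewrite (leq_trans Kn)// leq_addr.
    rewrite [leRHS](big_cat_nat Kn (leq_addr M n))/= lerDr sumr_ge0// => k _.
    exact: sqr_ge0.
  have h3 : h * npow s n * \sum_(n <= k < n + M) npow (- s - 1) k.+1 <= e.
    have -> : h * npow s n * \sum_(n <= k < n + M) npow (- s - 1) k.+1 =
       e * npow s n * (s * \sum_(n <= k < n + M) npow (- s - 1) k.+1).
      by rewrite /h; ring.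
    have := ler_wpM2l (mulr_ge0 (ltW e0) (npow_ge0 s n)) h1'.
    by rewrite -[X in _ <= X -> _]mulrA -npowD subrr npow0 mulr1.
  have h4 : h^-1 * \sum_(n <= k < n + M) x k ^+ 2 <= e.
    by rewrite mulrC ler_pdivrMr// mulrC.
  lra.
apply/ler_addgt0Pr => e' e'0.
have c0 : (fun M => npow al n * T M) @ \oo --> 0.
  have -> : nbhs (0 : R) = nbhs (npow al n * 0) by rewrite mulr0.
  exact: cvgMl_tmp.
have [M hM] := (cvg0P _).1 c0 e' e'0.
have := hM (n + M)%N (leq_addl _ _); have := bound M => h1 h2.
have -> : npow al n * T n = npow al n * (T n - T (n + M)%N) + npow al n * T (n + M)%N by ring.
by apply: (le_trans (ler_normD _ _)); apply: lerD.
Qed.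

(** The n-th entry of K x, divided by n^(al - 1/2). *)
Definition green x T n : R := npow (- (2 * al)) n.+1 * wsum al x n.+1 + T n.+1.

Lemma green_step x T n : is_tail x T -> green x T n - green x T n.+1 =
  (npow (- (2 * al)) n.+1 - npow (- (2 * al)) n.+2) * wsum al x n.+1.
Proof.
move=> [TS _]; rewrite /green [in X in _ - X]wsumS (TS n.+1).
rewrite (@npow_split _ (- (2 * al)) (al - 2^-1) (- 2^-1 - al)); last by field.
by ring.
Qed.

(** Summation by parts of the bilinear form. Its main part is symmetric in x and
    y, which makes K self-adjoint once the boundary term is known to vanish. *)
Lemma green_parts x T y N : is_tail x T ->
  \sum_(n < N.+1) npow (al - 2^-1) n.+1 * green x T n * y n =
  green x T N * wsum al y N.+1 +
  \sum_(n < N) (npow (- (2 * al)) n.+1 - npow (- (2 * al)) n.+2) *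
     (wsum al x n.+1 * wsum al y n.+1).
Proof.
move=> tl; elim: N => [|N IH].
  by rewrite big_ord1 big_ord0 wsumS wsum0; ring.
rewrite big_ord_recr /= IH [in RHS]big_ord_recr /= [wsum al y N.+2]wsumS.
by rewrite [_ * (wsum al x N.+1 * _)]mulrA -(green_step N tl); ring.
Qed.

Lemma green_boundary x T y : l2 x -> is_tail x T -> l2 y ->
  (fun N => green x T N * wsum al y N.+1) @ \oo --> 0.
Proof.
move=> xl2 tl yl2.
have e N : green x T N * wsum al y N.+1 =
   (npow (- al) N.+1 * wsum al x N.+1 + npow al N.+1 * T N.+1) * (npow (- al) N.+1 * wsum al y N.+1).
  rewrite /green (@npow_split _ (- al) (- al) (- (2 * al))); last by ring.
  have : npow al N.+1 * npow (- al) N.+1 = 1 by rewrite -npowD subrr npow0.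
  move: (npow al N.+1) (npow (- al) N.+1) => A B AB.
  transitivity (B * wsum al x N.+1 * (B * wsum al y N.+1) + (A * B) * T N.+1 * wsum al y N.+1).
    by rewrite AB; ring.
  by ring.
under eq_fun do rewrite e.
have h : (fun N => (npow (- al) N * wsum al x N + npow al N * T N) * (npow (- al) N * wsum al y N))
    @ \oo --> (0 + 0) * (0 : R).
  apply: cvgM; last exact: wsum_small.
  by apply: cvgD; [exact: wsum_small|exact: (tail_small xl2)].
by move: h; rewrite addr0 mul0r -cvg_shiftS.
Qed.

(** The convergence of the first row is already that of the series whose tails
    are T. *)
Lemma row_limit x L : (forall n, (fun M => \sum_(m < M) kern al n m * x m) @ \oo --> L n) ->
  exists2 T, is_tail x T & forall n, L n = npow (al - 2^-1) n.+1 * green x T n.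
Proof.
move=> hL.
pose tau M := \sum_(m < M) npow (- 2^-1 - al) m.+1 * x m.
have tauL : tau @ \oo --> L 0%N.
  have := hL 0%N; rewrite /tau; apply: cvg_trans; apply: near_eq_cvg.
  near=> M; apply: eq_bigr => m _; by rewrite kernC kern_le// npow_1 mulr1.
exists (fun n => L 0%N - tau n).
  split=> [n|]; first by rewrite /tau big_ord_recr /=; ring.
  by rewrite -[X in _ --> X](subrr (L 0%N)); apply: cvgB => //; exact: cvg_cst.
move=> n; apply: (cvg_unique _ (hL n)) => //.
have e M : (n < M)%N -> \sum_(m < M) kern al n m * x m =
    npow (- 2^-1 - al) n.+1 * wsum al x n.+1 + npow (al - 2^-1) n.+1 * (tau M - tau n.+1).
  move=> nM; rewrite -(big_mkord xpredT (fun m => kern al n m * x m)).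
  rewrite (big_cat_nat (leq0n n.+1) nM)/=; congr (_ + _).
    rewrite /wsum mulr_sumr big_mkord; apply: eq_bigr => m _.
    by rewrite kern_le -?mulrA// -ltnS.
  have -> : tau M - tau n.+1 = \sum_(n.+1 <= m < M) npow (- 2^-1 - al) m.+1 * x m.
    rewrite /tau -!(big_mkord xpredT (fun m => npow (- 2^-1 - al) m.+1 * x m)).
    by rewrite (big_cat_nat (leq0n n.+1) nM)/=; ring.
  rewrite mulr_sumr [LHS]big_nat [RHS]big_nat; apply: eq_bigr => m /andP[nm _].
  by rewrite kernC kern_le ?(ltnW nm)//; ring.
have -> : npow (al - 2^-1) n.+1 * green x (fun n => L 0%N - tau n) n =
   npow (- 2^-1 - al) n.+1 * wsum al x n.+1 + npow (al - 2^-1) n.+1 * (L 0%N - tau n.+1).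
  rewrite /green (@npow_split _ (- (2 * al)) (al - 2^-1) (- 2^-1 - al)); last by field.
  by ring.
apply: (@cvg_trans _ ((fun M => npow (- 2^-1 - al) n.+1 * wsum al x n.+1 +
    npow (al - 2^-1) n.+1 * (tau M - tau n.+1)) @ \oo)).
  by apply: near_eq_cvg; exists n.+1 => // M /= nM; rewrite e.
apply: cvgD; first exact: cvg_cst.
by apply: cvgMl_tmp; apply: cvgB => //; exact: cvg_cst.
Unshelve. all: by end_near. Qed.

Lemma wsum_eq0 x : (forall n, wsum al x n.+1 = 0) -> forall n, x n = 0.
Proof.
move=> h n; have := wsumS al x n; rewrite h.
have -> : wsum al x n = 0 by case: n => [|n]; rewrite ?wsum0.
rewrite add0r => /esym/eqP; rewrite mulf_eq0 (negPf (npow_neq0 _ _)) => /eqP.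
by [].
Qed.

(** The sequences are the real and imaginary parts of an eigenvector for p + i
    q. Summation by parts gives q (|x|^2 + |y|^2) = 0 by symmetry, and expresses
    p (|x|^2 + |y|^2) by squares of the sums S_n with positive weights. *)
Lemma eigen_pair x y p q : l2 x -> l2 y ->
  (forall n, (fun M => \sum_(m < M) kern al n m * x m) @ \oo --> p * x n - q * y n) ->
  (forall n, (fun M => \sum_(m < M) kern al n m * y m) @ \oo --> q * x n + p * y n) ->
  (q = 0 /\ 0 < p) \/ (forall n, x n = 0 /\ y n = 0).
Proof.
move=> xl yl /row_limit[Tx tx ex] /row_limit[Ty ty ey].
have b1 := green_boundary xl tx yl; have b2 := green_boundary yl ty xl.
have b3 := green_boundary xl tx xl; have b4 := green_boundary yl ty yl.
pose s N := \sum_(n < N) x n ^+ 2 + \sum_(n < N) y n ^+ 2.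
have sS N : s N.+1 = s N + (x N ^+ 2 + y N ^+ 2) by rewrite /s !big_ord_recr /=; ring.
have s_ge0 N : 0 <= s N by rewrite addr_ge0// sumr_ge0// => k _; exact: sqr_ge0.
have smono N n : s N <= s (N + n)%N by rewrite lerD// sum_sqr_mono.
have sz : (forall N, s N.+1 <= 0) -> forall n, x n = 0 /\ y n = 0.
  move=> h n; have := h n; rewrite sS; have := s_ge0 n; have := sqr_ge0 (x n); have := sqr_ge0 (y n).
  move=> h1 h2 h3 h4; have /eqP : x n ^+ 2 = 0 by lra.
  have /eqP : y n ^+ 2 = 0 by lra.
  by rewrite !sqrf_eq0 => /eqP -> /eqP ->.
have [q0|qn0] := eqVneq q 0; last first.
  right; apply: sz => N.
  have eq1 n : q * s n.+1 = green y Ty n * wsum al x n.+1 - green x Tx n * wsum al y n.+1.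
    have g1 := green_parts x n ty; have g2 := green_parts y n tx.
    transitivity (\sum_(k < n.+1) npow (al - 2^-1) k.+1 * green y Ty k * x k -
        \sum_(k < n.+1) npow (al - 2^-1) k.+1 * green x Tx k * y k).
      rewrite /s -sumrB -big_split /= mulr_sumr; apply: eq_bigr => k _.
      by rewrite -ey -ex; ring.
    rewrite g1 g2 opprD addrACA -sumrB [X in _ + X]big1 ?addr0// => k _; ring.
  have v0 : (fun n => q^-1 * (green y Ty n * wsum al x n.+1 - green x Tx n * wsum al y n.+1)) @ \oo --> 0.
    have -> : nbhs (0 : R) = nbhs (q^-1 * (0 - 0)) by rewrite subr0 mulr0.
    by apply: cvgMl_tmp; exact: cvgB.
  apply: (@squeezed_zero (fun n => s n.+1) _ N _ _ v0) => n; first by rewrite -addSn.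
  by rewrite -eq1 mulrA mulVf// mul1r.
have [p0|p0] := ltP 0 p; first by left.
right.
pose D N := \sum_(n < N) (npow (- (2 * al)) n.+1 - npow (- (2 * al)) n.+2) *
     (wsum al x n.+1 ^+ 2 + wsum al y n.+1 ^+ 2).
have Dpos n : 0 < npow (- (2 * al)) n.+1 - npow (- (2 * al)) n.+2.
  by rewrite subr_gt0 !npowN ltf_pV2 ?posrE ?npow_gt0// npow_lt// mulr_gt0.
have D_ge0 n : 0 <= (npow (- (2 * al)) n.+1 - npow (- (2 * al)) n.+2) *
     (wsum al x n.+1 ^+ 2 + wsum al y n.+1 ^+ 2).
  by apply: mulr_ge0; [exact: ltW|apply: addr_ge0; exact: sqr_ge0].
have eq1 n : p * s n.+1 = green x Tx n * wsum al x n.+1 + green y Ty n * wsum al y n.+1 + D n.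
  have g1 := green_parts x n tx; have g2 := green_parts y n ty.
  transitivity (\sum_(k < n.+1) npow (al - 2^-1) k.+1 * green x Tx k * x k +
      \sum_(k < n.+1) npow (al - 2^-1) k.+1 * green y Ty k * y k).
    rewrite /s -!big_split /= mulr_sumr; apply: eq_bigr => k _.
    by rewrite -ey -ex q0; ring.
  rewrite g1 g2 addrACA -big_split /= /D; congr (_ + _).
  by apply: eq_bigr => k _; ring.
have v0 : (fun n => - (green x Tx n * wsum al x n.+1 + green y Ty n * wsum al y n.+1)) @ \oo --> 0.
  have -> : nbhs (0 : R) = nbhs (- (0 + 0) : R) by rewrite addr0 oppr0.
  by apply: cvgN; exact: cvgD.
have DN N : D N <= 0.
  apply: (squeezed_zero _ _ v0) => n.
    rewrite /D -!(big_mkord xpredT (fun n => (npow (- (2 * al)) n.+1 - npow (- (2 * al)) n.+2) *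
     (wsum al x n.+1 ^+ 2 + wsum al y n.+1 ^+ 2))) [leRHS](big_cat_nat (leq0n N) (leq_addr n N))/=.
    by rewrite lerDl sumr_ge0.
  have := eq1 n; have : p * s n.+1 <= 0 by rewrite mulr_le0_ge0.
  lra.
have wz n : wsum al x n.+1 = 0 /\ wsum al y n.+1 = 0.
  have := DN n.+1; rewrite /D big_ord_recr /=.
  have h0 : 0 <= D n by rewrite sumr_ge0.
  have h1 := sqr_ge0 (wsum al x n.+1); have h2 := sqr_ge0 (wsum al y n.+1).
  move: h0; rewrite /D; move: (\sum_(_ < n) _) => Dn h0 h.
  have : wsum al x n.+1 ^+ 2 + wsum al y n.+1 ^+ 2 <= 0.
    by rewrite -(pmulr_rle0 _ (Dpos n)); lra.
  move=> h3; have /eqP : wsum al x n.+1 ^+ 2 = 0 by lra.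
  have /eqP : wsum al y n.+1 ^+ 2 = 0 by lra.
  by rewrite !sqrf_eq0 => /eqP -> /eqP ->.
move=> n; split; apply: wsum_eq0 => k; by have [] := wz k.
Qed.

End eigenvectors.

Section no_small_eigenvalue.
Variables (R : realType) (al : R).
Hypothesis al0 : 0 < al.
Implicit Types (x y T : nat -> R) (n N M : nat) (p q mu : R).

Lemma expR_quad (r : R) : 0 <= r -> r <= 2^-1 ->
  [/\ 1 + r <= expR r, expR r <= 1 + r + 2 * r ^+ 2,
      1 - r <= expR (- r) & expR (- r) <= 1 - r + r ^+ 2].
Proof.
move=> r0 r1; have h1 := expR_ge1Dx r; have h2 := expR_ge1Dx (- r).
have e1 := expRxMexpNx_1 r.
have h3 := expR_gt0 r; have h4 := expR_gt0 (- r).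
split => //.
  rewrite -(ler_pM2r h4) e1.
  have : (1 + r + 2 * r ^+ 2) * (1 - r) <= (1 + r + 2 * r ^+ 2) * expR (- r).
    rewrite ler_wpM2l//; have := sqr_ge0 r; lra.
  apply: le_trans; have : 0 <= r ^+ 2 * (1 - 2 * r).
    by apply: mulr_ge0; [exact: sqr_ge0|lra].
  lra.
rewrite -(ler_pM2l h3) e1.
have : (1 + r) * (1 - r + r ^+ 2) <= expR r * (1 - r + r ^+ 2).
  by rewrite ler_wpM2r//; have := sqr_ge0 r; lra.
apply: le_trans; have : 0 <= r ^+ 2 * r by apply: mulr_ge0; [exact: sqr_ge0|].
lra.
Qed.

(** From n to n + 1 the factors n^al and n^(- al) change by exp (al l) and exp
    (- al l), where l = ln (n + 1) - ln n. These are the coefficients of this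
    change in the sum and the difference of the two quantities. *)
Lemma rotation_coef n : (0 < n)%N -> 2 * al * n%:R^-1 <= 1 ->
  let E := expR (al * lnstep R n) in let E' := expR (- (al * lnstep R n)) in
  let K := 2 * al ^+ 2 + al in
  `|(E + E') / 2 - 1| <= K * n%:R^-1 ^+ 2 /\
  `|(E - E') / 2 - al * n%:R^-1| <= K * n%:R^-1 ^+ 2.
Proof.
move=> n0 hn E E' K; have al1 := al0.
have l0 := lnstep_ge0 R n0; have l1 := lnstep_le R n0; have l2 := lnstep_ge R n0.
have zy : (n%:R^-1 - n.+1%:R^-1 : R) <= n%:R^-1 ^+ 2.
  have : (0 : R) < n%:R by rewrite ltr0n.
  rewrite -[n.+1%:R]natr1; move: (n%:R : R) => w w0.
  rewrite -subr_ge0.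
  have -> : w^-1 ^+ 2 - (w^-1 - (w + 1)^-1) = (w ^+ 2 * (w + 1))^-1.
    by field; rewrite ?gt_eqF//; lra.
  by rewrite invr_ge0; apply: mulr_ge0; [exact: sqr_ge0|lra].
have z0 : (0 : R) <= n%:R^-1 by rewrite invr_ge0.
move: l1 l2 zy z0 hn; rewrite /K /E /E'.
move: (n%:R^-1 : R) (n.+1%:R^-1 : R) => z y l1 l2 zy z0 hn.
pose r := al * lnstep R n.
have r0 : 0 <= r by rewrite mulr_ge0// ltW.
have rz : r <= al * z by rewrite ler_pM2l.
have ry : al * z - r <= al * z ^+ 2.
  by rewrite /r -mulrBr ler_pM2l//; lra.
have [] := @expR_quad r r0; first lra.
rewrite -/r; move: (expR r) (expR (- r)) => F F' h1 h2 h3 h4.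
have r2 : r ^+ 2 <= al ^+ 2 * z ^+ 2.
  by rewrite -exprMn ler_sqr ?nnegrE// mulr_ge0// ltW.
have r20 := sqr_ge0 r.
have az : 0 <= al * z ^+ 2 by apply: mulr_ge0; [exact: ltW|exact: sqr_ge0].
rewrite !ler_norml; split; lra.
Qed.

(** Put a = n^(- al) S, b = n^al T, c = a + b and d = a - b. Both a and b tend
    to 0, and (c, d) satisfies the system of [perturbed_zero] with th = 2 / p -
    al >= 0. So S and T vanish for large n, and the recursion can be run
    backwards. *)
Lemma no_small_eigenvalue x T p : l2 x -> is_tail al x T -> 0 < p -> p * al <= 2 ->
  (forall n, p * x n = npow (al - 2^-1) n.+1 * green al x T n) -> forall n, x n = 0.
Proof.
move=> xl2 tl p0 pal hx; have al1 := al0; have [TS _] := tl.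
pose mu := p^-1; have mu0 : 0 < mu by rewrite invr_gt0.
have mual : al <= 2 * mu.
  have e : p * mu = 1 by rewrite mulfV ?gt_eqF.
  by rewrite -(ler_pM2l p0) mulrCA e mulr1.
pose a n := npow (- al) n * wsum al x n; pose b n := npow al n * T n.
have a0 : a @ \oo --> 0 by exact: wsum_small.
have b0 : b @ \oo --> 0 by exact: (tail_small al0 xl2).
pose c n := a n + b n; pose d n := a n - b n.
have c0 : c @ \oo --> 0.
  by have -> : nbhs (0 : R) = nbhs (0 + 0 : R); [rewrite addr0|exact: cvgD].
have d0 : d @ \oo --> 0.
  by have -> : nbhs (0 : R) = nbhs (0 - 0 : R); [rewrite subr0|exact: cvgB].
(* Adding x n to both sums does not change a + b: only the powers move. *)
have kick n : npow (- al) n.+1 * wsum al x n.+1 = npow (- al) n.+1 * wsum al x n + npow (- 2^-1) n.+1 * x n.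
  rewrite wsumS mulrDr mulrA -npowD.
  by have -> : - al + (al - 2^-1) = - 2^-1 by ring.
have kick' n : npow al n.+1 * T n.+1 = npow al n.+1 * T n - npow (- 2^-1) n.+1 * x n.
  rewrite TS mulrBr mulrA -npowD.
  by have -> : al + (- 2^-1 - al) = - 2^-1 by ring.
have cS n : c n.+1 = expR (- (al * lnstep R n)) * a n + expR (al * lnstep R n) * b n.
  rewrite /c /a /b kick kick' (npowS (- al) n) (npowS al n) mulNr; ring.
have xc n : npow (- 2^-1) n.+1 * x n = mu * n.+1%:R^-1 * c n.+1.
  have -> : x n = mu * (npow (al - 2^-1) n.+1 * green al x T n).
    by rewrite -hx mulrA mulVf ?mul1r// gt_eqF.
  have -> : npow (- 2^-1) n.+1 * (mu * (npow (al - 2^-1) n.+1 * green al x T n)) =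
    mu * (npow (- 2^-1) n.+1 * npow (al - 2^-1) n.+1) * green al x T n by ring.
  rewrite -npowD -(@npow1 R n.+1)// -npowN -!mulrA; congr (_ * _).
  rewrite (@npow_split _ (- 1) al (- 2^-1 + (al - 2^-1))); last by field.
  rewrite -mulrA; congr (_ * _); rewrite /c /a /b /green mulrDr mulrA -npowD.
  by have -> : al + - (2 * al) = - al by ring.
have dS n : d n.+1 = expR (- (al * lnstep R n)) * a n - expR (al * lnstep R n) * b n
     + 2 * mu * n.+1%:R^-1 * c n.+1.
  rewrite /d {1}/a {1}/b kick kick' (npowS (- al) n) (npowS al n) mulNr xc /a /b; ring.
pose K1 := 2 * al ^+ 2 + al.
pose K := K1 + 2 * mu * (2 * K1 + 1).
have K10 : 0 <= K1 by rewrite /K1 addr_ge0 ?mulr_ge0 ?ltW//; exact: exprn_gt0.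
have K0 : 0 <= K by rewrite /K addr_ge0// mulr_ge0// ?addr_ge0 ?mulr_ge0// ltW.
pose n0 := (Num.truncn (2 * al)).+1.
have main n : (n0 <= n)%N ->
  `|c n.+1 - c n + al * n%:R^-1 * d n| <= K1 * n%:R^-1 ^+ 2 * (`|c n| + `|d n|) /\
  `|d n.+1 - d n - (2 * mu - al) * n%:R^-1 * c n| <= K * n%:R^-1 ^+ 2 * (`|c n| + `|d n|).
  move=> nn; have n_0 : (0 < n)%N by rewrite (leq_trans _ nn).
  have hn : 2 * al * n%:R^-1 <= 1 by apply: natr_inv_ge1 => //; rewrite mulr_ge0// ltW.
  have := rotation_coef n_0 hn; rewrite /= -/K1.
  have dSn := dS n; have := cS n; rewrite dSn.
  have -> : a n = (c n + d n) / 2 by rewrite /c /d; field.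
  have -> : b n = (c n - d n) / 2 by rewrite /c /d; field.
  move: (expR _) (expR _) => E E'.
  have zy : (n%:R^-1 - n.+1%:R^-1 : R) <= n%:R^-1 ^+ 2 /\ (n.+1%:R^-1 : R) <= n%:R^-1.
    split; last by rewrite lef_pV2 ?posrE ?ltr0n// ler_nat.
    have : (0 : R) < n%:R by rewrite ltr0n.
    rewrite -[n.+1%:R]natr1; move: (n%:R : R) => w w0.
    rewrite -subr_ge0.
    have -> : w^-1 ^+ 2 - (w^-1 - (w + 1)^-1) = (w ^+ 2 * (w + 1))^-1.
      by field; rewrite ?gt_eqF//; lra.
    by rewrite invr_ge0; apply: mulr_ge0; [exact: sqr_ge0|lra].
  have z1 : (n%:R^-1 : R) <= 1 by rewrite invf_le1 ?ltr0n// ler1n.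
  have y0 : (0 : R) <= n.+1%:R^-1 by rewrite invr_ge0.
  move: (c n.+1) zy z1 y0 hn; move: (n%:R^-1 : R) (n.+1%:R^-1 : R) (c n) (d n).
  move=> z y C D C' [zy yz] z1 y0 hn eC.
  set s := (E + E') / 2 - 1; set t := (E - E') / 2 - al * z.
  move=> [hs ht].
  have z0 : 0 <= z by lra.
  have eC1 : C' - C = s * C - (t + al * z) * D by rewrite eC /s /t; field.
  have n1 := normr_ge0 C; have n2 := normr_ge0 D.
  have b1 : `|s * C - t * D| <= K1 * z ^+ 2 * (`|C| + `|D|).
    apply: (le_trans (ler_normB _ _)); rewrite !normrM mulrDr.
    by apply: lerD; apply: ler_wpM2r.
  split.
    by have -> : C' - C + al * z * D = s * C - t * D by rewrite eC1; ring.
  have -> : E' * ((C + D) / 2) - E * ((C - D) / 2) + 2 * mu * y * C' - D - (2 * mu - al) * z * C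
    = s * D - t * C + 2 * mu * (y * (C' - C) + (y - z) * C) by rewrite /s /t; field.
  have b2 : `|s * D - t * C| <= K1 * z ^+ 2 * (`|C| + `|D|).
    apply: (le_trans (ler_normB _ _)); rewrite !normrM addrC mulrDr.
    by apply: lerD; apply: ler_wpM2r.
  apply: (le_trans (ler_normD _ _)).
  have -> : K * z ^+ 2 * (`|C| + `|D|) = K1 * z ^+ 2 * (`|C| + `|D|) +
     2 * mu * ((2 * K1 + 1) * z ^+ 2 * (`|C| + `|D|)) by rewrite /K; ring.
  apply: lerD => //.
  rewrite normrM (ger0_norm (_ : 0 <= 2 * mu)); last by rewrite mulr_ge0// ltW.
  apply: ler_wpM2l; first by rewrite mulr_ge0// ltW.
  have zz : z ^+ 2 <= z by rewrite expr2 ler_piMl.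
  have kz : K1 * z ^+ 2 <= K1 * z by rewrite ler_wpM2l.
  have b3 : `|C' - C| <= 2 * K1 * z * (`|C| + `|D|).
    have -> : C' - C = (s * C - t * D) - al * z * D by rewrite eC1; ring.
    apply: (le_trans (ler_normB _ _)).
    have : `|al * z * D| <= K1 * z * (`|C| + `|D|).
      rewrite normrM (ger0_norm (mulr_ge0 (ltW al0) z0)).
      have : al * z * `|D| <= K1 * z * `|D|.
        apply: ler_wpM2r => //; apply: ler_wpM2r => //.
        by rewrite /K1 lerDr mulr_ge0//; exact: sqr_ge0.
      have : 0 <= K1 * z * `|C| by rewrite !mulr_ge0.
      lra.
    have := ler_wpM2r (addr_ge0 n1 n2) kz.
    lra.
  apply: (le_trans (ler_normD _ _)); rewrite !normrM (ger0_norm y0).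
  have b4 : y * `|C' - C| <= z * (2 * K1 * z * (`|C| + `|D|)) by apply: ler_pM.
  have b5 : `|y - z| * `|C| <= z ^+ 2 * (`|C| + `|D|).
    apply: ler_pM => //; last by lra.
    by rewrite distrC ger0_norm//; lra.
  lra.
have [||||N hN] := @perturbed_zero R c d al (2 * mu - al) K n0 al0 _ K0 _ c0 d0.
- lra.
- by [].
- move=> n nn; have [h _] := main n nn; apply: (le_trans h).
  apply: ler_wpM2r; first by rewrite addr_ge0.
  apply: ler_wpM2r; first exact: sqr_ge0.
  by rewrite /K lerDl mulr_ge0// ?addr_ge0 ?mulr_ge0// ltW.
- by move=> n nn; have [_ h] := main n nn.
have SN n : (N <= n)%N -> wsum al x n = 0 /\ T n = 0.
  move=> Nn; have [h1 h2] := hN n Nn.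
  have : a n = 0 by move: h1 h2; rewrite /c /d; lra.
  have : b n = 0 by move: h1 h2; rewrite /c /d; lra.
  rewrite /a /b => /eqP; rewrite mulf_eq0 (negPf (npow_neq0 _ _)) => /eqP ->.
  by move=> /eqP; rewrite mulf_eq0 (negPf (npow_neq0 _ _)) => /eqP ->.
have back n : wsum al x n.+1 = 0 -> T n.+1 = 0 -> [/\ x n = 0, wsum al x n = 0 & T n = 0].
  move=> S0 T0.
  have x0 : x n = 0.
    have := hx n; rewrite /green S0 T0 mulr0 addr0 mulr0 => /eqP.
    by rewrite mulf_eq0 gt_eqF//= => /eqP.
  split => //.
    by have := wsumS al x n; rewrite S0 x0 mulr0 addr0.
  by have := TS n; rewrite T0 x0 mulr0 subr0.
have all0 k n : (N <= n + k)%N -> wsum al x n = 0 /\ T n = 0.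
  elim: k n => [|k IH] n; first by rewrite addn0; exact: SN.
  by rewrite addnS -addSn => /IH[S0 T0]; have [] := back n S0 T0.
move=> n; have [S0 T0] := all0 N n.+1 (leq_addl _ _).
by have [] := back n S0 T0.
Qed.

(** The form at an eigenvector is p |x|^2, up to a boundary term tending to 0,
    and is at most (2 / al) |x|^2 by admissibility. *)
Lemma no_large_eigenvalue x T p : admissible al (al / 2) -> l2 x -> is_tail al x T ->
  2 < p * al ->
  (forall n, p * x n = npow (al - 2^-1) n.+1 * green al x T n) -> forall n, x n = 0.
Proof.
move=> adm xl2 tl pal hx; have al1 := al0.
pose s N := \sum_(k < N) x k ^+ 2.
have h0 : 0 < al / 2 by lra.
have key n : (p * al / 2 - 1) * s n.+1 <= al / 2 * (T n.+1 * wsum al x n.+1).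
  have := qform_le (ltW h0) adm h0 x n.+1.
  have : p * s n.+1 = green al x T n * wsum al x n.+1 +
     (qform al x n.+1 - npow (- (2 * al)) n.+1 * wsum al x n.+1 ^+ 2).
    have gp := green_parts x n tl; rewrite sum_by_parts addrK.
    transitivity (\sum_(k < n.+1) npow (al - 2^-1) k.+1 * green al x T k * x k).
      by rewrite /s mulr_sumr; apply: eq_bigr => k _; rewrite -hx; ring.
    by rewrite gp; congr (_ + _); apply: eq_bigr => k _; rewrite expr2.
  rewrite -/(s n.+1) /green.
  move=> h; have := congr1 (fun t => al / 2 * t) h => {}h.
  lra.
have v0 : (fun n => (p * al / 2 - 1)^-1 * (al / 2 * (T n.+1 * wsum al x n.+1))) @ \oo --> 0.
  have -> : nbhs (0 : R) = nbhs ((p * al / 2 - 1)^-1 * (al / 2 * 0)) by rewrite !mulr0.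
  apply: cvgMl_tmp; apply: cvgMl_tmp.
  have : (fun n => (npow al n * T n) * (npow (- al) n * wsum al x n)) @ \oo --> 0 * (0 : R).
    by apply: cvgM; [exact: (tail_small al0 xl2)|exact: wsum_small].
  have e n : (npow al n * T n) * (npow (- al) n * wsum al x n) = T n * wsum al x n.
    by rewrite npowN; field; exact: npow_neq0.
  by under eq_fun do rewrite e; rewrite mul0r -cvg_shiftS.
have sn n : s n.+1 <= 0.
  apply: (@squeezed_zero _ (fun n => s n.+1) _ n _ _ v0) => k.
    by rewrite -addSn sum_sqr_mono.
  by rewrite mulrC ler_pdivlMr ?key 1?mulrC ?key//; lra.
move=> n; have := sn n; rewrite /s big_ord_recr /=.
have : 0 <= \sum_(k < n) x k ^+ 2 by rewrite sumr_ge0// => k _; exact: sqr_ge0.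
have := sqr_ge0 (x n) => h1 h2 h3.
by apply/eqP; rewrite -sqrf_eq0; apply/eqP; lra.
Qed.

Lemma no_eigenvalue x y p q : admissible al (al / 2) -> l2 x -> l2 y ->
  (forall n, (fun M => \sum_(m < M) kern al n m * x m) @ \oo --> p * x n - q * y n) ->
  (forall n, (fun M => \sum_(m < M) kern al n m * y m) @ \oo --> q * x n + p * y n) ->
  forall n, x n = 0 /\ y n = 0.
Proof.
move=> adm xl yl hx hy.
have [[q0 p0]|//] := eigen_pair al0 xl yl hx hy.
have one z : l2 z -> (forall n, (fun M => \sum_(m < M) kern al n m * z m) @ \oo --> p * z n) ->
    forall n, z n = 0.
  move=> zl /row_limit[T tl hz].
  have [pal|pal] := leP (p * al) 2.
    exact: (no_small_eigenvalue zl tl p0 pal).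
  exact: (no_large_eigenvalue adm zl tl pal).
move=> n; split.
  by apply: one => // k; have := hx k; rewrite q0 mul0r subr0.
by apply: one => // k; have := hy k; rewrite q0 mul0r add0r.
Qed.

End no_small_eigenvalue.

(** * Derivatives and hyperbolic functions *)

Section hyperbolic.
Variable R : realType.
Implicit Types (x t u : R).

Lemma is_derive_continuous_within (f df : R -> R) (a b : R) :
  (forall x, a <= x <= b -> is_derive x 1 f (df x)) -> {within `[a, b], continuous f}.
Proof.
move=> h; apply: derivable_within_continuous => x; rewrite in_itv/= => hx.
by have [] := h x hx.
Qed.

Lemma MVT_closed (f df : R -> R) (a b : R) : a < b ->
  (forall x, a <= x <= b -> is_derive x 1 f (df x)) ->
  exists2 c, a < c < b & f b - f a = df c * (b - a).
Proof.
move=> ab h; have [||c] := @MVT R f df a b ab.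
- by move=> x; rewrite in_itv/= => /andP[/ltW h1 /ltW h2]; apply: h; rewrite h1.
- exact: is_derive_continuous_within h.
- by rewrite in_itv/= => hc e; exists c.
Qed.

Lemma ge0_of_derive (f df : R -> R) x : f 0 = 0 -> 0 <= x ->
  (forall t, is_derive t 1 f (df t)) -> (forall t, 0 <= t -> t <= x -> 0 <= df t) -> 0 <= f x.
Proof.
move=> f0; rewrite le_eqVlt => /predU1P[<- _ _|x0 h hd]; first by rewrite f0.
have [c /andP[c0 cx]] := @MVT_closed f df 0 x x0 (fun t _ => h t).
by rewrite f0 !subr0 => ->; rewrite mulr_ge0 ?hd// ltW.
Qed.

Lemma gt0_of_derive (f df : R -> R) x : f 0 = 0 -> 0 < x ->
  (forall t, is_derive t 1 f (df t)) -> (forall t, 0 < t -> t < x -> 0 < df t) -> 0 < f x.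
Proof.
move=> f0 x0 h hd.
have [c /andP[c0 cx]] := @MVT_closed f df 0 x x0 (fun t _ => h t).
by rewrite f0 !subr0 => ->; rewrite mulr_gt0 ?hd.
Qed.

(** Twice the hyperbolic functions: this avoids denominators. *)
Definition sh x : R := expR x - expR (- x).
Definition ch x : R := expR x + expR (- x).

Lemma sh0 : sh 0 = 0. Proof. by rewrite /sh oppr0 subrr. Qed.

Lemma derD (f g : R -> R) t a b : is_derive t 1 f a -> is_derive t 1 g b ->
  is_derive t 1 (fun t => f t + g t) (a + b).
Proof. by move=> hf hg; exact: (is_deriveD hf hg). Qed.

Lemma derB (f g : R -> R) t a b : is_derive t 1 f a -> is_derive t 1 g b ->
  is_derive t 1 (fun t => f t - g t) (a - b).
Proof. by move=> hf hg; exact: (is_deriveB hf hg). Qed.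

Lemma derM (f g : R -> R) t a b : is_derive t 1 f a -> is_derive t 1 g b ->
  is_derive t 1 (fun t => f t * g t) (f t * b + a * g t).
Proof. by move=> hf hg; have := is_deriveM hf hg; rewrite /GRing.scale /= [g t * a]mulrC. Qed.

Lemma derC (c t : R) : is_derive t 1 (fun=> c) 0.
Proof. exact: is_derive_cst. Qed.

Lemma derI (t : R) : is_derive t 1 (fun t => t) 1.
Proof. exact: is_derive_id. Qed.

Lemma derZ (f : R -> R) c t a : is_derive t 1 f a -> is_derive t 1 (fun t => c * f t) (c * a).
Proof.
move=> h; have := derM (derC c t) h; by rewrite mul0r addr0.
Qed.

Lemma der_comp (f g : R -> R) t a b : is_derive (g t) 1 f a -> is_derive t 1 g b ->
  is_derive t 1 (fun t => f (g t)) (a * b).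
Proof. by move=> hf hg; exact: (is_derive1_comp hf hg). Qed.

Lemma der_expM (a t : R) : is_derive t 1 (fun t => expR (a * t)) (a * expR (a * t)).
Proof.
rewrite mulrC; refine (der_comp (g := fun t => a * t) (is_derive_expR (a * t)) _).
by rewrite -[X in is_derive _ _ _ X](mulr1 a); apply: derZ; exact: derI.
Qed.

Lemma der_sh (a t : R) : is_derive t 1 (fun t => sh (a * t)) (a * ch (a * t)).
Proof.
have := derB (der_expM a t) (der_expM (- a) t).
rewrite /sh /ch !mulNr opprK -mulrDr.
by under eq_fun do rewrite mulNr.
Qed.

Lemma der_ch (a t : R) : is_derive t 1 (fun t => ch (a * t)) (a * sh (a * t)).
Proof.
have := derD (der_expM a t) (der_expM (- a) t).
rewrite /sh /ch !mulNr -mulrBr.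
by under eq_fun do rewrite mulNr.
Qed.

Lemma sh_ge0 x : 0 <= x -> 0 <= sh x.
Proof. by move=> x0; rewrite subr_ge0 ler_expR; lra. Qed.

Lemma ch_ge2 x : 2 <= ch x.
Proof. by rewrite /ch; have := expR_ge1Dx x; have := expR_ge1Dx (- x); lra. Qed.

Lemma sh_ge x : 0 <= x -> 2 * x <= sh x.
Proof.
move=> x0; rewrite -subr_ge0.
apply: (@ge0_of_derive (fun t => sh t - 2 * t) (fun t => ch t - 2) x) => //.
- by rewrite sh0 mulr0 subr0.
- move=> t; have := derB (der_sh 1 t) (derZ 2 (derI t)); rewrite !mul1r mulr1.
  by under eq_fun do rewrite mul1r.
- by move=> t _ _; rewrite subr_ge0 ch_ge2.
Qed.

Lemma sh_le x : 0 <= x -> sh x <= x * ch x.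
Proof.
move=> x0; rewrite -subr_ge0.
apply: (@ge0_of_derive (fun t => t * ch t - sh t) (fun t => t * sh t) x) => //.
- by rewrite sh0 mul0r subr0.
- move=> t; have := derB (derM (derI t) (der_ch 1 t)) (der_sh 1 t); rewrite !mul1r addrK.
  by under eq_fun do rewrite mul1r.
- by move=> t t0 _; rewrite mulr_ge0// sh_ge0.
Qed.

Lemma sh_convex th x : 0 <= th <= 1 -> 0 <= x -> sh (th * x) <= th * sh x.
Proof.
move=> /andP[th0 th1] x0; rewrite -subr_ge0.
apply: (@ge0_of_derive (fun t => th * sh t - sh (th * t)) (fun t => th * (ch t - ch (th * t))) x) => //.
- by rewrite mulr0 sh0 mulr0 subr0.
- move=> t; have := derB (derZ th (der_sh 1 t)) (der_sh th t); rewrite !mul1r -mulrBr.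
  by under eq_fun do rewrite mul1r.
- move=> t t0 _; apply: mulr_ge0 => //.
  have -> : ch t - ch (th * t) = (expR t - expR (th * t)) * (1 - expR (- (t + th * t))).
    have e1 : expR t * expR (- (t + th * t)) = expR (- (th * t)) by rewrite -expRD; congr expR; ring.
    have e2 : expR (th * t) * expR (- (t + th * t)) = expR (- t) by rewrite -expRD; congr expR; ring.
    by rewrite mulrBl !mulrBr !mulr1 e1 e2 /ch; ring.
  have tht : 0 <= th * t by rewrite mulr_ge0.
  apply: mulr_ge0; rewrite subr_ge0; first by rewrite ler_expR ler_piMl.
  by rewrite expR_le1; lra.
Qed.

Lemma ln2_lt : ln (2 : R) < 3 / 4.
Proof.
rewrite -ltr_expR lnK ?posrE//.
have -> : (3 / 4 : R) = 8%:R * (3 / 32) by field.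
rewrite expRM_natl.
have h := @expR_ge1Dx R (3 / 32).
apply: (@lt_le_trans _ _ ((1 + 3 / 32 : R) ^+ 8)); first by lra.
by rewrite lerXn2r// ?nnegrE ?expR_ge0//; lra.
Qed.

(** The trapezoidal rule overestimates the integral over [1, 2] of the convex
    function b t^(- b - 1). *)
Lemma trapezoid (b : R) : 0 < b -> 1 - expR (- (b * ln 2)) < b / 2 * (1 + expR (- (b * ln 2)) / 2).
Proof.
move=> b0; set L : R := ln 2; rewrite -subr_gt0.
have L1 : L < 3 / 4 by exact: ln2_lt.
have L0 : 0 <= L by rewrite ln_ge0// ler1n.
apply: (@gt0_of_derive (fun t => t / 2 * (1 + expR (- (t * L)) / 2) - (1 - expR (- (t * L))))
  (fun t => expR (- (t * L)) * (expR (t * L) / 2 - (L - 4^-1 + t * L / 4))) b) => //.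
- by rewrite !mul0r oppr0 expR0 subrr subr0.
- move=> t.
  have hE := der_expM (- L) t.
  have h1 : is_derive t 1 (fun t : R => t / 2) 2^-1.
    by have := derM (derI t) (derC 2^-1 t); rewrite mulr0 mul1r add0r.
  have := derB (derM h1 (derD (derC 1 t) (derM hE (derC 2^-1 t)))) (derB (derC 1 t) hE).
  have e (s : R) : - L * s = - (s * L) by ring.
  under eq_fun do rewrite e.
  rewrite e => hd; apply: (is_derive_eq hd).
  have : expR (- (t * L)) * expR (t * L) = 1 by rewrite mulrC expRxMexpNx_1.
  move: (expR (- (t * L))) (expR (t * L)) => E' E EE'.
  by rewrite mulrBr mulrA EE'; field.
- move=> t t0 _; apply: mulr_gt0; first exact: expR_gt0.
  have := expR_ge1Dx (t * L).
  have : 0 <= t * L by rewrite mulr_ge0// ltW.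
  lra.
Qed.

End hyperbolic.

(** * Power sequences do not satisfy the recursion *)

Lemma inv_sqr_step_le (R : realType) n : (0 < n)%N ->
  (n%:R^-1 - n.+1%:R^-1 : R) <= n%:R^-1 ^+ 2.
Proof.
move=> n0; have : (0 : R) < n%:R by rewrite ltr0n.
rewrite -[n.+1%:R]natr1; move: (n%:R : R) => w w0; rewrite -subr_ge0.
have -> : w^-1 ^+ 2 - (w^-1 - (w + 1)^-1) = (w ^+ 2 * (w + 1))^-1.
  by field; rewrite ?gt_eqF//; lra.
by rewrite invr_ge0; apply: mulr_ge0; [exact: sqr_ge0|lra].
Qed.

Section power_sequence.
Variables (R : realType) (al lam p b : R).
Hypotheses (al0 : 0 < al) (lam0 : 0 < lam) (pb : p + b = 2 * al).
Local Notation B := (2 * al).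
Local Notation l := (lnstep R).
(** The sums S_n of a power sequence, for which the eigenvalue equation reduces
    to the hypothesis [rec] below with lam the eigenvalue, up to normalization. *)
Definition psum n : R := \sum_(k < n) npow (p - 1) k.+1.
Hypothesis rec : forall n, (0 < n)%N ->
  lam * (npow (- b) n - npow (- b) n.+1) = (npow (- B) n - npow (- B) n.+1) * psum n.

Lemma psum1 : psum 1 = 1. Proof. by rewrite /psum big_ord1 npow_1. Qed.

Lemma psumS n : psum n.+1 = psum n + npow (p - 1) n.+1.
Proof. by rewrite /psum big_ord_recr. Qed.

Let B0 : 0 < B. Proof. by rewrite mulr_gt0. Qed.

Lemma lnstep_gt0 n : (0 < n)%N -> 0 < l n.
Proof. by move=> n0; apply: lt_le_trans (lnstep_ge R n0); rewrite invr_gt0. Qed.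

Lemma power_b_gt0 : 0 < b.
Proof.
have := @rec 1 isT; rewrite psum1 mulr1 !npow_1 => h.
have h1 : 0 < 1 - npow (- b) 2.
  rewrite -(pmulr_rgt0 _ lam0) h subr_gt0 npowN invf_lt1 ?npow_gt0//.
  by rewrite -[ltLHS](npow_1 B); exact: npow_lt.
move: h1; rewrite subr_gt0 /npow expR_lt1 mulNr oppr_lt0 pmulr_lgt0// ln_gt0//.
by rewrite ltr1n.
Qed.

Let b0 : 0 < b := power_b_gt0.

Lemma power_rec n : (0 < n)%N ->
  lam * npow p n * (1 - expR (- (b * l n))) = (1 - expR (- (B * l n))) * psum n.
Proof.
move=> n0; have := rec n0; rewrite !npowS (@npow_split _ (- B) p (- b)); last by have := pb; lra.
rewrite !mulNr => h.
have nz := npow_neq0 (- B) n.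
apply: (mulfI nz).
have -> : npow (- B) n * (lam * npow p n * (1 - expR (- (b * l n)))) =
  lam * (npow (- B) n * npow p n - npow (- B) n * npow p n * expR (- (b * l n))) by ring.
by rewrite h; ring.
Qed.

Lemma one_sub_exp_gt0 n : (0 < n)%N -> 0 < 1 - expR (- (B * l n)).
Proof.
by move=> n0; rewrite subr_gt0 expR_lt1 oppr_lt0 mulr_gt0// lnstep_gt0.
Qed.

Let kap := lam * b / B.

(** For p <= 0 Bernoulli's inequalities hold with the roles of b and 2 al
    exchanged, and give psum 2 <= kap 2^p <= psum 1. *)
Lemma power_p_gt0 : 0 < p.
Proof.
have BB := B0; have bb := b0; have pb1 := pb.
rewrite ltNge; apply/negP => p0.
have Bb : B <= b by lra.
pose th := B / b.
have th01 : 0 <= th <= 1.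
  by rewrite /th; apply/andP; split; [apply: divr_ge0; exact: ltW|rewrite ler_pdivrMr// mul1r].
have kap0 : 0 < kap by rewrite divr_gt0// mulr_gt0.
have hU n : (0 < n)%N -> psum n <= kap * npow p n.
  move=> n0; have := @expR_bernoulli_le R th (- (b * l n)) th01.
  have -> : th * - (b * l n) = - (B * l n) by rewrite /th; field; rewrite gt_eqF.
  move=> h; rewrite -(ler_pM2l (one_sub_exp_gt0 n0)) -power_rec//.
  have -> : lam * npow p n * (1 - expR (- (b * l n))) =
      kap * npow p n * (th * (1 - expR (- (b * l n)))).
    by rewrite /kap /th; field; rewrite !gt_eqF.
  by rewrite [leRHS]mulrC; apply: ler_wpM2l; [apply: mulr_ge0; [exact: ltW|exact: npow_ge0]|lra].
have hL n : (0 < n)%N -> kap * npow p n.+1 <= psum n.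
  move=> n0; have := @expR_bernoulli_le R th (b * l n) th01.
  have -> : th * (b * l n) = B * l n by rewrite /th; field; rewrite gt_eqF.
  move=> h; rewrite -(ler_pM2l (one_sub_exp_gt0 n0)) -power_rec// npowS.
  have E1 := expRxMexpNx_1 (b * l n); have E2 := expRxMexpNx_1 (B * l n).
  have -> : lam * npow p n * (1 - expR (- (b * l n))) =
      kap * npow p n * expR (- (b * l n)) * (th * (expR (b * l n) - 1)).
    have -> : lam * npow p n = kap * npow p n * th.
      by rewrite /kap /th; field; rewrite !gt_eqF.
    rewrite -[X in X - expR _]E1; ring.
  have -> : expR (p * l n) = expR (- (b * l n)) * expR (B * l n).
    by rewrite -expRD; rewrite -pb; congr expR; ring.
  have -> : (1 - expR (- (B * l n))) * (kap * (npow p n * (expR (- (b * l n)) * expR (B * l n)))) =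
    kap * npow p n * expR (- (b * l n)) * (expR (B * l n) - expR (B * l n) * expR (- (B * l n))) by ring.
  rewrite E2; apply: ler_wpM2l; last lra.
  by apply: mulr_ge0; [apply: mulr_ge0; [exact: ltW|exact: npow_ge0]|exact: expR_ge0].
have := le_trans (hU 2 isT) (hL 1%N isT).
by rewrite (psumS 1) gerDl leNgt npow_gt0.
Qed.

Let p0 : 0 < p := power_p_gt0.
Let th := b / B.
Let th01 : 0 <= th <= 1.
Proof.
have pp := p0; have pb1 := pb; rewrite /th.
by apply/andP; split; [apply: divr_ge0; exact: ltW|rewrite ler_pdivrMr// mul1r; lra].
Qed.
Let kap0 : 0 < kap. Proof. by rewrite divr_gt0// mulr_gt0. Qed.

(** By [power_rec], psum n is lam n^p times a ratio of two differences 1 - exp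
    (- t l), which Bernoulli's inequality compares with the ratio of the
    exponents. *)
Lemma psum_ge n : (0 < n)%N -> kap * npow p n <= psum n.
Proof.
move=> n0; have := @expR_bernoulli_le R th (- (B * l n)) th01.
have -> : th * - (B * l n) = - (b * l n) by rewrite /th; field; rewrite gt_eqF.
move=> h; rewrite -(ler_pM2l (one_sub_exp_gt0 n0)) -power_rec//.
have -> : (1 - expR (- (B * l n))) * (kap * npow p n) =
   lam * npow p n * (th * (1 - expR (- (B * l n)))).
  by rewrite /kap /th; field; rewrite gt_eqF.
by apply: ler_wpM2l; [apply: mulr_ge0; [exact: ltW|exact: npow_ge0]|lra].
Qed.

Lemma psum_le n : (0 < n)%N -> psum n <= kap * npow p n.+1.
Proof.
move=> n0; have := @expR_bernoulli_le R th (B * l n) th01.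
have -> : th * (B * l n) = b * l n by rewrite /th; field; rewrite gt_eqF.
move=> h; rewrite -(ler_pM2l (one_sub_exp_gt0 n0)) -power_rec// npowS.
have E1 := expRxMexpNx_1 (b * l n); have E2 := expRxMexpNx_1 (B * l n).
have -> : expR (p * l n) = expR (- (b * l n)) * expR (B * l n).
  by rewrite -expRD; rewrite -pb; congr expR; ring.
have -> : (1 - expR (- (B * l n))) * (kap * (npow p n * (expR (- (b * l n)) * expR (B * l n)))) =
  kap * npow p n * expR (- (b * l n)) * (expR (B * l n) - expR (B * l n) * expR (- (B * l n))) by ring.
have -> : lam * npow p n * (1 - expR (- (b * l n))) =
    lam * npow p n * expR (- (b * l n)) * (expR (b * l n) - 1).
  by rewrite -[X in X - expR _]E1; ring.
have -> : kap * npow p n * expR (- (b * l n)) * (expR (B * l n) - expR (B * l n) * expR (- (B * l n))) =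
   lam * npow p n * expR (- (b * l n)) * (th * (expR (B * l n) - 1)).
  by rewrite E2 /kap /th; field; rewrite gt_eqF.
apply: ler_wpM2l; last lra.
by apply: mulr_ge0; [apply: mulr_ge0; [exact: ltW|exact: npow_ge0]|exact: expR_ge0].
Qed.

Lemma power_kap_le1 : kap <= 1.
Proof. by have := psum_ge (isT : (0 < 1)%N); rewrite psum1 npow_1 mulr1. Qed.

Lemma natinv_cvg0 : (fun n => (n%:R^-1 : R)) @ \oo --> 0.
Proof.
have := @npow_cvg0 R 1 ltr01; apply: cvg_trans; apply: near_eq_cvg.
by exists 1%N => // n /= n0; rewrite npowN npow1.
Qed.

Lemma lnstep_cvg0 : l @ \oo --> 0.
Proof.
apply: (@squeeze_cvgr _ _ _ _ (fun=> 0) (fun n => n%:R^-1)).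
- exists 1%N => // n /= n0; rewrite lnstep_ge0//= lnstep_le//.
- exact: cvg_cst.
- exact: natinv_cvg0.
Qed.

(** By comparison with an integral psum n is asymptotic to n^p / p, and by
    [psum_le] it is at most kap (n + 1)^p. *)
Lemma power_kap_ge : 1 <= p * kap.
Proof.
have c1 : (fun n => 1 - npow (- p) n) @ \oo --> (1 : R).
  have -> : nbhs (1 : R) = nbhs (1 - 0 : R) by rewrite subr0.
  by apply: cvgB; [exact: cvg_cst|exact: npow_cvg0].
have c2 : (fun n => p * kap * expR (p * l n)) @ \oo --> p * kap.
  have -> : nbhs (p * kap) = nbhs (p * kap * expR (p * 0)) by rewrite mulr0 expR0 mulr1.
  apply: cvgMl_tmp.
  have c1' : (fun n => p * l n) @ \oo --> p * 0.
    by apply: cvgMl_tmp; exact: lnstep_cvg0.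
  exact: (cvg_comp _ _ c1' (@continuous_expR R (p * 0))).
apply: (ler_cvg_to c1 c2); exists 1%N => // -[//|n] _ /=.
have := @sum_npow_p_ge R p n p0; rewrite -/(psum n.+1) => h1.
have := psum_le (isT : (0 < n.+1)%N) => h2.
rewrite -(ler_pM2l (npow_gt0 p n.+1)) mulrBr -npowD subrr npow0 mulr1.
apply: (le_trans h1); have := ler_wpM2l (ltW p0) h2.
by rewrite npowS; move/le_trans; apply; rewrite le_eqVlt; apply/orP; left; apply/eqP; ring.
Qed.

Lemma power_p_ge1 : 1 <= p.
Proof.
rewrite leNgt; apply/negP => hp.
have := ler_wpM2l (ltW p0) power_kap_le1; have := power_kap_ge; lra.
Qed.

Lemma power_kap_eq : p * kap = 1.
Proof.
apply/eqP; rewrite eq_le power_kap_ge andbT.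
have c2 : (fun n => 1 + p * npow (- 1) n) @ \oo --> (1 : R).
  have -> : nbhs (1 : R) = nbhs (1 + p * 0 : R) by rewrite mulr0 addr0.
  by apply: cvgD; [exact: cvg_cst|apply: cvgMl_tmp; exact: npow_cvg0].
apply: (ler_cvg_to (cvg_cst (p * kap)) c2); exists 1%N => // -[//|n] _ /=.
have := @sum_npow_p_le R p n power_p_ge1; rewrite -/(psum n.+1) => h1.
have h2 := ler_wpM2l (ltW p0) (psum_ge (isT : (0 < n.+1)%N)).
rewrite -(ler_pM2l (npow_gt0 p n.+1)) mulrDr mulr1.
rewrite [npow p n.+1 * (p * kap)]mulrC -mulrA.
apply: (le_trans h2); apply: (le_trans h1).
by rewrite (npowD p (- 1)) lerD2l mulrCA.
Qed.

(** The recursion [power_rec] with lam eliminated by [power_kap_eq]. *)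
Lemma psum_exact n : (0 < n)%N ->
  B / b * npow p n * (1 - expR (- (b * l n))) = (1 - expR (- (B * l n))) * (p * psum n).
Proof.
move=> n0; have := power_rec n0.
have -> : lam = B / (p * b).
  have := power_kap_eq; rewrite /kap => e.
  have -> : lam = (p * (lam * b / B)) * (B / (p * b)).
    by field; rewrite !gt_eqF ?p0 ?b0 ?al0.
  by rewrite e mul1r.
move=> h; rewrite mulrCA -h; field; by rewrite !gt_eqF ?p0 ?b0.
Qed.

(** For p >= 2 the recursion at n = 1 contradicts the trapezoidal rule. *)
Lemma power_p_lt2 : p < 2.
Proof.
rewrite ltNge; apply/negP => p2; have bb := b0.
have := psum_exact (isT : (0 < 1)%N); rewrite psum1 npow_1 !mulr1.
have -> : l 1 = ln 2 by rewrite /lnstep ln1 subr0.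
have := trapezoid b0.
have -> : - (B * ln 2) = - (b * ln 2) + - (p * ln (2 : R)).
  by rewrite -pb; ring.
rewrite expRD.
have hP : expR (- (p * ln (2 : R))) <= 4^-1.
  have -> : (4^-1 : R) = expR (- (2 * ln 2)).
    rewrite expRN; congr (_^-1); rewrite mulrC expRM_natr lnK ?posrE//; by field.
  by rewrite ler_expR lerN2 ler_wpM2r// ln_ge0// ler1n.
have P0 := expR_gt0 (- (p * ln (2 : R))).
have E0 := expR_gt0 (- (b * ln (2 : R))).
have E1 : expR (- (b * ln (2 : R))) < 1.
  by rewrite expR_lt1 oppr_lt0 mulr_gt0// ln_gt0// ltr1n.
move: P0 hP E0 E1; move: (expR (- (p * ln 2))) (expR (- (b * ln 2))) => P E P0 hP E0 E1 tr.
rewrite -pb => /(congr1 (fun t => t * b / p)).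
have -> : (p + b) / b * (1 - E) * b / p = (1 - E) + b / p * (1 - E).
  by field; rewrite !gt_eqF ?p0.
have -> : (1 - E * P) * p * b / p = b * (1 - E * P) by field; rewrite gt_eqF.
have h1 : b / p * (1 - E) <= b / 2 * (1 - E).
  apply: ler_wpM2r; first by lra.
  by apply: ler_wpM2l; [exact: ltW|rewrite lef_pV2 ?posrE].
have h2 : b * (E * P) <= b * (E * 4^-1).
  by apply: ler_wpM2l; [exact: ltW|apply: ler_wpM2l; [exact: ltW|]].
lra.
Qed.

(** The trapezoidal rule underestimates the integral of the concave function
    t^(p - 1). The step is the convexity of the hyperbolic sine at (p / 2) l. *)
Lemma psum_upper n : (0 < n)%N ->
  p * psum n <= npow p n + p / 2 * npow (p - 1) n + p / 2 - 1.
Proof.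
have pp := power_p_ge1; have p2 := power_p_lt2.
elim: n => // -[_ _|n IH _]; first by rewrite psum1 !npow_1; lra.
rewrite psumS mulrDr; have := IH isT; set m := n.+2; set k := n.+1.
suff : npow p k + p / 2 * npow (p - 1) k + p * npow (p - 1) m <=
   npow p m + p / 2 * npow (p - 1) m by lra.
have ll := lnstep_gt0 (isT : (0 < k)%N).
have eP : npow (p - 1) m = npow p m * (1 - expR (- l k)).
  by rewrite npowD (npowN 1) npow1// expR_Nlnstep// opprB addrC subrK.
rewrite (npowSN p k) (npowSN (p - 1) k) -/m eP.
set M := npow p m.
have -> : M * expR (- (p * l k)) + p / 2 * (M * (1 - expR (- l k)) * expR (- ((p - 1) * l k))) +
   p * (M * (1 - expR (- l k))) =
  M * (expR (- (p * l k)) + p / 2 * (expR (- ((p - 1) * l k)) - expR (- l k) * expR (- ((p - 1) * l k)))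
   + p * (1 - expR (- l k))) by field.
have -> : M + p / 2 * (M * (1 - expR (- l k))) = M * (1 + p / 2 * (1 - expR (- l k))) by field.
rewrite ler_pM2l ?npow_gt0// -expRD.
have -> : - l k - (p - 1) * l k = - (p * l k) by ring.
(* Convexity of sh at (1 - p / 2) l, a fraction of (p / 2) l because p >= 1. *)
have c01 : 0 <= (1 - p / 2) / (p / 2) <= 1.
  by rewrite divr_ge0 ?ler_pdivrMr//=; lra.
have x0 : 0 <= p / 2 * l k by rewrite mulr_ge0 ?(ltW ll)//; lra.
have := sh_convex c01 x0.
have -> : (1 - p / 2) / (p / 2) * (p / 2 * l k) = (1 - p / 2) * l k by field; rewrite gt_eqF.
move=> hs.
have {}hs : p / 2 * sh ((1 - p / 2) * l k) <= (1 - p / 2) * sh (p / 2 * l k).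
  have -> : (1 - p / 2) * sh (p / 2 * l k) = p / 2 * ((1 - p / 2) / (p / 2) * sh (p / 2 * l k)).
    by field; rewrite gt_eqF.
  by rewrite ler_wpM2l//; lra.
have := ler_wpM2l (expR_ge0 (- (p / 2 * l k))) hs.
have i1 : expR (- (p / 2 * l k)) * sh ((1 - p / 2) * l k) =
    expR (- ((p - 1) * l k)) - expR (- l k).
  by rewrite /sh [LHS]mulrBr -!expRD; congr (expR _ - expR _); field.
have i2 : expR (- (p / 2 * l k)) * sh (p / 2 * l k) = 1 - expR (- (p * l k)).
  by rewrite /sh [LHS]mulrBr -!expRD addNr expR0; congr (1 - expR _); field.
rewrite [X in X <= _ -> _]mulrCA i1 [X in _ <= X -> _]mulrCA i2; lra.
Qed.

(** By [psum_exact] and two inequalities between hyperbolic functions, p psum n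
    is at least n^p + (p / 2) n^(p - 1) up to an error O(n^(p - 2)), which tends
    to 0. This contradicts the negative constant p / 2 - 1 in [psum_upper]. *)
Lemma power_sequence_absurd : False.
Proof.
have pp := power_p_ge1; have p2 := power_p_lt2; have bb := b0; have BB := B0.
pose c := 1 - p / 2; have cp : 0 < c by rewrite /c; lra.
have key n : (0 < n)%N -> B * n%:R^-1 <= 1 -> c <= (B ^+ 2 + p) * npow (p - 2) n.
  move=> n0 hn; set x := l n / 2.
  have ln0 := lnstep_gt0 n0; have ln1 := lnstep_le R n0; have ln2 := lnstep_ge R n0.
  have hU := psum_upper n0; have hE := psum_exact n0.
  have x0 : 0 <= x by rewrite /x; lra.
  (* Differences 1 - exp (- t l) in hyperbolic form, at the half step x = l / 2. *)
  have sE (t : R) : 1 - expR (- (t * l n)) = expR (- (t * x)) * sh (t * x).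
    by rewrite /sh [RHS]mulrBr -!expRD addNr expR0; congr (1 - expR _); rewrite /x; field.
  have s1 : 2 * (b * x) <= sh (b * x) by apply: sh_ge; rewrite mulr_ge0 ?(ltW bb).
  have s2 : sh (B * x) <= B * x * ch (B * x) by apply: sh_le; rewrite mulr_ge0 ?(ltW BB).
  have r0 : 0 <= B * x by rewrite mulr_ge0 ?(ltW BB).
  have rl : B * x <= B * n%:R^-1 / 2 by have := ler_wpM2l (ltW BB) ln1; rewrite /x; lra.
  have [] := @expR_quad R (B * x) r0; first by lra.
  move=> _ e1 _ e2.
  have chb : ch (B * x) <= 2 + 3 * (B * x) ^+ 2 by rewrite /ch; lra.
  have h1 : npow p n * expR (p * x) <= (1 + 3 / 2 * (B * x) ^+ 2) * (p * psum n).
    have e3 : expR (- (b * x)) = expR (p * x) * expR (- (B * x)).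
      by rewrite -expRD; rewrite -pb; congr expR; ring.
    move: hE; rewrite !sE e3 => hE.
    have sB : 0 < sh (B * x).
      have := one_sub_exp_gt0 n0; rewrite sE pmulr_rgt0//; exact: expR_gt0.
    have h2 : B / b * npow p n * expR (p * x) * sh (b * x) = sh (B * x) * (p * psum n).
      apply: (mulfI (lt0r_neq0 (expR_gt0 (- (B * x))))).
      by rewrite [RHS]mulrA -hE; ring.
    have h3 : B / b * npow p n * expR (p * x) * (2 * (b * x)) <= sh (B * x) * (p * psum n).
      rewrite -h2; apply: ler_wpM2l => //; apply: mulr_ge0; last exact: expR_ge0.
      by apply: mulr_ge0; [apply: divr_ge0; exact: ltW|exact: npow_ge0].
    have U0 : 0 <= p * psum n.
      rewrite mulr_ge0 ?(ltW p0)// sumr_ge0// => k _; exact: npow_ge0.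
    have h4 : sh (B * x) * (p * psum n) <= B * x * (2 + 3 * (B * x) ^+ 2) * (p * psum n).
      by apply: ler_wpM2r => //; apply: (le_trans s2); apply: ler_wpM2l.
    have xp : 0 < 2 * (B * x) by rewrite !mulr_gt0// /x; lra.
    rewrite -(ler_pM2l xp); have := le_trans h3 h4.
    have -> : B / b * npow p n * expR (p * x) * (2 * (b * x)) = 2 * (B * x) * (npow p n * expR (p * x)).
      by field; rewrite gt_eqF.
    by move/le_trans; apply; rewrite le_eqVlt; apply/orP; left; apply/eqP; field.
  have h5 : npow p n * (1 + p * x) <= (1 + 3 / 2 * (B * x) ^+ 2) * (p * psum n).
    apply: le_trans h1; rewrite ler_wpM2l ?npow_ge0//; exact: expR_ge1Dx.
  have q0 : 0 <= 1 + 3 / 2 * (B * x) ^+ 2 by have := sqr_ge0 (B * x); lra.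
  have := le_trans h5 (ler_wpM2l q0 hU).
  have eP : npow (p - 1) n = npow p n * n%:R^-1 by rewrite npowD npowN npow1.
  have eP2 : npow (p - 2) n = npow p n * n%:R^-1 ^+ 2.
    have -> : p - 2 = p + (- 1) + (- 1) by ring.
    by rewrite 2!npowD npowN npow1//; ring.
  rewrite eP eP2.
  have zz := inv_sqr_step_le R n0.
  have z1 : (n%:R^-1 : R) <= 1 by rewrite invf_le1 ?ltr0n// ler1n.
  have z0 : (0 : R) < n%:R^-1 by rewrite invr_gt0 ltr0n.
  have xz : n%:R^-1 - n%:R^-1 ^+ 2 <= 2 * x.
    by rewrite /x; move: zz ln2; move: (n%:R^-1 : R) (n.+1%:R^-1 : R) => z y; lra.
  have P0 := npow_ge0 p n.
  have r2 : (B * x) ^+ 2 <= B ^+ 2 * (n%:R^-1 ^+ 2) / 4.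
    have -> : B ^+ 2 * (n%:R^-1 ^+ 2) / 4 = (B * n%:R^-1 / 2) ^+ 2 by field; rewrite pnatr_eq0 -lt0n.
    by rewrite ler_sqr ?nnegrE// (le_trans r0).
  have r20 := sqr_ge0 (B * x).
  move: r2 r20 xz z0 z1 P0; move: ((B * x) ^+ 2) (npow p n) (n%:R^-1 : R) => r P z r2 r20 xz z0 z1 P0 h.
  clear - p0 p2 pp BB cp r2 r20 xz z0 z1 P0 h.
  have pz : p / 2 * z <= 1 by apply: mulr_ile1; lra.
  have i1 : P * (1 + p / 2 * (z - z ^+ 2)) <= P * (1 + p * x).
    by apply: ler_wpM2l => //; have := ler_wpM2l (ltW p0) xz; lra.
  have i2 : 0 <= 3 / 2 * r * c by apply: mulr_ge0; [apply: mulr_ge0 => //; lra|exact: ltW].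
  have i3 : P * (3 / 2 * r * (1 + p / 2 * z)) <= P * (3 / 2 * (B ^+ 2 * z ^+ 2 / 4) * 2).
    have pz0 : 0 <= p / 2 * z by apply: mulr_ge0; lra.
    by apply: ler_wpM2l => //; apply: ler_pM; lra.
  have i4 : 0 <= P * z ^+ 2 * (p / 2 + B ^+ 2 / 4).
    apply: mulr_ge0; first by apply: mulr_ge0 => //; exact: sqr_ge0.
    by have := sqr_ge0 B; lra.
  rewrite /c in i2 *; lra.
pose D := B ^+ 2 + p; have D0 : 0 < D by rewrite /D; have := sqr_ge0 B; lra.
have c0 : (fun n => npow (- (2 - p)) n) @ \oo --> 0 by apply: npow_cvg0; lra.
have [|K hK] := (cvg0P _).1 c0 (c / (2 * D)); first by rewrite divr_gt0// mulr_gt0.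
pose n := maxn K (Num.truncn B).+1.
have := hK n (leq_maxl _ _); rewrite ger0_norm ?npow_ge0// opprB => h1.
have n0 : (0 < n)%N by rewrite /n leq_max orbT.
have h2 : B * n%:R^-1 <= 1 by apply: natr_inv_ge1; [exact: ltW|exact: leq_maxr].
have := key n n0 h2; rewrite -/D.
have : D * npow (p - 2) n <= D * (c / (2 * D)) by rewrite ler_pM2l.
have -> : D * (c / (2 * D)) = c / 2 by field; rewrite gt_eqF.
lra.
Qed.

End power_sequence.

(** * Real reproducing kernels as test sequences *)

Section limits.
Variables (R : realType) (al : R).
Hypothesis al0 : 0 < al.
Implicit Types (x : nat -> R) (mu de : R) (n N : nat).

Definition sqnorm x : R := limn (fun N => \sum_(k < N) x k ^+ 2).
Definition qlim x : R := limn (qform al x).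

Lemma sqnorm_cvg x : l2 x -> (fun N => \sum_(k < N) x k ^+ 2) @ \oo --> sqnorm x.
Proof. exact: l2_cvg. Qed.

Lemma sqnorm_ge x N : l2 x -> \sum_(k < N) x k ^+ 2 <= sqnorm x.
Proof.
move=> xl2; apply: (nondecreasing_cvgn_le _ (l2_cvg xl2)).
by apply/nondecreasing_seqP => n; rewrite big_ord_recr lerDl sqr_ge0.
Qed.

Lemma sqnorm_ge0 x : l2 x -> 0 <= sqnorm x.
Proof. by move=> /(sqnorm_ge 0); rewrite big_ord0. Qed.

(** In [sum_by_parts] the sum increases and is bounded by admissibility, and the
    boundary term tends to 0 by [wsum_small]. *)
Lemma qform_cvg x mu : 0 < mu -> admissible al mu -> l2 x -> cvgn (qform al x).
Proof.
move=> mu0 adm xl2.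
pose D N := \sum_(n < N) (npow (- (2 * al)) n.+1 - npow (- (2 * al)) n.+2) * wsum al x n.+1 ^+ 2.
have Dpos n : 0 <= npow (- (2 * al)) n.+1 - npow (- (2 * al)) n.+2.
  by rewrite subr_ge0 !npowN lef_pV2 ?posrE ?npow_gt0// npow_le// mulr_ge0// ltW.
have cD : cvgn D.
  apply: nondecreasing_is_cvgn.
    apply/nondecreasing_seqP => N; rewrite /D big_ord_recr lerDl /=.
    by apply: mulr_ge0 => //; exact: sqr_ge0.
  exists (sqnorm x / mu) => _ [N _ <-].
  rewrite ler_pdivlMr// mulrC.
  apply: le_trans (sqnorm_ge N.+1 xl2); apply: le_trans (qform_le (ltW mu0) adm mu0 x N.+1).
  rewrite ler_pM2l// sum_by_parts lerDl; apply: mulr_ge0; [exact: npow_ge0|exact: sqr_ge0].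
have c0 : (fun N => npow (- (2 * al)) N * wsum al x N ^+ 2) @ \oo --> 0.
  have h := wsum_small al0 xl2.
  have -> : nbhs (0 : R) = nbhs (0 * 0 : R) by rewrite mulr0.
  apply: (cvg_trans _ (cvgM h h)); apply: near_eq_cvg; near=> N.
  by rewrite /= (@npow_split _ (- al) (- al) (- (2 * al))); [ring|ring].
have c1 : (fun N => qform al x N.+1) @ \oo --> limn D + 0.
  under eq_fun do rewrite sum_by_parts.
  apply: cvgD => //.
  by move: c0; rewrite -cvg_shiftS.
by apply/cvg_ex; exists (limn D + 0); rewrite -cvg_shiftS.
Unshelve. all: by end_near. Qed.

Lemma qlim_le x mu : 0 < mu -> admissible al mu -> l2 x -> mu * qlim x <= sqnorm x.
Proof.
move=> mu0 adm xl2; apply: (ler_cvg_to (cvgMl_tmp (qform_cvg mu0 adm xl2) : _ @ \oo --> mu * qlim x) (sqnorm_cvg xl2)).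
by near=> N; apply: qform_le => //; exact: ltW.
Unshelve. all: by end_near. Qed.

(** The coefficients of the reproducing kernel at the real point 1/2 + de. *)
Definition kseq de k : R := npow (- 2^-1 - de) k.+1.

Lemma kseq_sqr de k : kseq de k ^+ 2 = npow (- (2 * de) - 1) k.+1.
Proof.
rewrite /kseq npow_sqr; have -> : 2 * (- 2^-1 - de) = - (2 * de) - 1 by field.
by [].
Qed.

Lemma kseq_sum_le de N : 0 < de -> \sum_(k < N) kseq de k ^+ 2 <= 1 + (2 * de)^-1.
Proof.
move=> de0; under eq_bigr do rewrite kseq_sqr.
by apply: sum_npow_le; rewrite mulr_gt0.
Qed.

Lemma kseq_l2 de : 0 < de -> l2 (kseq de).
Proof. by move=> de0; exists (1 + (2 * de)^-1) => N; exact: kseq_sum_le. Qed.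

Lemma sqnorm_kseq_ge de : 0 < de -> (2 * de)^-1 <= sqnorm (kseq de).
Proof.
move=> de0; have c0 : (fun N => (2 * de)^-1 * (1 - npow (- (2 * de)) N.+1)) @ \oo --> (2 * de)^-1.
  have -> : nbhs ((2 * de)^-1) = nbhs ((2 * de)^-1 * (1 - 0) : R) by rewrite subr0 mulr1.
  apply: cvgMl_tmp; apply: cvgB; first exact: cvg_cst.
  have h : (fun N => npow (- (2 * de)) N) @ \oo --> (0 : R) by apply: npow_cvg0; rewrite mulr_gt0.
  by move: h; rewrite -cvg_shiftS.
apply: (ler_cvg_to c0 (sqnorm_cvg (kseq_l2 de0))); near=> N.
under [leRHS]eq_bigr do rewrite kseq_sqr.
by apply: sum_npow_ge; rewrite mulr_gt0.
Unshelve. all: by end_near. Qed.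

Lemma sqnorm_kseq_le de : 0 < de -> sqnorm (kseq de) <= 1 + (2 * de)^-1.
Proof.
move=> de0; apply: (ler_cvg_to (sqnorm_cvg (kseq_l2 de0)) (cvg_cst _)); near=> N.
exact: kseq_sum_le.
Unshelve. all: by end_near. Qed.

Lemma wsum_kseq de n : wsum al (kseq de) n = \sum_(k < n) npow (al - de - 1) k.+1.
Proof.
apply: eq_bigr => k _; rewrite /kseq -npowD.
by have -> : al - 2^-1 + (- 2^-1 - de) = al - de - 1 by field.
Qed.

Lemma qform_kseq_step de N : qform al (kseq de) N.+1 - qform al (kseq de) N =
  2 * npow (- 1 - al - de) N.+1 * wsum al (kseq de) N.+1 - npow (- (2 + 2 * de)) N.+1.
Proof.
rewrite qformS addrC addKr.
have -> : wsum al (kseq de) N = wsum al (kseq de) N.+1 - npow (al - de - 1) N.+1.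
  by rewrite !wsum_kseq big_ord_recr addrK.
rewrite (@npow_split _ (- (2 * al)) (al - de - 1) (- 1 - al - de)); last by ring.
rewrite (@npow_split _ (- (2 * al)) (2 * (al - de - 1)) (- (2 + 2 * de))); last by ring.
by rewrite -(npow_sqr (al - de - 1)); ring.
Qed.

(** The sum S_n is at least (n^(al - de) - 1) / (al - de), so that the increment
    of the form is at least 2 / al times the square of the new entry, up to
    terms with a sum bounded uniformly in de. *)
Lemma qform_kseq_lower : exists2 C, 0 <= C & forall de, 0 < de -> de <= al / 2 ->
  forall N, 2 / al * \sum_(k < N) kseq de k ^+ 2 - C <= qform al (kseq de) N.
Proof.
have al1 := al0.
pose C1 := 4 / al; pose C := C1 * (1 + al^-1) + (1 + 1^-1).
have C10 : 0 <= C1 by rewrite divr_ge0 ?ltW.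
exists C.
  have ai : 0 <= al^-1 by rewrite invr_ge0 ltW.
  by rewrite /C invr1 addr_ge0 ?mulr_ge0//; lra.
move=> de de0 dea N.
pose p := al - de; have p0 : 0 < p by rewrite /p; lra.
have p2 : 2 / p <= C1.
  rewrite ler_pdivrMr// /C1 mulrAC ler_pdivlMr//; rewrite /p; lra.
have p1 : 2 / al <= 2 / p by rewrite ler_pM2l// lef_pV2 ?posrE// /p; lra.
suff : 2 / al * \sum_(k < N) kseq de k ^+ 2 - (C1 * \sum_(k < N) npow (- al - 1) k.+1 +
    \sum_(k < N) npow (- 1 - 1) k.+1) <= qform al (kseq de) N.
  apply: le_trans; rewrite lerD2l lerN2 /C lerD//.
    by rewrite ler_wpM2l// sum_npow_le.
  exact: sum_npow_le.
elim: N => [|N IH]; first by rewrite !big_ord0 qform0 !mulr0; lra.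
rewrite !big_ord_recr /=.
suff : 2 / al * kseq de N ^+ 2 - C1 * npow (- al - 1) N.+1 - npow (- 1 - 1) N.+1 <=
   qform al (kseq de) N.+1 - qform al (kseq de) N.
  by move: IH; lra.
rewrite qform_kseq_step kseq_sqr.
have h1 := @sum_npow_p_ge R p N p0; rewrite wsum_kseq -/p.
have h2 : npow (- (2 + 2 * de)) N.+1 <= npow (- 1 - 1) N.+1.
  rewrite ler_expR; apply: ler_wpM2r; last by lra.
  by rewrite ln_ge0// ler1n.
have h3 : npow (- 1 - al - de) N.+1 <= npow (- al - 1) N.+1.
  rewrite ler_expR; apply: ler_wpM2r; last by lra.
  by rewrite ln_ge0// ler1n.
have h4 : 2 / p * npow (- 1 - al - de) N.+1 * (npow p N.+1 - 1) <=
    2 * npow (- 1 - al - de) N.+1 * \sum_(k < N.+1) npow (p - 1) k.+1.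
  have -> : 2 * npow (- 1 - al - de) N.+1 * \sum_(k < N.+1) npow (p - 1) k.+1 =
    2 / p * npow (- 1 - al - de) N.+1 * (p * \sum_(k < N.+1) npow (p - 1) k.+1).
    by field; rewrite gt_eqF.
  apply: ler_wpM2l => //; apply: mulr_ge0; last exact: npow_ge0.
  by rewrite divr_ge0// ltW.
have e : npow (- 1 - al - de) N.+1 * npow p N.+1 = npow (- (2 * de) - 1) N.+1.
  by rewrite -npowD /p; have -> : - 1 - al - de + (al - de) = - (2 * de) - 1 by ring.
have h5 : 2 / p * npow (- 1 - al - de) N.+1 <= C1 * npow (- al - 1) N.+1.
  by apply: ler_pM => //; [rewrite divr_ge0// ltW|exact: npow_ge0].
have h6 : 2 / al * npow (- (2 * de) - 1) N.+1 <= 2 / p * npow (- (2 * de) - 1) N.+1.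
  by apply: ler_wpM2r => //; exact: npow_ge0.
move: h4; rewrite mulrBr mulr1 -[X in X - _ <= _ -> _]mulrA e; lra.
Qed.

(** The matching estimate; al - de >= 1 makes the summand of S_n monotone. *)
Lemma qform_kseq_upper de N : 0 < de -> 1 <= al - de ->
  qform al (kseq de) N <= 2 / (al - de) * \sum_(k < N) kseq de k ^+ 2 + 2.
Proof.
move=> de0 p1; set p := al - de; have p0 : 0 < p by rewrite /p; lra.
suff : qform al (kseq de) N <= 2 / p * \sum_(k < N) kseq de k ^+ 2 + \sum_(k < N) npow (- 1 - 1) k.+1.
  move/le_trans; apply; rewrite lerD2l (le_trans (sum_npow_le _ ltr01))// invr1; lra.
elim: N => [|N IH]; first by rewrite !big_ord0 qform0 !mulr0 addr0.
rewrite !big_ord_recr /=.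
suff : qform al (kseq de) N.+1 - qform al (kseq de) N <= 2 / p * kseq de N ^+ 2 + npow (- 1 - 1) N.+1.
  by move: IH; lra.
rewrite qform_kseq_step kseq_sqr.
have h1 := @sum_npow_p_le R p N p1; rewrite wsum_kseq -/p.
have h2 : npow (- (2 + 2 * de)) N.+1 <= npow (- 1 - 1) N.+1.
  rewrite ler_expR; apply: ler_wpM2r; last by lra.
  by rewrite ln_ge0// ler1n.
have h4 : 2 * npow (- 1 - al - de) N.+1 * \sum_(k < N.+1) npow (p - 1) k.+1 <=
  2 / p * npow (- 1 - al - de) N.+1 * (npow p N.+1 + p * npow (p - 1) N.+1).
  have -> : 2 * npow (- 1 - al - de) N.+1 * \sum_(k < N.+1) npow (p - 1) k.+1 =
    2 / p * npow (- 1 - al - de) N.+1 * (p * \sum_(k < N.+1) npow (p - 1) k.+1).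
    by field; rewrite gt_eqF.
  apply: ler_wpM2l => //; apply: mulr_ge0; last exact: npow_ge0.
  by rewrite divr_ge0// ltW.
have e : npow (- 1 - al - de) N.+1 * npow p N.+1 = npow (- (2 * de) - 1) N.+1.
  by rewrite -npowD /p; have -> : - 1 - al - de + (al - de) = - (2 * de) - 1 by ring.
have e2 : npow (- 1 - al - de) N.+1 * npow (p - 1) N.+1 = npow (- (2 + 2 * de)) N.+1.
  by rewrite -npowD /p; have -> : - 1 - al - de + (al - de - 1) = - (2 + 2 * de) by ring.
have e3 : 2 / p * npow (- 1 - al - de) N.+1 * (npow p N.+1 + p * npow (p - 1) N.+1) =
   2 / p * npow (- (2 * de) - 1) N.+1 + 2 * npow (- (2 + 2 * de)) N.+1.
  by rewrite -e -e2; field; rewrite gt_eqF.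
lra.
Qed.

End limits.

(** * The gap between the kernels and the ground state *)

Section gap.
Variables (R : realType) (al mu : R).
Hypotheses (al1 : 1 < al) (sub : subcritical al mu).
Let al0 : 0 < al. Proof. exact: lt_trans al1. Qed.
Let mup : 0 < mu. Proof. by case: sub. Qed.
Let mu0 : 0 <= mu. Proof. exact: ltW. Qed.
Let adm : admissible al mu. Proof. by case: sub. Qed.
Local Notation Sm := (Sm al mu).
Local Notation gm := (gm al mu).
Implicit Types (n N k : nat) (de : R).

(** As de tends to 0 the quotient of the kernel tends to 2 / al, which is less
    than 1 / mu. The assumption al > 1 allows [qform_kseq_upper]. *)
Lemma small_kernel_gap : exists2 h, 0 < h & exists2 e, 0 < e & forall de, 0 < de -> de < h ->
  mu * qlim al (kseq de) <= (1 - e) * sqnorm (kseq de).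
Proof.
have aa := al0; have a1 := al1; have mm := mup.
have mual : mu < al / 2 by case: sub.
pose e := (1 - 2 * mu / al) / 2.
have e0 : 0 < e.
  have : 2 * mu / al < 1 by rewrite ltr_pdivrMr// mul1r; lra.
  by rewrite /e; lra.
pose K := mu * (4 / al ^+ 2 + 4).
have K0 : 0 < K by rewrite mulr_gt0// addr_gt0// divr_gt0// exprn_gt0.
pose h := Num.min (al - 1) (Num.min (al / 2) (e / K)).
have h0 : 0 < h by rewrite !lt_min divr_gt0// divr_gt0// !andbT subr_gt0.
exists h => //; exists e => // de de0; rewrite !lt_min => /and3P[d1 d2 d3].
have d3' : K * de <= e by rewrite mulrC -ler_pdivlMr// ltW.
have kl2 := kseq_l2 de0; have n0 := sqnorm_ge0 kl2.
have up : qlim al (kseq de) <= 2 / (al - de) * sqnorm (kseq de) + 2.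
  apply: (ler_cvg_to (qform_cvg al0 mup adm kl2) (_ : (fun N => 2 / (al - de) * \sum_(k < N) kseq de k ^+ 2 + 2) @ \oo --> _)).
    by apply: cvgD; [apply: cvgMl_tmp; exact: sqnorm_cvg|exact: cvg_cst].
  by near=> N; apply: qform_kseq_upper => //; lra.
have n1 : 2 <= 4 * de * sqnorm (kseq de).
  have := sqnorm_kseq_ge de0; rewrite -(ler_pM2l (_ : 0 < 4 * de)) ?mulr_gt0//.
  by have -> : 4 * de * (2 * de)^-1 = 2 by field; rewrite gt_eqF.
have fr : 2 / (al - de) <= 2 / al + 4 / al ^+ 2 * de.
  have -> : 2 / al + 4 / al ^+ 2 * de = (2 * al + 4 * de) / al ^+ 2 by field; rewrite gt_eqF.
  have ad : 0 < al - de by lra.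
  rewrite ler_pdivrMr// mulrAC ler_pdivlMr ?exprn_gt0//.
  have : 0 <= de * (al - 2 * de) by rewrite mulr_ge0 ?ltW//; lra.
  lra.
have h1 : qlim al (kseq de) <= (2 / al + 4 / al ^+ 2 * de + 4 * de) * sqnorm (kseq de).
  by have := ler_wpM2r n0 fr; lra.
apply: (le_trans (ler_wpM2l mu0 h1)); rewrite mulrA; apply: ler_wpM2r => //.
have -> : mu * (2 / al + 4 / al ^+ 2 * de + 4 * de) = 2 * mu / al + K * de.
  by rewrite /K; field; rewrite gt_eqF.
by move: d3'; rewrite /e; lra.
Unshelve. all: by end_near. Qed.

(** Each single Picone defect is bounded by the total deficit. *)
Lemma picone_rem_le_deficit x n : l2 x -> picone_rem al mu x n.+1 <= sqnorm x - mu * qlim al x.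
Proof.
move=> xl2.
have c : (fun N => \sum_(k < N) x k ^+ 2 - mu * qform al x N) @ \oo --> sqnorm x - mu * qlim al x.
  by apply: cvgB; [exact: sqnorm_cvg|apply: cvgMl_tmp; exact: (qform_cvg al0 mup adm)].
apply: (ler_cvg_to (cvg_cst _) c); exists n.+2 => // -[//|N] /=; rewrite ltnS => nN.
have := qform_le_rem mu0 adm mup x N.
rewrite (bigD1 (Ordinal nN))//=.
have : 0 <= \sum_(i < N | i != Ordinal nN) picone_rem al mu x i.+1.
  by rewrite sumr_ge0// => k _; exact: picone_rem_ge0.
lra.
Qed.

(** Otherwise some kernels have quotients tending to 1 / mu. By
    [small_kernel_gap] their parameters stay away from 0, so their norms are
    bounded and all their Picone defects tend to 0. Hence their sums S_n
    converge to multiples of those of the ground state. These are then the sums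
    of a power sequence, against [power_sequence_absurd]. *)
Lemma kernel_gap : exists2 e, 0 < e & forall de, 0 < de ->
  mu * qlim al (kseq de) <= (1 - e) * sqnorm (kseq de).
Proof.
apply: contrapT => no_gap.
have hk k : exists de, 0 < de /\ (1 - k.+1%:R^-1) * sqnorm (kseq de) < mu * qlim al (kseq de).
  apply: contrapT => h; apply: no_gap; exists (k.+1%:R^-1); first by rewrite invr_gt0.
  move=> de de0; rewrite leNgt; apply/negP => hd; apply: h; by exists de.
have [d hd] := choice hk.
have d0 k : 0 < d k by have [] := hd k.
have [h h0 [e e0 he]] := small_kernel_gap.
pose M := 1 + (2 * h)^-1.
have M0 : 0 < M by rewrite addr_gt0// invr_gt0 mulr_gt0.
have bound : \forall k \near \oo, forall n, picone_rem al mu (kseq (d k)) n.+1 <= M * k.+1%:R^-1.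
  exists (Num.truncn e^-1).+1 => // k /= ke n.
  have hk1 : k.+1%:R^-1 <= e.
    rewrite -[leRHS]invrK lef_pV2 ?posrE ?invr_gt0//.
    by rewrite (le_trans (ltW (truncnS_gt _)))// ler_nat ltnW.
  have kl2 := kseq_l2 (d0 k); have n0 := sqnorm_ge0 kl2.
  have [_ hdk] := hd k.
  have dh : h <= d k.
    rewrite leNgt; apply/negP => hlt; have := he _ (d0 k) hlt.
    have : k.+1%:R^-1 * sqnorm (kseq (d k)) <= e * sqnorm (kseq (d k)) by apply: ler_wpM2r.
    move: hdk; move: (k.+1%:R^-1 : R) => z; lra.
  have nM : sqnorm (kseq (d k)) <= M.
    apply: (le_trans (sqnorm_kseq_le (d0 k))); rewrite lerD2l lef_pV2 ?posrE ?mulr_gt0//.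
    by rewrite ler_pM2l.
  apply: (le_trans (picone_rem_le_deficit n kl2)).
  have : sqnorm (kseq (d k)) * k.+1%:R^-1 <= M * k.+1%:R^-1 by apply: ler_wpM2r; first rewrite invr_ge0.
  move: hdk; move: (k.+1%:R^-1 : R) => z; lra.
pose W n k := wsum al (kseq (d k)) n.
have Sp n : 0 < Sm n.+1 by exact: adm_Sm_gt0.
have diff n : (fun k => W n.+2 k / Sm n.+2 - W n.+1 k / Sm n.+1) @ \oo --> 0.
  pose c := npow (1 - 2 * al) n.+2 * (Sm n.+2 * Sm n.+1).
  have cp : 0 < c by rewrite !mulr_gt0// npow_gt0.
  apply/cvg0P => e1 e10.
  have z0 : (fun k => M / c * (k%:R^-1 : R)) @ \oo --> 0.
    have -> : nbhs (0 : R) = nbhs (M / c * 0 : R) by rewrite mulr0.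
    by apply: cvgMl_tmp; exact: natinv_cvg0.
  have [K1 hK1] := (cvg0P _).1 z0 (e1 ^+ 2) (exprn_gt0 2 e10).
  have [K2 _ hK2] := bound.
  exists (maxn K1 K2) => k; rewrite geq_max => /andP[k1 k2].
  have := hK2 k k2 n; rewrite /picone_rem -/(W n.+2 k) -/(W n.+1 k) -/c => hr.
  have := hK1 k.+1 (leq_trans k1 (leqnSn k)).
  rewrite ger0_norm; last by rewrite mulr_ge0 ?invr_ge0// divr_ge0 ?ltW.
  move: hr; rewrite mulrC -ler_pdivlMr// => hr hz.
  rewrite -ler_sqr ?nnegrE ?(ltW e10)// real_normK ?num_real//.
  by apply: (le_trans hr); apply: le_trans hz; rewrite mulrAC.
have Wlim n : (fun k => W n.+1 k) @ \oo --> Sm n.+1 / Sm 1.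
  elim: n => [|n IH].
    have -> : W 1 = (fun=> 1).
      by apply/funext => k; rewrite /W wsum_kseq big_ord1 npow_1.
    rewrite divff ?gt_eqF//; exact: cvg_cst.
  have -> : W n.+2 = (fun k => Sm n.+2 * ((W n.+2 k / Sm n.+2 - W n.+1 k / Sm n.+1) + W n.+1 k / Sm n.+1)).
    apply/funext => k; have := Sp n; have := Sp n.+1.
    by move: (Sm n.+1) (Sm n.+2) => A B hB hA; field; rewrite !gt_eqF.
  have -> : Sm n.+2 / Sm 1 = Sm n.+2 * (0 + Sm n.+1 / Sm 1 / Sm n.+1).
    have := Sp n; have := Sp 0%N.
    by move: (Sm n.+1) (Sm 1) (Sm n.+2) => A B C hB hA; field; rewrite !gt_eqF.
  by apply: cvgMl_tmp; apply: cvgD => //; exact: cvgMr_tmp.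
have Wlim' n : (fun k => W n k) @ \oo --> Sm n / Sm 1.
  case: n => [|n //]; rewrite Sm0 mul0r.
  have -> : W 0%N = (fun=> 0) by apply/funext => k; rewrite /W wsum0.
  exact: cvg_cst.
(* The entries of the kernels, times powers of n, converge to the increments of
   Sm. *)
pose en n := (Sm n.+1 - Sm n) / Sm 1.
have elim_ n : (fun k => npow (al - d k - 1) n.+1) @ \oo --> en n.
  have -> : (fun k => npow (al - d k - 1) n.+1) = (fun k => W n.+1 k - W n k).
    by apply/funext => k; rewrite /W !wsum_kseq big_ord_recr [RHS]addrAC subrr add0r.
  by rewrite /en mulrBl; exact: cvgB.
have e1p : 0 < en 1%N.
  rewrite divr_gt0// SmS addrAC subrr add0r; apply: mulr_gt0; last exact: adm_gm_gt0.
  by rewrite mulr_gt0 ?npow_gt0.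
have l2p : 0 < ln (2 : R) by rewrite ln_gt0// ltr1n.
(* The exponents converge, because the powers of 2 do. *)
pose q := ln (en 1%N) / ln 2.
have qcvg : (fun k => al - d k - 1) @ \oo --> q.
  have c : (fun k => ln (npow (al - d k - 1) 2)) @ \oo --> ln (en 1%N).
    exact: (cvg_comp _ _ (elim_ 1%N) (continuous_ln e1p)).
  have -> : (fun k => al - d k - 1) = (fun k => ln (npow (al - d k - 1) 2) / ln 2).
    by apply/funext => k; rewrite /npow expRK mulfK// gt_eqF.
  exact: cvgMr_tmp.
have eq_en n : en n = npow q n.+1.
  have c : (fun k => npow (al - d k - 1) n.+1) @ \oo --> npow q n.+1.
    have c1 : (fun k => (al - d k - 1) * ln n.+1%:R) @ \oo --> q * ln n.+1%:R by exact: cvgMr_tmp.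
    exact: (cvg_comp _ _ c1 (@continuous_expR R (q * ln n.+1%:R))).
  exact: (cvg_unique _ (elim_ n) c).
have dS n : Sm n.+1 - Sm n = Sm 1 * npow q n.+1.
  by rewrite -eq_en /en mulrCA divff ?mulr1// gt_eqF.
have SU n : Sm n = Sm 1 * psum (q + 1) n.
  elim: n => [|n IH]; first by rewrite Sm0 /psum big_ord0 mulr0.
  by rewrite psumS addrK mulrDr -IH -dS; ring.
have geq n : gm n = Sm 1 / mu * npow (- (2 * al - (q + 1))) n.+1.
  have := dS n; rewrite SmS addrAC subrr add0r => e2.
  have e3 : npow (- (2 * al - (q + 1))) n.+1 * npow (2 * al - 1) n.+1 = npow q n.+1.
    by rewrite -npowD; have -> : - (2 * al - (q + 1)) + (2 * al - 1) = q by ring.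
  have nz := npow_neq0 (2 * al - 1) n.+1.
  apply: (mulfI nz); apply: (mulfI (lt0r_neq0 mup)).
  by rewrite mulrA e2 -e3; move: (Sm 1) => A; field; rewrite gt_eqF.
apply: (@power_sequence_absurd R al (mu^-1) (q + 1) (2 * al - (q + 1)) al0).
- by rewrite invr_gt0.
- by ring.
- case=> // n _; have := gm_step al mu n; rewrite !geq (SU n.+1) -mulrBr => e2.
  apply: (mulfI (lt0r_neq0 (Sp 0%N))).
  by rewrite mulrA e2; ring.
Qed.

End gap.

(** * Laguerre functions *)

Section laguerre.
Variable R : realType.
Implicit Types (x t b g : R) (k n N : nat).

(** Laguerre polynomials by the three-term recursion; pairs (L_k, L_(k+1)) make
    it structural. *)
Fixpoint lagp k x : R * R :=
  if k is m.+1 then let: (u, v) := lagp m x in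
    (v, ((2 * m%:R + 3 - x) * v - (m%:R + 1) * u) / (m%:R + 2))
  else (1, 1 - x).

Definition lag k x : R := (lagp k x).1.

Lemma lag0 x : lag 0 x = 1. Proof. by []. Qed.
Lemma lag1 x : lag 1 x = 1 - x. Proof. by []. Qed.

Lemma lag_rec m x : (m%:R + 2) * lag m.+2 x =
  (2 * m%:R + 3 - x) * lag m.+1 x - (m%:R + 1) * lag m x.
Proof.
rewrite /lag /=; case: (lagp m x) => u v /=.
have h : (m%:R + 2 : R) != 0 by rewrite -natrD pnatr_eq0 addn2.
by rewrite mulrC divfK.
Qed.

(** The derivatives, from the identity L_(k+1)' = L_k' - L_k. *)
Fixpoint dlag k x : R := if k is m.+1 then dlag m x - lag m x else 0.

Lemma dlag_lag k x : x * dlag k.+1 x = (k%:R + 1) * (lag k.+1 x - lag k x).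
Proof.
elim: k => [|k IH]; first by rewrite /= lag0 lag1; ring.
have := lag_rec k x; rewrite -natr1 [dlag k.+2 x]/= mulrBr IH; lra.
Qed.

Lemma der_lag k t : is_derive t 1 (lag k) (dlag k t) /\ is_derive t 1 (lag k.+1) (dlag k.+1 t).
Proof.
elim: k => [|k [IH1 IH2]].
  split; first exact: derC.
  have := derB (derC 1 t) (derI t); exact.
split => //.
have k2 : (k%:R + 2 : R) != 0 by rewrite -natrD pnatr_eq0 addn2.
have e : lag k.+2 = (fun x => (k%:R + 2)^-1 * ((2 * k%:R + 3 - x) * lag k.+1 x - (k%:R + 1) * lag k x)).
  by apply/funext => x; rewrite -lag_rec mulrA mulVf// mul1r.
rewrite e.
have h := derZ (k%:R + 2)^-1 (derB (derM (derB (derC (2 * k%:R + 3) t) (derI t)) IH2) (derZ (k%:R + 1) IH1)).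
apply: (is_derive_eq h).
have hd := dlag_lag k t; move: hd => /=.
set D := dlag k t; set a := lag k t; set b := lag k.+1 t => hd.
apply: (mulfI k2); rewrite mulrA mulfV// mul1r.
by lra.
Qed.

(** The coefficients of the powers of z in exp (- b (1 - z) / (1 + z)) / (1 +
    z). *)
Definition sco k b : R := (-1) ^+ k * (expR (- b) * lag k (2 * b)).

(** The coefficients of the powers of z in exp (- b (1 - z) / (1 + z)). *)
Definition cco k b : R := if k is m.+1 then sco m.+1 b + sco m b else sco 0 b.

Definition dsco k b : R := (-1) ^+ k * (expR (- b) * (2 * dlag k (2 * b) - lag k (2 * b))).

Lemma der_sco k t : is_derive t 1 (sco k) (dsco k t).
Proof.
have h1 := der_expM (-1) t.
have h2 : is_derive t 1 (fun t => lag k (2 * t)) (dlag k (2 * t) * 2).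
  refine (der_comp (g := fun t => 2 * t) (proj1 (der_lag k (2 * t))) _).
  by rewrite -[X in is_derive _ _ _ X](mulr1 2); apply: derZ; exact: derI.
have := derZ ((-1) ^+ k) (derM h1 h2).
have e s : -1 * s = - s by rewrite mulN1r.
under eq_fun do rewrite e.
rewrite e => h; apply: (is_derive_eq h); rewrite /dsco; ring.
Qed.

Lemma der_cco k t : is_derive t 1 (cco k.+1) (- (sco k.+1 t - sco k t)).
Proof.
have h := derD (der_sco k.+1 t) (der_sco k t).
by apply: (is_derive_eq h); rewrite /dsco /sco /= exprS; ring.
Qed.

Lemma der_cco0 t : is_derive t 1 (cco 0) (- sco 0 t).
Proof. by apply: (is_derive_eq (der_sco 0 t)); rewrite /dsco /sco /= lag0; ring. Qed.

Lemma lag_0 k : lag k 0 = 1.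
Proof.
suff : lag k 0 = 1 /\ lag k.+1 0 = 1 by case.
elim: k => [|k [IH1 IH2]]; first by rewrite lag0 lag1 subr0.
split => //.
have k2 : (k%:R + 2 : R) != 0 by rewrite -natrD pnatr_eq0 addn2.
apply: (mulfI k2); rewrite lag_rec IH1 IH2; ring.
Qed.

Lemma sco_0 k : sco k 0 = (-1) ^+ k.
Proof. by rewrite /sco mulr0 lag_0 oppr0 expR0 !mulr1. Qed.

Lemma cco_0 k : cco k 0 = (k == 0%N)%:R.
Proof.
case: k => [|k]; first by rewrite /cco sco_0.
by rewrite /cco !sco_0 exprS mulN1r addNr.
Qed.

Lemma cco0E b : cco 0 b = expR (- b).
Proof. by rewrite /cco /sco expr0 lag0 mulr1 mul1r. Qed.

Definition gram N b g : R := \sum_(k < N.+1) cco k b * cco k g.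

Lemma gramS N b g : gram N.+1 b g = gram N b g + cco N.+1 b * cco N.+1 g.
Proof. by rewrite /gram big_ord_recr. Qed.

Lemma gram_0 N b : gram N b 0 = expR (- b).
Proof.
rewrite /gram big_ord_recl cco_0 mulr1 cco0E big1 ?addr0// => k _.
by rewrite cco_0 mulr0.
Qed.

Lemma der_shift (f : R -> R) (df : R -> R) b t : (forall t, is_derive t 1 f (df t)) ->
  is_derive t 1 (fun t => f (b + t)) (df (b + t)).
Proof.
move=> h; rewrite -[df (b + t)]mulr1.
refine (der_comp (g := fun t => b + t) (h (b + t)) _).
by have := derD (derC b t) (derI t); rewrite add0r.
Qed.

(** The product c_k(b) c_k(g) involves sums of two consecutive s_k, and the
    derivatives of the c_k are differences of them; so the derivative is a
    telescoping sum. *)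
Lemma der_gram N b g t : is_derive t 1 (fun t => gram N (b + t) (g + t))
  (- (2 * (sco N (b + t) * sco N (g + t)))).
Proof.
elim: N => [|N IH].
  have e : (fun t => gram 0 (b + t) (g + t)) = (fun t => cco 0 (b + t) * cco 0 (g + t)).
    by apply/funext => s; rewrite /gram big_ord1.
  rewrite e; have h1 := der_shift b t der_cco0; have h2 := der_shift g t der_cco0.
  by apply: (is_derive_eq (derM h1 h2)); rewrite /cco; ring.
under eq_fun do rewrite gramS.
have h1 := der_shift b t (der_cco N); have h2 := der_shift g t (der_cco N).
by apply: (is_derive_eq (derD IH (derM h1 h2))); rewrite /cco; ring.
Qed.

(** On the diagonal the derivative of [der_gram] is a negative square, and the
    value at 0 is 1. *)
Lemma gram_le1 N b : 0 <= b -> gram N b b <= 1.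
Proof.
rewrite le_eqVlt => /predU1P[<-|b0]; first by rewrite gram_0 oppr0 expR0.
have [c _] := @MVT_closed R _ _ 0 b b0 (fun t _ => der_gram N 0 0 t).
rewrite !add0r gram_0 oppr0 expR0 addr0 => e.
have : 0 <= sco N c * sco N c * b by rewrite mulr_ge0 ?(ltW b0)// -expr2 sqr_ge0.
lra.
Qed.

Lemma sum_cco_sqr N b : 0 <= b -> \sum_(k < N) cco k b ^+ 2 <= 1.
Proof.
move=> b0; case: N => [|N]; first by rewrite big_ord0.
by under eq_bigr do rewrite expr2; exact: gram_le1.
Qed.

Lemma cco_le1 k b : 0 <= b -> cco k b ^+ 2 <= 1.
Proof.
move=> b0; have := sum_cco_sqr k.+1 b0; rewrite big_ord_recr /=.
have : 0 <= \sum_(i < k) cco i b ^+ 2 by rewrite sumr_ge0// => i _; exact: sqr_ge0.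
lra.
Qed.

Lemma cco_norm k b : 0 <= b -> `|cco k b| <= 1.
Proof. by move=> b0; rewrite -(@ler_sqr _ _ 1) ?nnegrE// real_normK ?num_real// expr1n cco_le1. Qed.

Lemma sco_norm k b : 0 <= b -> `|sco k b| <= k.+1%:R.
Proof.
move=> b0; elim: k => [|k IH]; first exact: (cco_norm 0 b0).
have -> : sco k.+1 b = cco k.+1 b - sco k b by rewrite /cco addrK.
apply: (le_trans (ler_normB _ _)).
by rewrite -[k.+2%:R]natr1 addrC lerD// cco_norm.
Qed.

End laguerre.

(** * Decay of the Laguerre functions *)

(** A recursion of Bessel type, satisfied by q_n = (-1)^n s_n. The increments
    e_n are square summable. The energy F_n = (n + 1) e_n^2 + x q_(n+1) q_n,
    comparable to a sum of squares, is almost decreasing; a virial identity for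
    Y_n = e_n q_(n+1) bounds the sum of the F_n / (n + 2). Together they show
    F_n = O(1 / ln n), with constants depending only on the bounds x0 and X of
    x. *)
Section discrete_bessel.
Variables (R : realType) (q e : nat -> R) (x x0 X : R) (N0 : nat).
Hypotheses (x00 : 0 < x0) (x0x : x0 <= x) (xX : x <= X) (XN : X <= N0%:R).
Hypothesis qS : forall n, q n.+1 = q n + e n.
Hypothesis eS : forall n, (n%:R + 2) * e n.+1 = (n%:R + 1) * e n - x * q n.+1.
Hypothesis e2 : forall N, \sum_(n < N) e n ^+ 2 <= 1.
Hypothesis qn : forall n, `|q n| <= n.+1%:R.

Let F n := (n%:R + 1) * e n ^+ 2 + x * (q n.+1 * q n).
Let E n := x * q n.+1 ^+ 2 + (n%:R + 1) * e n ^+ 2.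

Let xp : 0 < x. Proof. exact: lt_le_trans x0x. Qed.

Lemma bessel_Fstep n : F n.+1 - F n = - (e n * e n.+1).
Proof.
have hw : x * (q n + e n) = (n%:R + 1) * e n - (n%:R + 2) * e n.+1 by rewrite eS qS; ring.
transitivity ((n%:R + 2) * e n.+1 ^+ 2 + x * (q n + e n) * (e n + e n.+1) - (n%:R + 1) * e n ^+ 2).
  by rewrite /F !qS -[n.+1%:R]natr1; ring.
by rewrite hw; ring.
Qed.

Lemma bessel_sum_e2 m M : \sum_(m <= n < M) e n ^+ 2 <= 1.
Proof.
have [mM|Mm] := leqP m M; last by rewrite big_geq// ltnW.
apply: le_trans (e2 M); rewrite -(big_mkord xpredT (fun n => e n ^+ 2)).
by rewrite [leRHS](big_cat_nat (leq0n m) mM)/= lerDr sumr_ge0// => k _; exact: sqr_ge0.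
Qed.

Lemma bessel_sum_e2S m M : \sum_(m <= n < M) e n.+1 ^+ 2 <= 1.
Proof. by have := bessel_sum_e2 m.+1 M.+1; rewrite big_add1. Qed.

(** For n >= x the mixed term x q_(n+1) e_n is dominated by the squares. *)
Lemma bessel_F_E n : (N0 <= n)%N -> E n <= 2 * F n /\ 2 * F n <= 3 * E n.
Proof.
move=> nn; have h1 : x <= n%:R + 1.
  have : (N0%:R : R) <= n%:R by rewrite ler_nat.
  have := xX; have := XN; lra.
have xp1 := xp.
have eF : F n = E n - x * (q n.+1 * e n) by rewrite /F /E; have := qS n => ->; ring.
have h2 : x * e n ^+ 2 <= (n%:R + 1) * e n ^+ 2 by apply: ler_wpM2r => //; exact: sqr_ge0.
have h3 := mulr_ge0 (ltW xp) (sqr_ge0 (q n.+1 - e n)).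
have h4 := mulr_ge0 (ltW xp) (sqr_ge0 (q n.+1 + e n)).
by rewrite eF /E; split; lra.
Qed.

Let C1 : R := (N0%:R + 1) + X * ((N0%:R + 2) * (N0%:R + 1)) + 1.

Lemma bessel_e_le1 n : e n ^+ 2 <= 1.
Proof.
have := e2 n.+1; rewrite big_ord_recr /=.
have : 0 <= \sum_(i < n) e i ^+ 2 by rewrite sumr_ge0// => i _; exact: sqr_ge0.
lra.
Qed.

Lemma bessel_F_bound M : (N0 <= M)%N -> F M <= C1.
Proof.
move=> NM.
have FN : F N0 <= C1 - 1.
  rewrite /C1 addrK /F; apply: lerD.
    rewrite -[leRHS]mulr1; apply: ler_wpM2l; last exact: bessel_e_le1.
    by rewrite addr_ge0.
  have h : `|q N0.+1 * q N0| <= (N0%:R + 2) * (N0%:R + 1).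
    rewrite normrM; apply: ler_pM => //.
      by have := qn N0.+1; rewrite -natr1 -[N0.+1%:R]natr1; lra.
    by have := qn N0; rewrite -natr1.
  apply: le_trans (_ : x * ((N0%:R + 2) * (N0%:R + 1)) <= _).
    by apply: ler_wpM2l; [exact: ltW|exact: le_trans (ler_norm _) h].
  by apply: ler_wpM2r => //; rewrite mulr_ge0// addr_ge0.
have -> : F M = F N0 - \sum_(N0 <= n < M) e n * e n.+1.
  elim: M NM => [|M IH]; first by rewrite leqn0 => /eqP ->; rewrite big_geq// subr0.
  rewrite leq_eqVlt => /predU1P[->|]; first by rewrite big_geq// subr0.
  rewrite ltnS => NM; rewrite big_nat_recr//= opprD addrA -IH//.
  by rewrite -bessel_Fstep; ring.
have : - \sum_(N0 <= n < M) e n * e n.+1 <= 2^-1 * (\sum_(N0 <= n < M) e n ^+ 2 + \sum_(N0 <= n < M) e n.+1 ^+ 2).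
  rewrite -sumrN -big_split /= mulr_sumr; apply: ler_sum => n _.
  by have := sqr_ge0 (e n + e n.+1); lra.
have := bessel_sum_e2 N0 M; have := bessel_sum_e2S N0 M; lra.
Qed.

Lemma bessel_q_bound n : (N0 <= n)%N -> x * q n.+1 ^+ 2 <= 2 * C1.
Proof.
move=> nn; have [h _] := bessel_F_E nn; have := bessel_F_bound nn.
have : 0 <= (n%:R + 1) * e n ^+ 2 by rewrite mulr_ge0 ?sqr_ge0// addr_ge0.
move: h; rewrite /E; lra.
Qed.

Let Y n := e n * q n.+1.

(** The recursion expresses x q_(n+1)^2 / (n + 2) by the increment of Y, by
    e_(n+1)^2 and by a product absorbed in the left-hand side. *)
Lemma bessel_virial n : x * q n.+1 ^+ 2 / (n%:R + 2) <=
  2 * (e n.+1 ^+ 2 + e n ^+ 2 / (2 * x) - (Y n.+1 - Y n)).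
Proof.
have xp1 := xp.
have n2 : 0 < (n%:R + 2 : R) by rewrite ltr_wpDl.
have id : x * q n.+1 ^+ 2 / (n%:R + 2) = e n.+1 ^+ 2 - (Y n.+1 - Y n) - e n * q n.+1 / (n%:R + 2).
  apply: (mulIf (lt0r_neq0 n2)); rewrite mulfVK ?gt_eqF//.
  have -> : (e n.+1 ^+ 2 - (Y n.+1 - Y n) - e n * q n.+1 / (n%:R + 2)) * (n%:R + 2) =
     (n%:R + 2) * e n.+1 * (e n.+1 - q n.+2) + (n%:R + 1) * e n * q n.+1.
    by rewrite /Y; field; rewrite gt_eqF.
  by rewrite (qS n.+1) eS; ring.
set z := (n%:R + 2)^-1 in id *.
have z0 : 0 <= z by rewrite invr_ge0 ltW.
have z1 : z <= 1 by rewrite invf_le1//; have := ler0n R n; lra.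
have h : - (e n * q n.+1 * z) <= e n ^+ 2 / (2 * x) + x * q n.+1 ^+ 2 * z / 2.
  have h1 : - (e n * q n.+1 * z) <= e n ^+ 2 / (2 * x) + x * q n.+1 ^+ 2 * z ^+ 2 / 2.
    rewrite -subr_ge0.
    have -> : e n ^+ 2 / (2 * x) + x * q n.+1 ^+ 2 * z ^+ 2 / 2 - - (e n * q n.+1 * z) =
      (e n + x * q n.+1 * z) ^+ 2 / (2 * x) by field; rewrite gt_eqF.
    by apply: divr_ge0; [exact: sqr_ge0|rewrite mulr_ge0// ltW].
  apply: (le_trans h1); rewrite lerD2l; apply: ler_wpM2r; first by rewrite invr_ge0.
  apply: ler_wpM2l; first by apply: mulr_ge0; [exact: ltW|exact: sqr_ge0].
  by rewrite expr2 ler_piMl.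
lra.
Qed.

Let C2 : R := 3 / 2 * (2 * (1 + (2 * x0)^-1 + 2 * (1 + 2 * C1 / x0)) + 1).

Lemma bessel_C1_ge0 : 0 <= C1.
Proof.
rewrite /C1 addr_ge0// addr_ge0 ?addr_ge0//.
rewrite mulr_ge0 ?mulr_ge0 ?addr_ge0//; exact: le_trans (ltW xp) xX.
Qed.

Lemma bessel_Y_bound n : (N0 <= n)%N -> `|Y n| <= 1 + 2 * C1 / x0.
Proof.
move=> nn; have h := bessel_q_bound nn; have he := bessel_e_le1 n.
have h2 : q n.+1 ^+ 2 <= 2 * C1 / x0.
  rewrite ler_pdivlMr//; apply: le_trans h; rewrite mulrC.
  by apply: ler_wpM2r => //; exact: sqr_ge0.
rewrite /Y ler_norml.
by have := sqr_ge0 (e n - q n.+1); have := sqr_ge0 (e n + q n.+1);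
  have := sqr_ge0 (q n.+1); have := sqr_ge0 (e n) => h3 h4 h5 h6; apply/andP; split; lra.
Qed.

Lemma bessel_sum M : (N0 <= M)%N -> \sum_(N0 <= n < M) F n / (n%:R + 2) <= C2.
Proof.
move=> NM.
have tel : \sum_(N0 <= n < M) (Y n.+1 - Y n) = Y M - Y N0 by rewrite telescope_sumr.
have s1 : \sum_(N0 <= n < M) x * q n.+1 ^+ 2 / (n%:R + 2) <=
    2 * (1 + (2 * x0)^-1 + 2 * (1 + 2 * C1 / x0)).
  apply: (le_trans (ler_sum _ (fun n _ => bessel_virial n))).
  rewrite -mulr_sumr ler_pM2l// sumrB tel big_split /= -mulr_suml.
  have h1 := bessel_sum_e2 N0 M; have h2 := bessel_sum_e2S N0 M.
  have h3 : (\sum_(N0 <= n < M) e n ^+ 2) / (2 * x) <= (2 * x0)^-1.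
    rewrite -[leRHS]mul1r; apply: ler_pM => //.
    - by rewrite sumr_ge0// => k _; exact: sqr_ge0.
    - by rewrite invr_ge0 mulr_ge0// ltW// xp.
    - by rewrite lef_pV2 ?posrE ?mulr_gt0 ?xp// ler_pM2l.
  have := bessel_Y_bound NM; have := bessel_Y_bound (leqnn N0); rewrite !ler_norml; lra.
have s2 : \sum_(N0 <= n < M) (n%:R + 1) * e n ^+ 2 / (n%:R + 2) <= 1.
  apply: le_trans (bessel_sum_e2 N0 M); apply: ler_sum => n _.
  have n2 : 0 < (n%:R + 2 : R) by rewrite ltr_wpDl.
  rewrite ler_pdivrMr// mulrC; apply: ler_wpM2l; [exact: sqr_ge0|lra].
apply: (@le_trans _ _ (3 / 2 * (\sum_(N0 <= n < M) x * q n.+1 ^+ 2 / (n%:R + 2) +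
   \sum_(N0 <= n < M) (n%:R + 1) * e n ^+ 2 / (n%:R + 2)))); last by rewrite /C2; apply: ler_wpM2l; [lra|exact: lerD].
rewrite -big_split /= mulr_sumr big_nat [leRHS]big_nat; apply: ler_sum => n /andP[Nn _].
have n2 : 0 < (n%:R + 2 : R) by rewrite ltr_wpDl.
rewrite -mulrDl mulrA ler_pM2r ?invr_gt0//.
by have [_] := bessel_F_E Nn; rewrite /E; lra.
Qed.

Lemma bessel_almost_mono n : (N0 <= n)%N ->
  F n.+1 <= F n + X * C1 * ((n%:R + 1)^-1 - (n%:R + 2)^-1).
Proof.
move=> Nn; have n2 : 0 < (n%:R + 2 : R) by rewrite ltr_wpDl.
have n1 : 0 < (n%:R + 1 : R) by rewrite ltr_wpDl.
have C10 := bessel_C1_ge0; have X0 : 0 <= X by exact: le_trans (ltW xp) xX.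
have e' : e n.+1 = ((n%:R + 1) * e n - x * q n.+1) / (n%:R + 2).
  by rewrite -eS mulrC mulKf// gt_eqF.
have : F n.+1 - F n <= x * (x * q n.+1 ^+ 2) / (2 * (n%:R + 1) * (n%:R + 2)).
  rewrite bessel_Fstep e' -subr_ge0.
  have -> : x * (x * q n.+1 ^+ 2) / (2 * (n%:R + 1) * (n%:R + 2)) -
     - (e n * (((n%:R + 1) * e n - x * q n.+1) / (n%:R + 2))) =
    (((n%:R + 1) * e n) ^+ 2 + ((n%:R + 1) * e n - x * q n.+1) ^+ 2) / (2 * (n%:R + 1) * (n%:R + 2)).
    by field; rewrite !gt_eqF.
  apply: divr_ge0; last by rewrite !mulr_ge0// ltW.
  by apply: addr_ge0; exact: sqr_ge0.
have : x * (x * q n.+1 ^+ 2) / (2 * (n%:R + 1) * (n%:R + 2)) <= X * (2 * C1) / (2 * (n%:R + 1) * (n%:R + 2)).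
  apply: ler_wpM2r; first by rewrite invr_ge0 !mulr_ge0// ltW.
  apply: ler_pM => //; [exact: ltW|apply: mulr_ge0; [exact: ltW|exact: sqr_ge0]|].
  exact: bessel_q_bound.
have -> : X * (2 * C1) / (2 * (n%:R + 1) * (n%:R + 2)) = X * C1 * ((n%:R + 1)^-1 - (n%:R + 2)^-1).
  by field; rewrite !gt_eqF.
lra.
Qed.

Lemma bessel_mono n M : (N0 <= n)%N -> (n <= M)%N -> F M <= F n + X * C1 / (n%:R + 1).
Proof.
move=> Nn nM; have C10 := bessel_C1_ge0; have X0 : 0 <= X by exact: le_trans (ltW xp) xX.
have XC : 0 <= X * C1 by rewrite mulr_ge0.
suff : F M <= F n + X * C1 * ((n%:R + 1)^-1 - (M%:R + 1)^-1).
  have : 0 <= X * C1 * (M%:R + 1)^-1 by rewrite mulr_ge0// invr_ge0 addr_ge0.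
  by rewrite mulrBr; lra.
elim: M nM => [|M IH]; first by rewrite leqn0 => /eqP ->; rewrite subrr mulr0 addr0.
rewrite leq_eqVlt => /predU1P[->|]; first by rewrite subrr mulr0 addr0.
rewrite ltnS => nM; have h1 := IH nM; have h2 := bessel_almost_mono (leq_trans Nn nM).
have -> : (M.+1%:R + 1 : R) = M%:R + 2 by rewrite -[M.+1%:R]natr1; ring.
move: h1 h2; rewrite !mulrBr; lra.
Qed.

(** F_M is at most each previous F_n up to O(1 / n), so F_M times the harmonic
    sum is bounded by [bessel_sum]. *)
Lemma bessel_decay M : (N0 <= M)%N ->
  q M.+1 ^+ 2 * (ln (M%:R + 2) - ln (N0%:R + 2)) <= 2 * (C2 + X * C1) / x0.
Proof.
move=> NM; have C10 := bessel_C1_ge0; have X0 : 0 <= X by exact: le_trans (ltW xp) xX.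
have XC : 0 <= X * C1 by rewrite mulr_ge0.
pose H := \sum_(N0 <= n < M) (n%:R + 2 : R)^-1.
have H0 : 0 <= H by rewrite sumr_ge0// => n _; rewrite invr_ge0 addr_ge0.
have hH : ln (M%:R + 2) - ln (N0%:R + 2) <= H.
  rewrite -(telescope_sumr (fun n => ln (n%:R + 2 : R)) NM); apply: ler_sum => n _.
  have := lnstep_le R (isT : (0 < n.+2)%N); rewrite /lnstep.
  have e1 : (n.+2%:R : R) = n%:R + 2 by rewrite -addn2 natrD.
  have e3 : (n.+3%:R : R) = n.+1%:R + 2 by rewrite -addn2 natrD.
  by rewrite e1 e3.
have FH : F M * H <= C2 + X * C1.
  rewrite /H mulr_sumr.
  apply: (@le_trans _ _ (\sum_(N0 <= n < M) (F n / (n%:R + 2) + X * C1 * ((n%:R + 1)^-1 - (n%:R + 2)^-1)))).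
    rewrite big_nat [leRHS]big_nat; apply: ler_sum => n /andP[Nn nM].
    have n2 : 0 < (n%:R + 2 : R) by rewrite ltr_wpDl.
    have n1 : 0 < (n%:R + 1 : R) by rewrite ltr_wpDl.
    have -> : F n / (n%:R + 2) + X * C1 * ((n%:R + 1)^-1 - (n%:R + 2)^-1) =
       (F n + X * C1 / (n%:R + 1)) / (n%:R + 2) by field; rewrite !gt_eqF.
    by rewrite ler_pM2r ?invr_gt0//; apply: bessel_mono => //; exact: ltnW.
  rewrite big_split /=; apply: lerD; first exact: bessel_sum.
  rewrite -mulr_sumr -[leRHS]mulr1; apply: ler_wpM2l => //.
  pose u n : R := - (n%:R + 1)^-1.
  have -> : \sum_(N0 <= n < M) ((n%:R + 1)^-1 - (n%:R + 2)^-1 : R) = \sum_(N0 <= n < M) (u n.+1 - u n).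
    apply: eq_bigr => n _; rewrite /u -[n.+1%:R]natr1.
    have -> : (n%:R + 1 + 1 : R) = n%:R + 2 by ring.
    by rewrite opprK; exact: addrC.
  rewrite telescope_sumr// /u opprK.
  have : (N0%:R + 1 : R)^-1 <= 1 by rewrite invf_le1 ?ltr_wpDl//; have := ler0n R N0; lra.
  have : 0 <= (M%:R + 1 : R)^-1 by rewrite invr_ge0 addr_ge0.
  lra.
have [h1 _] := bessel_F_E NM.
have q0 := sqr_ge0 (q M.+1).
have h2 : x0 * q M.+1 ^+ 2 <= 2 * F M.
  have : x0 * q M.+1 ^+ 2 <= x * q M.+1 ^+ 2 by apply: ler_wpM2r.
  have : 0 <= (M%:R + 1) * e M ^+ 2 by rewrite mulr_ge0 ?sqr_ge0// addr_ge0.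
  by move: h1; rewrite /E; lra.
rewrite ler_pdivlMr//.
apply: (@le_trans _ _ (x0 * q M.+1 ^+ 2 * H)).
  by rewrite [leLHS]mulrC mulrA; apply: ler_wpM2l => //; rewrite mulr_ge0// ltW.
by have := ler_wpM2r H0 h2; lra.
Qed.

End discrete_bessel.

(** * The Gram matrix of the Laguerre functions *)

Section gram_limit.
Variable R : realType.
Implicit Types (x t b g : R) (k n N : nat).

(** The bounds of [bessel_decay] are uniform on compact intervals of b > 0; this
    is needed for the mean value theorem in [gram_cvg]. *)
Lemma sco_decay x0 X ep : 0 < x0 -> 0 < ep -> exists K, forall N b, (K <= N)%N ->
  x0 <= 2 * b -> 2 * b <= X -> `|sco N b| <= ep.
Proof.
move=> x00 ep0.
pose N0 := (Num.truncn X).+1.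
have XN : X <= N0%:R by exact/ltW/truncnS_gt.
pose C1 : R := (N0%:R + 1) + X * ((N0%:R + 2) * (N0%:R + 1)) + 1.
pose C2 : R := 3 / 2 * (2 * (1 + (2 * x0)^-1 + 2 * (1 + 2 * C1 / x0)) + 1).
pose D := `|2 * (C2 + X * C1) / x0| + 1.
have D0 : 0 < D by rewrite ltr_wpDl.
pose A := D / ep ^+ 2 + ln (N0%:R + 2).
exists (maxn N0 (Num.truncn (expR A)).+1).+1 => -[//|M] b; rewrite ltnS geq_max => /andP[NM AM] bx bX.
have b0 : 0 <= b by lra.
pose q n := expR (- b) * lag n (2 * b).
have sq n : sco n b = (-1) ^+ n * q n by [].
have nq n : `|sco n b| = `|q n| by rewrite sq normrM normrX normrN1 expr1n mul1r.
pose e n := q n.+1 - q n.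
have ec n : e n ^+ 2 = cco n.+1 b ^+ 2.
  rewrite /e /cco !sq [(-1) ^+ n.+1]exprS.
  have s2 : ((-1) ^+ n : R) ^+ 2 = 1 by rewrite sqrr_sign.
  transitivity (((-1) ^+ n) ^+ 2 * (q n.+1 - q n) ^+ 2); first by rewrite s2 mul1r.
  by ring.
have qS n : q n.+1 = q n + e n by rewrite /e; ring.
have eS n : (n%:R + 2) * e n.+1 = (n%:R + 1) * e n - 2 * b * q n.+1.
  by have h := congr1 ( *%R (expR (- b))) (lag_rec n (2 * b)); rewrite /e /q; lra.
have e2 N : \sum_(n < N) e n ^+ 2 <= 1.
  under eq_bigr do rewrite ec.
  have h := sum_cco_sqr N.+1 b0; rewrite big_ord_recl in h.
  by apply: (le_trans _ h); exact: ler_wpDl (sqr_ge0 _) (lexx _).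
have qn n : `|q n| <= n.+1%:R by rewrite -nq sco_norm.
have := bessel_decay x00 bx bX XN qS eS e2 qn NM.
rewrite -/C1 -/C2 => h.
have hA : D / ep ^+ 2 <= ln (M%:R + 2) - ln (N0%:R + 2).
  rewrite lerBrDr -/A -[leLHS]expRK ler_ln ?posrE ?expR_gt0 ?ltr_wpDl//.
  rewrite (le_trans (ltW (truncnS_gt (expR A))))//.
  by apply: (@le_trans _ _ (M%:R : R)); rewrite ?ler_nat ?lerDl.
have De : 0 < D / ep ^+ 2 by rewrite divr_gt0// exprn_gt0.
rewrite nq -ler_sqr ?nnegrE ?(ltW ep0)// real_normK ?num_real//.
rewrite -(ler_pM2r De); apply: (@le_trans _ _ D).
  apply: le_trans (ler_wpM2l (sqr_ge0 _) hA) _; apply: (le_trans h).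
  by rewrite /D (le_trans (ler_norm _))// lerDl.
by rewrite mulrC mulfVK// gt_eqF// exprn_gt0.
Qed.

(** At a small second argument the term k = 0 is almost exp (- t0). The others
    are small, since the squares c_k^2 have sum at most 1 and c_0^2 is nearly 1
    there. *)
Lemma gram_near N t0 ep : 0 <= t0 -> 0 < ep -> `|gram N (t0 + ep ^+ 2 / 2) (ep ^+ 2 / 2) - expR (- t0)| <= ep + ep ^+ 2.
Proof.
move=> t00 ep0; set d := ep ^+ 2 / 2.
have d0 : 0 <= d by rewrite divr_ge0// sqr_ge0.
rewrite /gram big_ord_recl !cco0E.
have h1 : `|expR (- (t0 + d)) * expR (- d) - expR (- t0)| <= ep ^+ 2.
  rewrite -expRD; have -> : - (t0 + d) - d = - t0 + - (ep ^+ 2) by rewrite /d; field.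
  rewrite expRD -[X in _ - X]mulr1 -mulrBr normrM ger0_norm ?expR_ge0//.
  have h := expR_ge1Dx (- ep ^+ 2).
  have h2 : expR (- ep ^+ 2) <= 1 by rewrite expR_le1 oppr_le0 sqr_ge0.
  rewrite -[leRHS]mul1r; apply: ler_pM; [exact: expR_ge0|exact: normr_ge0| |].
    by rewrite expR_le1 oppr_le0.
  by rewrite ler0_norm; lra.
have s1 : \sum_(i < N) cco (lift ord0 i) (t0 + d) ^+ 2 <= 1.
  have := sum_cco_sqr N.+1 (addr_ge0 t00 d0); rewrite big_ord_recl.
  by have := sqr_ge0 (cco (@ord0 N) (t0 + d)); lra.
have s2 : \sum_(i < N) cco (lift ord0 i) d ^+ 2 <= ep ^+ 2.
  have := sum_cco_sqr N.+1 d0; rewrite big_ord_recl cco0E -expRM_natl.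
  have := expR_ge1Dx (2 * - d); rewrite /d; lra.
have h2 : `|\sum_(i < N) cco (lift ord0 i) (t0 + d) * cco (lift ord0 i) d| <= ep.
  apply: (le_trans (ler_norm_sum _ _ _)).
  apply: (@le_trans _ _ (\sum_(i < N) (ep / 2 * cco (lift ord0 i) (t0 + d) ^+ 2 + (2 * ep)^-1 * cco (lift ord0 i) d ^+ 2))).
    apply: ler_sum => i _; rewrite normrM.
    rewrite -[X in ep / 2 * X]real_normK ?num_real// -[X in (2 * ep)^-1 * X]real_normK ?num_real//.
    move: (`|cco _ (t0 + d)|) (`|cco _ d|) => u v.
    rewrite -subr_ge0; have -> : ep / 2 * u ^+ 2 + (2 * ep)^-1 * v ^+ 2 - u * v =
      (2 * ep)^-1 * (ep * u - v) ^+ 2 by field; rewrite gt_eqF.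
    by apply: mulr_ge0; [rewrite invr_ge0 mulr_ge0// ltW|exact: sqr_ge0].
  rewrite big_split /= -!mulr_sumr.
  have : ep / 2 * \sum_(i < N) cco (lift ord0 i) (t0 + d) ^+ 2 <= ep / 2.
    by rewrite -[leRHS]mulr1; apply: ler_wpM2l => //; lra.
  have : (2 * ep)^-1 * \sum_(i < N) cco (lift ord0 i) d ^+ 2 <= (2 * ep)^-1 * ep ^+ 2.
    by apply: ler_wpM2l => //; rewrite invr_ge0 mulr_ge0// ltW.
  have -> : (2 * ep)^-1 * ep ^+ 2 = ep / 2 by field; exact: lt0r_neq0.
  lra.
rewrite addrAC; apply: (le_trans (ler_normD _ _)); rewrite [leRHS]addrC; exact: lerD.
Qed.

(** The limit is the inner product, in the Hardy space, of the inner functions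
    exp (- b (1 - z) / (1 + z)) and exp (- g (1 - z) / (1 + z)): their quotient
    on the circle is such a function again, with value exp (- (b - g)) at 0. The
    proof by series moves both arguments by the same amount: by [der_gram] and
    [sco_decay] the sum hardly changes, and near the boundary its value is given
    by [gram_near]. *)
Lemma gram_cvg b g : 0 <= g -> g <= b -> (fun N => gram N b g) @ \oo --> expR (- (b - g)).
Proof.
move=> g0 gb; pose t0 := b - g; have t00 : 0 <= t0 by rewrite subr_ge0.
rewrite -/t0 (_ : b = t0 + g); last by rewrite /t0 subrK.
move: g0; rewrite le_eqVlt => /predU1P[<-|g0].
  under eq_fun do rewrite addr0 gram_0; exact: cvg_cst.
apply/subr_cvg0/cvg0P => ep ep0.
pose d := Num.min 1 (Num.min (ep / 4) g).
have d0 : 0 < d by rewrite !lt_min ltr01 g0 divr_gt0.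
have d1 : d <= 1 by rewrite /d ge_min lexx.
have d2 : d <= ep / 4 by rewrite /d !ge_min lexx orbT.
have d3 : d <= g by rewrite /d !ge_min lexx !orbT.
have dd : d ^+ 2 <= d by rewrite expr2 ler_piMl// ltW.
(* Start at the point s near the boundary, as in [gram_near]. *)
pose s := d ^+ 2 / 2.
have s0 : 0 < s by rewrite divr_gt0// exprn_gt0.
have sg : s < g by rewrite /s; lra.
pose eta := Num.min 1 (ep / (4 * g)).
have eta0 : 0 < eta by rewrite lt_min ltr01 divr_gt0// mulr_gt0.
have s20 : 0 < 2 * s by rewrite mulr_gt0.
have [K hK] := @sco_decay (2 * s) (2 * (t0 + g)) eta s20 eta0.
exists K => N KN.
have -> : gram N (t0 + g) g - expR (- t0) =
  (gram N (t0 + g) g - gram N (t0 + s) s) + (gram N (t0 + s) s - expR (- t0)) by ring.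
have h1 := gram_near N t00 d0; rewrite -/s in h1.
have h2 : `|gram N (t0 + g) g - gram N (t0 + s) s| <= ep / 2.
  have hder t : is_derive t 1 (fun t => gram N (t0 + t) t) (- (2 * (sco N (t0 + t) * sco N t))).
    by have := der_gram N t0 0 t; under eq_fun do rewrite add0r; rewrite add0r.
  have [c /andP[sc cg] ->] := @MVT_closed R _ _ s g sg (fun t _ => hder t).
  have b1 : `|sco N (t0 + c)| <= eta by apply: hK => //; lra.
  have b2 : `|sco N c| <= eta by apply: hK => //; lra.
  have gs : 0 <= g - s by lra.
  rewrite normrM (ger0_norm gs) normrN normrM [`|sco _ _ * _|]normrM (ger0_norm (ler0n R 2)).
  have b3 : `|sco N (t0 + c)| * `|sco N c| <= eta * 1.
    by apply: ler_pM => //; rewrite (le_trans b2)// ge_min lexx.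
  have b4 : 2 * (`|sco N (t0 + c)| * `|sco N c|) * (g - s) <= 2 * (eta * 1) * g.
    by apply: ler_pM; [rewrite !mulr_ge0 ?normr_ge0|exact: gs|apply: ler_wpM2l|lra].
  have b5 : eta * g <= ep / (4 * g) * g by rewrite ler_pM2r// ge_min lexx orbT.
  have e5 : ep / (4 * g) * g = ep / 4 by field; rewrite gt_eqF.
  lra.
apply: (le_trans (ler_normD _ _)); lra.
Qed.

Section vectors.
Variable al : R.
Hypothesis al0 : 0 < al.

(** The coefficients of the powers of z in n^(- phi), where z = 2^(- s). *)
Definition kvec n k : R := npow (- 2^-1) n.+1 * cco k (al * ln n.+1%:R).

Lemma kvec_gram n m : (fun N => \sum_(k < N) kvec n k * kvec m k) @ \oo --> kern al n m.
Proof.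
wlog mn : n m / (m <= n)%N => [H|].
  have [mn|/ltnW nm] := leqP m n; first exact: H.
  rewrite kernC; have := H m n nm; apply: cvg_trans; apply: near_eq_cvg.
  by near=> N; apply: eq_bigr => k _; rewrite mulrC.
pose b := al * ln n.+1%:R; pose g := al * ln m.+1%:R.
have g0 : 0 <= g by rewrite mulr_ge0 ?(ltW al0)// ln_ge0// ler1n.
have gb : g <= b by rewrite ler_pM2l// ler_ln ?posrE ?ltr0n// ler_nat.
have h : (fun N => npow (- 2^-1) n.+1 * npow (- 2^-1) m.+1 * gram N b g) @ \oo -->
    npow (- 2^-1) n.+1 * npow (- 2^-1) m.+1 * expR (- (b - g)).
  by apply: cvgMl_tmp; exact: gram_cvg.
have -> : kern al n m = npow (- 2^-1) n.+1 * npow (- 2^-1) m.+1 * expR (- (b - g)).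
  rewrite kern_le// /npow /b /g -!expRD; congr expR.
  by move: (ln _) (ln _) => u v; ring.
rewrite -cvg_shiftS; move: h; apply: cvg_trans; apply: near_eq_cvg; near=> N.
by rewrite /gram mulr_sumr; apply: eq_bigr => k _; rewrite /kvec -/b -/g; ring.
Unshelve. all: by end_near. Qed.

End vectors.
End gram_limit.

(** * Synthesis of square summable sequences *)

Lemma cvg_sumn (R : realType) N (f : nat -> nat -> R) (l : nat -> R) :
  (forall i, (i < N)%N -> f i @ \oo --> l i) ->
  (fun K => \sum_(i < N) f i K) @ \oo --> \sum_(i < N) l i.
Proof.
elim: N => [|N IH] h.
  by under eq_fun do rewrite big_ord0; rewrite big_ord0; exact: cvg_cst.
under eq_fun do rewrite big_ord_recr /=; rewrite big_ord_recr /=.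
by apply: cvgD; [apply: IH => i iN; apply: h; rewrite ltnS ltnW|exact: h].
Qed.

Lemma sum_sqr_le_lim (R : realType) (f : nat -> R) l K :
  (fun K => \sum_(k < K) f k ^+ 2) @ \oo --> l -> \sum_(k < K) f k ^+ 2 <= l.
Proof.
move=> h; rewrite -(cvg_lim _ h)//.
apply: (nondecreasing_cvgn_le _ (cvgP _ h)).
by apply/nondecreasing_seqP => n; rewrite big_ord_recr lerDl sqr_ge0.
Qed.

Lemma sum_ord_split (R : realType) (F : nat -> R) M N : (M <= N)%N ->
  \sum_(n < N) F n = \sum_(n < M) F n + \sum_(M <= n < N) F n.
Proof. by move=> MN; rewrite -!(big_mkord xpredT F) -big_cat_nat. Qed.

Lemma cvg_epsP (R : realType) (u : nat -> R) (l : R) : u @ \oo --> l <->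
  forall e : R, 0 < e -> exists K, forall n, (K <= n)%N -> `|u n - l| <= e.
Proof.
split=> [h e e0|h]; last by apply/subr_cvg0/cvg0P.
have h0 : (fun n => u n - l) @ \oo --> 0 by apply/subr_cvg0.
exact: (cvg0P _).1 h0 e e0.
Qed.

Section synthesis.
Variables (R : realType) (al mu : R).
Hypotheses (al0 : 0 < al) (mup : 0 < mu) (adm : admissible al mu).
Implicit Types (x w : nat -> R) (k n m N M K : nat).
Local Notation v := (kvec al).

(** The coefficients of f o phi for a finite Dirichlet series f. *)
Definition synth x N k : R := \sum_(n < N) x n * v n k.

Lemma synth_sqr_cvg w N : (fun K => \sum_(k < K) synth w N k ^+ 2) @ \oo --> qform al w N.
Proof.
have e K : \sum_(k < K) synth w N k ^+ 2 =
    \sum_(i < N) \sum_(j < N) (\sum_(k < K) v i k * v j k) * (w i * w j).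
  transitivity (\sum_(k < K) \sum_(i < N) \sum_(j < N) v i k * v j k * (w i * w j)).
    apply: eq_bigr => k _; rewrite expr2 /synth mulr_suml; apply: eq_bigr => i _.
    by rewrite mulr_sumr; apply: eq_bigr => j _; ring.
  rewrite exchange_big; apply: eq_bigr => i _ /=; rewrite exchange_big; apply: eq_bigr => j _ /=.
  by rewrite mulr_suml.
under eq_fun do rewrite e.
apply: (@cvg_sumn _ N (fun i K => \sum_(j < N) (\sum_(k < K) v i k * v j k) * (w i * w j))
  (fun i => \sum_(j < N) kern al i j * (w i * w j))) => i _.
apply: (@cvg_sumn _ N (fun j K => (\sum_(k < K) v i k * v j k) * (w i * w j))
  (fun j => kern al i j * (w i * w j))) => j _.
by apply: cvgMr_tmp; exact: kvec_gram.
Qed.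

(** The square sum is the quadratic form, bounded by admissibility: synthesis is
    a bounded operator. *)
Lemma synth_bessel w N K : mu * \sum_(k < K) synth w N k ^+ 2 <= \sum_(n < N) w n ^+ 2.
Proof.
apply: le_trans (qform_le (ltW mup) adm mup w N).
rewrite ler_pM2l//; exact: (@sum_sqr_le_lim _ (synth w N) _ K (@synth_sqr_cvg w N)).
Qed.

Lemma synth_diff x M N k : (M <= N)%N ->
  synth x N k - synth x M k = synth (fun n => if (M <= n)%N then x n else 0) N k.
Proof.
move=> MN; rewrite /synth (sum_ord_split (fun n => x n * v n k) MN).
rewrite (sum_ord_split (fun n => (if (M <= n)%N then x n else 0) * v n k) MN) addrAC subrr add0r.
rewrite [X in _ = X + _]big1 ?add0r => [|n _]; last by rewrite /= leqNgt ltn_ord mul0r.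
by rewrite big_nat [RHS]big_nat; apply: eq_bigr => n /andP[-> _].
Qed.

Lemma synth_diff_bessel x M N K : (M <= N)%N ->
  mu * \sum_(k < K) (synth x N k - synth x M k) ^+ 2 <= \sum_(M <= n < N) x n ^+ 2.
Proof.
move=> MN; under eq_bigr do rewrite synth_diff//.
apply: le_trans (synth_bessel _ N K) _.
rewrite (sum_ord_split (fun n => (if (M <= n)%N then x n else 0) ^+ 2) MN).
rewrite [X in X + _ <= _]big1 ?add0r => [|n _]; last by rewrite /= leqNgt ltn_ord expr0n.
by rewrite big_nat [leRHS]big_nat; apply: ler_sum => n /andP[-> _].
Qed.

Variable x : nat -> R.
Hypothesis xl2 : l2 x.

Lemma synth_cvg k : cvgn (fun N => synth x N k).
Proof.
apply: cauchy_cvg; apply: cauchy_exP => e e0.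
pose e2 := e / 2; have e20 : 0 < e2 by rewrite divr_gt0.
have [K hK] := l2_tail xl2 (mulr_gt0 mup (exprn_gt0 2 e20)).
exists (synth x K k); exists K => // N /= KN.
rewrite /ball /= distrC; apply: (@le_lt_trans _ _ e2); last by rewrite /e2; lra.
rewrite -ler_sqr ?nnegrE ?(ltW e20)// real_normK ?num_real//.
rewrite -(ler_pM2l mup); apply: le_trans (hK N KN).
apply: le_trans (synth_diff_bessel x k.+1 KN); rewrite ler_pM2l// big_ord_recr /= lerDr.
by rewrite sumr_ge0// => i _; exact: sqr_ge0.
Qed.

(** The coefficient of the k-th power of 2^(- s) in f o phi, when x is square
    summable. *)
Definition l2image k : R := limn (fun N => synth x N k).

Lemma image_approx M N K C : (M <= N)%N ->
  (forall N', (N <= N')%N -> \sum_(M <= n < N') x n ^+ 2 <= C) ->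
  mu * \sum_(k < K) (l2image k - synth x M k) ^+ 2 <= C.
Proof.
move=> MN hC.
have c : (fun N => mu * \sum_(k < K) (synth x N k - synth x M k) ^+ 2) @ \oo -->
    mu * \sum_(k < K) (l2image k - synth x M k) ^+ 2.
  apply: cvgMl_tmp.
  apply: (@cvg_sumn _ K (fun k N => (synth x N k - synth x M k) ^+ 2)
    (fun k => (l2image k - synth x M k) ^+ 2)) => k _.
  have h : (fun N => synth x N k - synth x M k) @ \oo --> l2image k - synth x M k.
    by apply: cvgB; [exact: synth_cvg|exact: cvg_cst].
  by rewrite expr2; under eq_fun do rewrite expr2; exact: cvgM.
apply: (ler_cvg_to c (cvg_cst C)); exists N => // N' /= NN'.
apply: le_trans (hC N' NN'); apply: synth_diff_bessel; exact: leq_trans NN'.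
Qed.

Lemma image_l2 : l2 l2image.
Proof.
exists (sqnorm x / mu) => K; rewrite ler_pdivlMr// mulrC.
have := @image_approx 0 0 K (sqnorm x) (leqnn _) _.
have e k : synth x 0 k = 0 by rewrite /synth big_ord0.
under eq_bigr do rewrite e subr0.
by apply=> N' _; rewrite big_mkord; exact: sqnorm_ge.
Qed.

(** Interchange of the sums over n and k. The finite syntheses converge to the
    image in l2 by [image_approx], and pairing with w is continuous. *)
Lemma image_pair (w E : nat -> R) (L : R) : l2 w ->
  (forall n, (fun K => \sum_(k < K) v n k * w k) @ \oo --> E n) ->
  (fun N => \sum_(n < N) x n * E n) @ \oo --> L ->
  (fun K => \sum_(k < K) l2image k * w k) @ \oo --> L.
Proof.
move=> wl2 hE hL; apply/cvg_epsP => e e0.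
have nw := sqnorm_ge0 wl2.
pose d := e / (4 * (1 + sqnorm w)).
have d0 : 0 < d by rewrite divr_gt0// mulr_gt0// ltr_wpDr.
have [M1 hM1] := l2_tail xl2 (mulr_gt0 mup (exprn_gt0 2 d0)).
have e40 : 0 < e / 4 by rewrite divr_gt0.
have [M2 hM2] := (cvg_epsP _ _).1 hL _ e40.
pose M := maxn M1 M2.
have cM : (fun K => \sum_(k < K) synth x M k * w k) @ \oo --> \sum_(n < M) x n * E n.
  have eK K : \sum_(k < K) synth x M k * w k = \sum_(n < M) x n * \sum_(k < K) v n k * w k.
    transitivity (\sum_(k < K) \sum_(n < M) x n * (v n k * w k)).
      by apply: eq_bigr => k _; rewrite /synth mulr_suml; apply: eq_bigr => n _; ring.
    by rewrite exchange_big; apply: eq_bigr => n _; rewrite mulr_sumr.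
  under eq_fun do rewrite eK.
  apply: (@cvg_sumn _ M (fun n K => x n * \sum_(k < K) v n k * w k) (fun n => x n * E n)) => n _.
  by apply: cvgMl_tmp; exact: hE.
have [K0 hK0] := (cvg_epsP _ _).1 cM _ e40.
exists K0 => K KK.
have h1 := hM2 M (leq_maxr _ _); have h2 := hK0 K KK.
have h3 : `|\sum_(k < K) l2image k * w k - \sum_(k < K) synth x M k * w k| <= e / 4.
  rewrite -sumrB.
  have h4 : mu * \sum_(k < K) (l2image k - synth x M k) ^+ 2 <= mu * d ^+ 2.
    apply: (@image_approx M M) => // N' MN'.
    apply: le_trans (hM1 N' _); last by rewrite (leq_trans _ MN')// leq_maxl.
    rewrite [leRHS](big_cat_nat (leq_maxl M1 M2 : (M1 <= M)%N) MN')/= lerDr.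
    by rewrite sumr_ge0// => n _; exact: sqr_ge0.
  rewrite ler_pM2l// in h4.
  apply: (le_trans (ler_norm_sum _ _ _)).
  apply: (@le_trans _ _ (\sum_(k < K) ((2 * d)^-1 * (l2image k - synth x M k) ^+ 2 + d / 2 * w k ^+ 2))).
    apply: ler_sum => k _; rewrite -mulrBl normrM.
    rewrite -[X in _^-1 * X]real_normK ?num_real// -[X in d / 2 * X]real_normK ?num_real//.
    move: (`|l2image k - synth x M k|) (`|w k|) => u z.
    rewrite -subr_ge0; have -> : (2 * d)^-1 * u ^+ 2 + d / 2 * z ^+ 2 - u * z =
      (2 * d)^-1 * (u - d * z) ^+ 2 by field; exact: lt0r_neq0.
    by apply: mulr_ge0; [rewrite invr_ge0 mulr_ge0// ltW|exact: sqr_ge0].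
  rewrite big_split /= -!mulr_sumr.
  have h5 : (2 * d)^-1 * \sum_(k < K) (l2image k - synth x M k) ^+ 2 <= (2 * d)^-1 * d ^+ 2.
    by apply: ler_wpM2l => //; rewrite invr_ge0 mulr_ge0// ltW.
  have e5 : (2 * d)^-1 * d ^+ 2 = d / 2 by field; exact: lt0r_neq0.
  have h6 : d / 2 * \sum_(k < K) w k ^+ 2 <= d / 2 * sqnorm w.
    by apply: ler_wpM2l; [rewrite divr_ge0// ltW|exact: sqnorm_ge].
  have e6 : d * (1 + sqnorm w) = e / 4 by rewrite /d; field; apply: lt0r_neq0; rewrite ltr_wpDr.
  by rewrite e5 in h5; lra.
have -> : \sum_(k < K) l2image k * w k - L =
  (\sum_(k < K) l2image k * w k - \sum_(k < K) synth x M k * w k) +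
  (\sum_(k < K) synth x M k * w k - \sum_(n < M) x n * E n) +
  (\sum_(n < M) x n * E n - L) by ring.
apply: (le_trans (ler_normD _ _)).
have := ler_normD (\sum_(k < K) l2image k * w k - \sum_(k < K) synth x M k * w k)
  (\sum_(k < K) synth x M k * w k - \sum_(n < M) x n * E n).
lra.
Qed.

(** For finite sequences this is [synth_sqr_cvg], and both sides are continuous. *)
Lemma image_sqnorm : sqnorm l2image = qlim al x.
Proof.
have il2 := image_l2.
have sl2 N : l2 (synth x N) by exists (qform al x N) => K; exact: (@sum_sqr_le_lim _ (synth x N) _ K (@synth_sqr_cvg x N)).
have B0 : 0 <= sqnorm x / mu by rewrite divr_ge0 ?sqnorm_ge0// ltW.
pose B := sqnorm x / mu.
have iB K : \sum_(k < K) l2image k ^+ 2 <= B.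
  apply: le_trans (sqnorm_ge K il2) _.
  apply: (ler_cvg_to (sqnorm_cvg il2) (cvg_cst B)); near=> N.
  rewrite ler_pdivlMr// mulrC.
  have := @image_approx 0 0 N (sqnorm x) (leqnn _) _.
  have e k : synth x 0 k = 0 by rewrite /synth big_ord0.
  under eq_bigr do rewrite e subr0.
  by apply=> N' _; rewrite big_mkord; exact: sqnorm_ge.
have sB N K : \sum_(k < K) synth x N k ^+ 2 <= B.
  rewrite ler_pdivlMr// mulrC; apply: (le_trans (synth_bessel x N K)); exact: sqnorm_ge.
suff cq : qform al x @ \oo --> sqnorm l2image by rewrite /qlim (cvg_lim _ cq).
apply/cvg_epsP => e e0.
pose d := e / (1 + 4 * B).
have d0 : 0 < d by rewrite divr_gt0// ltr_wpDr// mulr_ge0.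
have [M hM] := l2_tail xl2 (mulr_gt0 mup (exprn_gt0 2 d0)).
exists M => N MN.
have c : (fun K => \sum_(k < K) synth x N k ^+ 2 - \sum_(k < K) l2image k ^+ 2) @ \oo -->
    qform al x N - sqnorm l2image.
  by apply: cvgB; [exact: synth_sqr_cvg|exact: sqnorm_cvg].
have bound K : `|\sum_(k < K) synth x N k ^+ 2 - \sum_(k < K) l2image k ^+ 2| <= e.
  rewrite -sumrB.
  have h4 : mu * \sum_(k < K) (l2image k - synth x N k) ^+ 2 <= mu * d ^+ 2.
    apply: (@image_approx N N) => // N' NN'.
    apply: le_trans (hM N' _); last exact: leq_trans NN'.
    by rewrite [leRHS](big_cat_nat MN NN')/= lerDr sumr_ge0// => n _; exact: sqr_ge0.
  rewrite ler_pM2l// in h4.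
  apply: (le_trans (ler_norm_sum _ _ _)).
  apply: (@le_trans _ _ (\sum_(k < K) ((2 * d)^-1 * (l2image k - synth x N k) ^+ 2 +
     d * (l2image k ^+ 2 + synth x N k ^+ 2)))).
    apply: ler_sum => k _.
    have -> : synth x N k ^+ 2 - l2image k ^+ 2 = - ((l2image k - synth x N k) * (l2image k + synth x N k)) by ring.
    rewrite normrN normrM.
    have h : d / 2 * (l2image k + synth x N k) ^+ 2 <= d * (l2image k ^+ 2 + synth x N k ^+ 2).
      rewrite -subr_ge0.
      have -> : d * (l2image k ^+ 2 + synth x N k ^+ 2) - d / 2 * (l2image k + synth x N k) ^+ 2 =
        d / 2 * (l2image k - synth x N k) ^+ 2 by field.
      by apply: mulr_ge0; [rewrite divr_ge0// ltW|exact: sqr_ge0].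
    apply: le_trans (lerD (lexx _) h).
    rewrite -[X in _^-1 * X]real_normK ?num_real// -[X in d / 2 * X]real_normK ?num_real//.
    move: (`|l2image k - synth x N k|) (`|l2image k + synth x N k|) => u z.
    rewrite -subr_ge0; have -> : (2 * d)^-1 * u ^+ 2 + d / 2 * z ^+ 2 - u * z =
      (2 * d)^-1 * (u - d * z) ^+ 2 by field; exact: lt0r_neq0.
    by apply: mulr_ge0; [rewrite invr_ge0 mulr_ge0// ltW|exact: sqr_ge0].
  rewrite big_split /= -!mulr_sumr big_split /=.
  have h5 : (2 * d)^-1 * \sum_(k < K) (l2image k - synth x N k) ^+ 2 <= (2 * d)^-1 * d ^+ 2.
    by apply: ler_wpM2l => //; rewrite invr_ge0 mulr_ge0// ltW.
  have e5 : (2 * d)^-1 * d ^+ 2 = d / 2 by field; exact: lt0r_neq0.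
  have h6 : d * (\sum_(k < K) l2image k ^+ 2 + \sum_(k < K) synth x N k ^+ 2) <= d * (B + B).
    by apply: ler_wpM2l; [exact: ltW|apply: lerD].
  have e6 : d * (1 + 4 * B) = e by rewrite /d mulfVK// lt0r_neq0// ltr_wpDr// mulr_ge0.
  have : 0 <= d * B by rewrite mulr_ge0// ltW.
  by rewrite e5 in h5; lra.
rewrite ler_norml; apply/andP; split.
  apply: (ler_cvg_to (cvg_cst (- e)) c); near=> K.
  by have := bound K; rewrite ler_norml => /andP[].
apply: (ler_cvg_to c (cvg_cst e)); near=> K.
by have := bound K; rewrite ler_norml => /andP[].
Unshelve. all: by end_near. Qed.

End synthesis.

(** * Complex series *)

Local Open Scope complex_scope.

Local Notation cRe := complex.Re.
Local Notation cIm := complex.Im.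
Local Notation normc := ComplexField.Normc.normc.

Section complex_basics.
Variable R : realType.
Implicit Types (z w s : R[i]) (u : nat -> R[i]).

Lemma cReD z w : cRe (z + w) = cRe z + cRe w. Proof. by case: z w => [a b] [c d]. Qed.
Lemma cImD z w : cIm (z + w) = cIm z + cIm w. Proof. by case: z w => [a b] [c d]. Qed.
Lemma cReN z : cRe (- z) = - cRe z. Proof. by case: z. Qed.
Lemma cImN z : cIm (- z) = - cIm z. Proof. by case: z. Qed.
Lemma cReM z w : cRe (z * w) = cRe z * cRe w - cIm z * cIm w.
Proof. by case: z w => [a b] [c d]. Qed.
Lemma cImM z w : cIm (z * w) = cRe z * cIm w + cIm z * cRe w.
Proof. by case: z w => [a b] [c d]. Qed.
Lemma cReC (a : R) : cRe a%:C = a. Proof. by []. Qed.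
Lemma cImC (a : R) : cIm a%:C = 0. Proof. by []. Qed.
Lemma cReJ z : cRe z^* = cRe z. Proof. by case: z. Qed.
Lemma cImJ z : cIm z^* = - cIm z. Proof. by case: z. Qed.

Lemma c_eqP z w : cRe z = cRe w -> cIm z = cIm w -> z = w.
Proof. by case: z w => [a b] [c d] /= -> ->. Qed.

Lemma cRe_sum N u : cRe (\sum_(k < N) u k) = \sum_(k < N) cRe (u k).
Proof. by elim: N => [|N IH]; rewrite ?big_ord0// !big_ord_recr /= cReD IH. Qed.
Lemma cIm_sum N u : cIm (\sum_(k < N) u k) = \sum_(k < N) cIm (u k).
Proof. by elim: N => [|N IH]; rewrite ?big_ord0// !big_ord_recr /= cImD IH. Qed.

Lemma normc_sqr z : normc z ^+ 2 = cRe z ^+ 2 + cIm z ^+ 2.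
Proof. by case: z => a b; rewrite /= sqr_sqrtr// addr_ge0 ?sqr_ge0. Qed.

Lemma normcE z : `|z| = (normc z)%:C. Proof. by []. Qed.

Lemma normc_ge0 z : 0 <= normc z. Proof. by case: z => a b; exact: sqrtr_ge0. Qed.

Lemma Re_le_normc z : `|cRe z| <= normc z.
Proof.
by rewrite -ler_sqr ?nnegrE ?normc_ge0// real_normK ?num_real// normc_sqr lerDl sqr_ge0.
Qed.

Lemma Im_le_normc z : `|cIm z| <= normc z.
Proof.
by rewrite -ler_sqr ?nnegrE ?normc_ge0// real_normK ?num_real// normc_sqr lerDr sqr_ge0.
Qed.

Lemma normc_le z : normc z <= `|cRe z| + `|cIm z|.
Proof.
rewrite -ler_sqr ?nnegrE ?normc_ge0 ?addr_ge0// normc_sqr.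
rewrite -[X in X + _ <= _]real_normK ?num_real// -[X in _ + X <= _]real_normK ?num_real//.
have : 0 <= `|cRe z| * `|cIm z| by rewrite mulr_ge0.
lra.
Qed.

Lemma cseries_toP u (l : R[i]) : cseries_to u l <->
  (fun N => \sum_(k < N) cRe (u k)) @ \oo --> cRe l /\
  (fun N => \sum_(k < N) cIm (u k)) @ \oo --> cIm l.
Proof.
have sE N : series (u : nat -> R[i]^o) N = \sum_(k < N) u k by rewrite /series /= big_mkord.
rewrite /cseries_to; split.
  move=> /cvgrPdist_le h; split; apply/cvg_epsP => e e0.
    have [|K _ hK] := h e%:C; first by rewrite ltcR.
    exists K => n Kn; have := hK n Kn; rewrite sE normcE lecR => h2.
    rewrite -cRe_sum distrC; apply: le_trans h2; apply: le_trans (Re_le_normc _).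
    by rewrite cReD cReN.
  have [|K _ hK] := h e%:C; first by rewrite ltcR.
  exists K => n Kn; have := hK n Kn; rewrite sE normcE lecR => h2.
  rewrite -cIm_sum distrC; apply: le_trans h2; apply: le_trans (Im_le_normc _).
  by rewrite cImD cImN.
move=> [hr hi]; apply/cvgrPdist_le => -[e e'] ; rewrite ltcE /= => /andP[/eqP -> e0].
have e20 : 0 < e / 2 by rewrite divr_gt0.
have [K1 h1] := (cvg_epsP _ _).1 hr _ e20; have [K2 h2] := (cvg_epsP _ _).1 hi _ e20.
exists (maxn K1 K2) => // n /=; rewrite geq_max => /andP[n1 n2].
rewrite sE normcE lecE /= eqxx /=; apply: le_trans (normc_le _) _.
have := h1 n n1; have := h2 n n2.
rewrite cReD cImD cReN cImN cRe_sum cIm_sum (distrC (cRe l)) (distrC (cIm l)); lra.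
Qed.

End complex_basics.

(** * Square summable complex sequences *)

Section hilbert_space.
Variable R : realType.
Implicit Types (x : nat -> R[i]) (f : R[i] -> R[i]).

Definition re x k : R := cRe (x k).
Definition im x k : R := cIm (x k).

Lemma sum_normc_sqr x N :
  \sum_(k < N) normc (x k) ^+ 2 = \sum_(k < N) re x k ^+ 2 + \sum_(k < N) im x k ^+ 2.
Proof. by rewrite -big_split; apply: eq_bigr => k _; rewrite normc_sqr. Qed.

Lemma ell2P x : ell2 x <-> l2 (re x) /\ l2 (im x).
Proof.
split=> [h|[[C hC] [D hD]]].
  suff [C hC] : exists C, forall N, \sum_(k < N) normc (x k) ^+ 2 <= C.
    by split; exists C => N; have := hC N; rewrite sum_normc_sqr; apply: le_trans;
      rewrite ?lerDl ?lerDr sumr_ge0// => k _; exact: sqr_ge0.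
  move: h; rewrite /ell2 /= /l2norm.
  have S0 : (0 <= \sum_(0 <= k <oo) (normc (x k) ^+ 2)%:E)%E.
    by apply: nneseries_ge0 => k _ _; rewrite lee_fin sqr_ge0.
  move: S0; case e : (\sum_(0 <= k <oo) _)%E => [r| |]// _ _.
  exists r => N; rewrite -lee_fin -e -sumEFin.
  have h := @nneseries_lim_ge R (fun k => (normc (x k) ^+ 2)%:E) xpredT 0 N.
  rewrite big_mkord in h; apply: h => k _ _; rewrite lee_fin sqr_ge0//.
rewrite /ell2 /= /l2norm.
have : (\sum_(0 <= k <oo) (normc (x k) ^+ 2)%:E <= (C + D)%:E)%E.
  apply: lime_le; first by apply: is_cvg_nneseries => k _ _; rewrite lee_fin sqr_ge0.
  near=> N; rewrite sumEFin lee_fin big_mkord sum_normc_sqr lerD//.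
have : (0 <= \sum_(0 <= k <oo) (normc (x k) ^+ 2)%:E)%E.
  by apply: nneseries_ge0 => k _ _; rewrite lee_fin sqr_ge0.
by case: (\sum_(0 <= k <oo) _)%E => [r| |]//= _ _; rewrite ltry.
Unshelve. all: by end_near. Qed.

Definition csqnorm x : R := sqnorm (re x) + sqnorm (im x).

Lemma l2normE x : ell2 x -> l2norm x = (Num.sqrt (csqnorm x))%:E.
Proof.
move=> /ell2P[hr hi]; rewrite /l2norm.
have c : (fun N => \sum_(0 <= k < N) normc (x k) ^+ 2) @ \oo --> csqnorm x.
  rewrite [X in X @ _ --> _](_ : _ = (fun N => \sum_(k < N) re x k ^+ 2) \+ (fun N => \sum_(k < N) im x k ^+ 2)).
    by apply: cvgD; exact: sqnorm_cvg.
  by apply/funext => N; rewrite big_mkord sum_normc_sqr.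
have -> : (\sum_(0 <= k <oo) (normc (x k) ^+ 2)%:E)%E = (csqnorm x)%:E.
  rewrite -(cvg_lim _ c)// -(EFin_lim (cvgP (csqnorm x) c)).
  congr (lim (_ @ \oo)); apply/funext => N /=; by rewrite sumEFin.
by [].
Qed.

End hilbert_space.

(** * Complex powers and the symbol *)

Section complex_powers.
Variable R : realType.
Implicit Types (z w s : R[i]) (u : nat -> R[i]).

Lemma normcM z w : normc (z * w) = normc z * normc w.
Proof. exact: ComplexField.Normc.normcM. Qed.

Lemma normcN z : normc (- z) = normc z.
Proof. by case: z => a b /=; rewrite !sqrrN. Qed.

Lemma normcC (a : R) : normc a%:C = `|a|.
Proof. by rewrite /= expr0n addr0 sqrtr_sqr. Qed.

Lemma normcX z k : normc (z ^+ k) = normc z ^+ k.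
Proof.
elim: k => [|k IH]; first by rewrite !expr0 (_ : 1 = 1%:C)// normcC normr1.
by rewrite !exprS normcM IH.
Qed.

Lemma normc_conj z : normc z^* = normc z.
Proof. by case: z => a b /=; rewrite sqrrN. Qed.

Lemma cexpD z w : cexp (z + w) = cexp z * cexp w.
Proof.
rewrite /cexp cReD cImD expRD cosD sinD.
case: z w => [a b] [c d] /=; apply: c_eqP => /=; ring.
Qed.

Lemma cexp0 : cexp (0 : R[i]) = 1.
Proof. by rewrite /cexp /= expR0 cos0 sin0 mul1r. Qed.

Lemma normc_cexp z : normc (cexp z) = expR (cRe z).
Proof.
rewrite /cexp normcM normcC ger0_norm ?expR_ge0// /=.
by rewrite cos2Dsin2 sqrtr1 mulr1.
Qed.

Lemma normc_cpow n s : normc (cpow n s) = npow (cRe s) n.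
Proof. by rewrite /cpow normc_cexp cReM cReC cImC mulr0 subr0. Qed.

Lemma cpowM m n s : (0 < m)%N -> (0 < n)%N -> cpow (m * n) s = cpow m s * cpow n s.
Proof.
move=> m0 n0; rewrite /cpow natrM lnM ?posrE ?ltr0n//.
by rewrite rmorphD /= mulrDr cexpD.
Qed.

Lemma cpow1 s : cpow 1 s = 1.
Proof. by rewrite /cpow ln1 mulr0 cexp0. Qed.

Lemma cpow_exp2 k s : cpow (2 ^ k)%N s = cpow 2 s ^+ k.
Proof.
elim: k => [|k IH]; first by rewrite expn0 expr0 cpow1.
by rewrite expnS exprS cpowM ?expn_gt0// IH.
Qed.

Lemma cseries_epsP u (l : R[i]) : cseries_to u l <->
  forall e : R, 0 < e -> exists K, forall N, (K <= N)%N -> normc (\sum_(k < N) u k - l) <= e.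
Proof.
have h N : normc (\sum_(k < N) u k - l) <=
    `|\sum_(k < N) cRe (u k) - cRe l| + `|\sum_(k < N) cIm (u k) - cIm l|.
  by apply: le_trans (normc_le _) _; rewrite cReD cImD cReN cImN cRe_sum cIm_sum.
have hr N : `|\sum_(k < N) cRe (u k) - cRe l| <= normc (\sum_(k < N) u k - l).
  by apply: le_trans (Re_le_normc _); rewrite cReD cReN cRe_sum.
have hi N : `|\sum_(k < N) cIm (u k) - cIm l| <= normc (\sum_(k < N) u k - l).
  by apply: le_trans (Im_le_normc _); rewrite cImD cImN cIm_sum.
split=> [/cseries_toP[/cvg_epsP c1 /cvg_epsP c2] e e0|H].
  have e20 : 0 < e / 2 by rewrite divr_gt0.
  have [K1 h1] := c1 _ e20; have [K2 h2] := c2 _ e20.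
  exists (maxn K1 K2) => N; rewrite geq_max => /andP[n1 n2].
  by apply: le_trans (h N) _; have := h1 N n1; have := h2 N n2; lra.
apply/cseries_toP; split; apply/cvg_epsP => e e0; have [K hK] := H e e0; exists K => N KN.
  exact: le_trans (hr N) (hK N KN).
exact: le_trans (hi N) (hK N KN).
Qed.

End complex_powers.

Section symbol.
Variable R : realType.
Implicit Types (z w s : R[i]).

Lemma one_plus_neq0 z : normc z < 1 -> 1 + z != 0.
Proof.
move=> z1; apply/eqP => h; have : normc (- z) = 1.
  by rewrite (_ : - z = 1); [rewrite (_ : 1 = 1%:C)// normcC normr1|rewrite -[1]addr0 -[X in _ = _ + X](subrr z) addrA h add0r].
by rewrite normcN => h1; rewrite h1 ltxx in z1.
Qed.

Definition cayley z : R[i] := (1 - z) / (1 + z).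

Lemma cayleyE z : normc z < 1 -> cayley z * (1 + z) = 1 - z.
Proof. by move=> z1; rewrite /cayley divfK// one_plus_neq0. Qed.

Lemma Re_cayley_gt0 z : normc z < 1 -> 0 < cRe (cayley z).
Proof.
move=> z1; have e := cayleyE z1.
have := congr1 (@complex.Re R) e; have := congr1 (@complex.Im R) e.
rewrite cReM cImM !cReD !cImD cReN cImN.
have z2 : cRe z ^+ 2 + cIm z ^+ 2 < 1.
  by rewrite -normc_sqr expr_lt1// normc_ge0.
case: (cayley z) => c d /=; case: z z1 z2 {e} => a b /= _ z2 h1 h2.
have e : c * ((1 + a) ^+ 2 + b ^+ 2) = 1 - (a ^+ 2 + b ^+ 2).
  have -> : c * ((1 + a) ^+ 2 + b ^+ 2) =
    (c * (1 + a) - d * (0 + b)) * (1 + a) + (c * (0 + b) + d * (1 + a)) * b by ring.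
  by rewrite h1 h2; ring.
have p : 0 < c * ((1 + a) ^+ 2 + b ^+ 2) by rewrite e subr_gt0.
have q : 0 <= (1 + a) ^+ 2 + b ^+ 2 by rewrite addr_ge0 ?sqr_ge0.
rewrite ltNge; apply/negP => c0.
by have := mulr_le0_ge0 c0 q; rewrite leNgt p.
Qed.

Lemma normc_cpow2 s : half_plane 2^-1 s -> normc (cpow 2 (- s)) < 1.
Proof.
move=> hs; have h : 2^-1 < cRe s := hs; rewrite normc_cpow cReN /npow -[ltRHS]expR0 ltr_expR.
by rewrite mulNr oppr_lt0 mulr_gt0 ?ln_gt0 ?ltr1n//; apply: lt_trans h; rewrite invr_gt0.
Qed.

Lemma phi_symbolE al s : phi_symbol al s = (2^-1 : R)%:C + al%:C * cayley (cpow 2 (- s)).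
Proof. by rewrite /phi_symbol /cayley fmorphV rmorphMn. Qed.

Lemma phi_symbol_half_plane al s : 0 < al -> half_plane 2^-1 s -> half_plane 2^-1 (phi_symbol al s).
Proof.
move=> al0 hs; change (2^-1 < cRe (phi_symbol al s)).
rewrite phi_symbolE cReD cReM (cReC al) (cReC 2^-1) (cImC al) mul0r subr0.
by rewrite ltrDl mulr_gt0// Re_cayley_gt0// normc_cpow2.
Qed.

(** The reduction of the symbol to the Cayley transform A of 2^(- s). *)
Lemma cpow_phi al n s : (0 < n)%N -> cpow n (- phi_symbol al s) =
  (npow (- 2^-1) n)%:C * cexp (- ((al * ln n%:R)%:C * cayley (cpow 2 (- s)))).
Proof.
move=> n0; rewrite /cpow phi_symbolE opprD mulrDl cexpD; congr (_ * _).
  by rewrite /cexp -rmorphN -rmorphM /= cos0 sin0 mulr1.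
by congr cexp; rewrite rmorphM; ring.
Qed.

End symbol.

(** * The generating function of the Laguerre functions *)

Section generating_function.
Variable R : realType.
Implicit Types (z w s A : R[i]) (f g : R -> R[i]).

(** Componentwise derivative of a complex function of a real variable. *)
Definition cder f (l : R[i]) (t : R) :=
  is_derive t 1 (fun t => cRe (f t)) (cRe l) /\ is_derive t 1 (fun t => cIm (f t)) (cIm l).

Lemma cder_eq f l l' t : cder f l t -> l = l' -> cder f l' t.
Proof. by move=> h <-. Qed.

Lemma cderD f g l m t : cder f l t -> cder g m t -> cder (fun t => f t + g t) (l + m) t.
Proof.
move=> [f1 f2] [g1 g2]; split; rewrite ?cReD ?cImD.
  by have := derD f1 g1; under eq_fun do rewrite -cReD.
by have := derD f2 g2; under eq_fun do rewrite -cImD.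
Qed.

Lemma cderM f g l m t : cder f l t -> cder g m t ->
  cder (fun t => f t * g t) (f t * m + l * g t) t.
Proof.
move=> [f1 f2] [g1 g2]; split; rewrite ?cReD ?cImD ?cReM ?cImM.
  have := derB (derM f1 g1) (derM f2 g2); under eq_fun do rewrite -cReM.
  by move=> h; apply: (is_derive_eq h); ring.
have := derD (derM f1 g2) (derM f2 g1); under eq_fun do rewrite -cImM.
by move=> h; apply: (is_derive_eq h); ring.
Qed.

Lemma cder_real (h : R -> R) (d : R) w (t : R) : is_derive t 1 h d -> cder (fun t => (h t)%:C * w) (d%:C * w) t.
Proof.
move=> hd; split.
  rewrite cReM (cReC d) (cImC d) mul0r subr0.
  have := derZ (cRe w) hd; rewrite mulrC; congr is_derive.
  by apply/funext => u; rewrite cReM (cReC (h u)) (cImC (h u)) mul0r subr0 mulrC.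
rewrite cImM (cReC d) (cImC d) mul0r addr0.
have := derZ (cIm w) hd; rewrite mulrC; congr is_derive.
by apply/funext => u; rewrite cImM (cReC (h u)) (cImC (h u)) mul0r addr0 mulrC.
Qed.

Lemma cder_cexp A (t : R) : cder (fun t => cexp (t%:C * A)) (A * cexp (t%:C * A)) t.
Proof.
have e u : cexp (u%:C * A) =
    expR (cRe A * u) * cos (cIm A * u) +i* (expR (cRe A * u) * sin (cIm A * u)).
  rewrite /cexp cReM cImM (cReC u) (cImC u) !mul0r subr0 addr0 [u * _]mulrC [u * cIm A]mulrC.
  by apply: c_eqP => /=; ring.
have hl (a v : R) : is_derive v 1 (fun t => a * t) a.
  by rewrite -[X in is_derive _ _ _ X]mulr1; apply: derZ; exact: derI.
have hc : is_derive t 1 (fun t => cos (cIm A * t)) (- sin (cIm A * t) * cIm A).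
  exact: (der_comp (is_derive_cos _) (hl _ t)).
have hs : is_derive t 1 (fun t => sin (cIm A * t)) (cos (cIm A * t) * cIm A).
  exact: (der_comp (is_derive_sin _) (hl _ t)).
split; rewrite e.
  under eq_fun do rewrite e /=.
  by apply: (is_derive_eq (derM (der_expM (cRe A) t) hc)); rewrite cReM /=; ring.
under eq_fun do rewrite e /=.
by apply: (is_derive_eq (derM (der_expM (cRe A) t) hs)); rewrite cImM /=; ring.
Qed.

(** The mean value theorem applies to each component separately, hence the
    factor 2. *)
Lemma cMVT f (df : R -> R[i]) (b M : R) : 0 <= b ->
  (forall t, 0 <= t <= b -> cder f (df t) t) ->
  (forall t, 0 <= t <= b -> normc (df t) <= M) ->
  normc (f b - f 0) <= 2 * (M * b).
Proof.
rewrite le_eqVlt => /predU1P[<- _ _|b0 hd hM].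
  by rewrite subrr (_ : 0 = 0%:C)// normcC normr0 !mulr0.
apply: le_trans (normc_le _) _.
have [c cb e1] := MVT_closed b0 (fun t h => (hd t h).1).
have [d db e2] := MVT_closed b0 (fun t h => (hd t h).2).
rewrite cReD cImD cReN cImN e1 e2 !subr0 !normrM (gtr0_norm b0) mulr2n mulrDl mul1r.
have wk c' : 0 < c' < b -> 0 <= c' <= b by move=> /andP[h1 h2]; rewrite !ltW.
apply: lerD; apply: ler_wpM2r; rewrite ?(ltW b0)//.
  exact: le_trans (Re_le_normc _) (hM _ (wk _ cb)).
exact: le_trans (Im_le_normc _) (hM _ (wk _ db)).
Qed.

Definition Phi z N (b : R) : R[i] := \sum_(k < N.+1) (cco k b)%:C * z ^+ k.
Definition Psi z N (b : R) : R[i] := \sum_(k < N.+1) (sco k b)%:C * z ^+ k.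

Lemma PhiE z N b : Phi z N b = (1 + z) * Psi z N b - z ^+ N.+1 * (sco N b)%:C.
Proof.
elim: N => [|N IH].
  by rewrite /Phi /Psi !big_ord1 expr0 expr1 /=; ring.
rewrite /Phi /Psi !(big_ord_recr N.+1) /= -/(Phi z N b) -/(Psi z N b) IH.
by rewrite rmorphD /= !exprS; ring.
Qed.

Lemma cder_Phi z N t : cder (Phi z N)
  (- ((1 - z) * Psi z N t) - z ^+ N.+1 * (sco N t)%:C) t.
Proof.
elim: N => [|N IH].
  have := cder_real (z ^+ 0) (der_cco0 t).
  rewrite (_ : (fun _ => _) = Phi z 0); last by apply/funext => u; rewrite /Phi big_ord1.
  by move=> h; apply: (cder_eq h); rewrite /Psi big_ord1 rmorphN /= expr1 expr0; ring.
have := cderD IH (cder_real (z ^+ N.+1) (der_cco N t)).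
rewrite (_ : (fun _ => _) = Phi z N.+1); last by apply/funext => u; rewrite /Phi (big_ord_recr N.+1).
move=> h; apply: (cder_eq h); rewrite /Psi (big_ord_recr N.+1) /= rmorphN rmorphB /= !exprS; ring.
Qed.

Lemma Phi0 z N : Phi z N 0 = 1.
Proof.
rewrite /Phi big_ord_recl big1 => [|k _]; first by rewrite cco_0 expr0 mulr1 addr0.
by rewrite cco_0 /= mul0r.
Qed.

(** By [PhiE] and [cder_Phi], the partial sum Phi satisfies Phi' = - A Phi -
    z^(N + 1) s_N (1 + A) with A the Cayley transform of z. So Phi exp (b A) is
    almost constant, with value 1 at b = 0. *)
Lemma Phi_bound z N b : normc z < 1 -> 0 <= b ->
  normc (Phi z N b * cexp (b%:C * cayley z) - 1) <=
    2 * (normc z ^+ N.+1 * N.+1%:R * (normc (1 + cayley z) * expR (cRe (cayley z) * b)) * b).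
Proof.
move=> z1 b0; set A := cayley z.
have A0 : 0 < cRe A by exact: Re_cayley_gt0.
have := @cMVT (fun t => Phi z N t * cexp (t%:C * A))
  (fun t => - (z ^+ N.+1 * (sco N t)%:C * (1 + A) * cexp (t%:C * A))) b
  (normc z ^+ N.+1 * N.+1%:R * (normc (1 + A) * expR (cRe A * b))) b0.
rewrite Phi0 mul0r cexp0 mulr1; apply=> t /andP[t0 tb].
  apply: (cder_eq (cderM (cder_Phi z N t) (cder_cexp A t))).
  have e := cayleyE z1; rewrite -/A in e; rewrite PhiE -e; ring.
rewrite normcN 3!normcM normcX normcC -!mulrA.
apply: ler_wpM2l; first by rewrite exprn_ge0// normc_ge0.
apply: ler_pM; rewrite ?normr_ge0 ?mulr_ge0 ?normc_ge0//; first exact: sco_norm.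
apply: ler_wpM2l; first exact: normc_ge0.
rewrite normc_cexp ler_expR cReM (cReC t) (cImC t) mul0r subr0 mulrC.
by apply: ler_wpM2l => //; exact: ltW.
Qed.

Lemma nexp_small (r e : R) : 0 <= r -> r < 1 -> 0 < e ->
  exists K, forall N, (K <= N)%N -> r ^+ N * N%:R <= e.
Proof.
(* r^N N = q^N (q^N N), where the second factor is bounded. *)
move=> r0 r1 e0; pose q := Num.sqrt r.
have q0 : 0 <= q by exact: sqrtr_ge0.
have q1 : q < 1 by rewrite -sqrtr1 ltr_sqrt.
have rE : r = q ^+ 2 by rewrite sqr_sqrtr.
have hq N : q ^+ N * N%:R <= (1 - q)^-1.
  rewrite -[leRHS]mul1r ler_pdivlMr ?subr_gt0//.
  have : q ^+ N * N%:R <= \sum_(k < N) q ^+ k.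
    rewrite -[N in N%:R]card_ord -sumr_const mulr_sumr; apply: ler_sum => k _.
    by rewrite mulr1; apply: ler_wiXn2l; [exact: q0|exact: ltW|exact: ltnW].
  have : (\sum_(k < N) q ^+ k) * (1 - q) <= 1.
    rewrite mulrC -[1 - q]opprB mulNr -subrX1 opprB lerBlDr lerDl exprn_ge0//.
  move=> h1 h2; apply: le_trans h1; apply: ler_wpM2r h2; by rewrite subr_ge0 ltW.
have /cvg_epsP c : (fun N => q ^+ N) @ \oo --> (0 : R).
  by apply: cvg_expr; rewrite ger0_norm.
have [|K hK] := c (e * (1 - q)); first by rewrite mulr_gt0// subr_gt0.
exists K => N KN; have := hK N KN; rewrite subr0 ger0_norm ?exprn_ge0// => h.
rewrite rE -exprM mulnC exprM expr2 -mulrA.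
apply: le_trans (ler_wpM2l _ (hq N)) _; first exact: exprn_ge0.
by rewrite ler_pdivrMr ?subr_gt0.
Qed.

Lemma generating_function z b : normc z < 1 -> 0 <= b ->
  cseries_to (fun k => (cco k b)%:C * z ^+ k) (cexp (- (b%:C * cayley z))).
Proof.
move=> z1 b0; apply/cseries_epsP => e e0; set A := cayley z.
pose B := 2 * (normc (1 + A) * expR (cRe A * b) * b) * normc (cexp (- (b%:C * A))).
have B0 : 0 <= B by rewrite !mulr_ge0 ?normc_ge0 ?expR_ge0.
have [|K hK] := @nexp_small (normc z) (e / (1 + B)) (normc_ge0 z) z1.
  by rewrite divr_gt0// ltr_wpDr.
exists K.+1 => -[//|N] KN; have := hK N.+1 (ltnW KN).
rewrite ler_pdivlMr ?ltr_wpDr// => h; rewrite -/(Phi z N b).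
have -> : Phi z N b - cexp (- (b%:C * A)) =
    (Phi z N b * cexp (b%:C * A) - 1) * cexp (- (b%:C * A)).
  by rewrite mulrBl mul1r -mulrA -cexpD subrr cexp0 mulr1.
rewrite normcM; apply: le_trans (ler_wpM2r _ (Phi_bound N z1 b0)) _; first exact: normc_ge0.
apply: le_trans h; rewrite -/A.
have -> : 2 * (normc z ^+ N.+1 * N.+1%:R * (normc (1 + A) * expR (cRe A * b)) * b) * normc (cexp (- (b%:C * A)))
   = normc z ^+ N.+1 * N.+1%:R * B by rewrite /B; ring.
apply: ler_wpM2l; first by rewrite mulr_ge0// exprn_ge0// normc_ge0.
by rewrite lerDr.
Qed.

End generating_function.

(** * Uniqueness of Dirichlet coefficients *)

Section dirichlet_uniqueness.
Variable R : realType.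
Implicit Types (d : nat -> R).

(** The first possibly nonzero term is bounded by the sum of the following ones,
    whose bases are at least n + 2. *)
Lemma dirichlet_leading_bound d (D : R) n i : 0 <= D -> (forall k, `|d k| <= D) ->
  (forall k, (k < n)%N -> d k = 0) ->
  (fun N => \sum_(k < N) d k * npow (- (i%:R + 2)) k.+1) @ \oo --> 0 ->
  `|d n| * npow (- (i%:R + 2)) n.+1 <= 2 * D * npow (- i%:R) n.+2.
Proof.
move=> D0 dD d0 /cvg_epsP c; apply/ler_addgt0Pl => e e0.
have [K hK] := c e e0; pose N := maxn K n.+1.
have nN : (n.+1 <= N)%N by exact: leq_maxr.
have := hK N (leq_maxl _ _); rewrite subr0.
rewrite (sum_ord_split (fun k => d k * npow (- (i%:R + 2)) k.+1) nN) big_ord_recr /=.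
rewrite big1 ?add0r => [|k _]; last by rewrite d0 ?mul0r.
set T := \sum_(n.+1 <= k < N) _ => h.
have hT : `|T| <= 2 * D * npow (- i%:R) n.+2.
  apply: le_trans (ler_norm_sum _ _ _) _.
  have -> : 2 * D * npow (- i%:R) n.+2 = D * npow (- i%:R) n.+2 * 2 by ring.
  have s2 : \sum_(n.+1 <= k < N) npow (- 1 - 1 : R) k.+1 <= 2.
    have := @sum_npow_le R 1 N ltr01.
    rewrite (sum_ord_split (fun k => npow (- 1 - 1) k.+1) nN) invr1.
    have : 0 <= \sum_(k < n.+1) npow (- 1 - 1 : R) k.+1 by apply: sumr_ge0 => k _; exact: npow_ge0.
    lra.
  apply: le_trans (ler_wpM2l _ s2); last by rewrite mulr_ge0// npow_ge0.
  rewrite mulr_sumr big_nat [leRHS]big_nat; apply: ler_sum => k /andP[nk _].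
  rewrite normrM (ger0_norm (npow_ge0 _ _)) -mulrA; apply: ler_pM => //; first exact: npow_ge0.
  rewrite (@npow_split _ (- i%:R) (- 1 - 1)); last by ring.
  apply: ler_wpM2r; first exact: npow_ge0.
  by rewrite !npowN lef_pV2 ?posrE ?npow_gt0// npow_le.
have -> : `|d n| * npow (- (i%:R + 2)) n.+1 = `|d n * npow (- (i%:R + 2)) n.+1 + T - T|.
  by rewrite addrK normrM (ger0_norm (npow_ge0 _ _)).
by apply: le_trans (ler_normB _ _) _; apply: lerD.
Qed.

(** In [dirichlet_leading_bound] the right-hand side decreases faster than the
    power on the left when the exponent i grows. *)
Lemma dirichlet_real_uniqueness d (D : R) : 0 <= D -> (forall k, `|d k| <= D) ->
  (forall i, (fun N => \sum_(k < N) d k * npow (- (i%:R + 2)) k.+1) @ \oo --> 0) ->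
  forall k, d k = 0.
Proof.
move=> D0 dD c n; elim/ltn_ind: n => n IH.
apply/eqP; rewrite -normr_eq0; apply/negPn/negP => dn0.
have dn : 0 < `|d n| by rewrite lt_def dn0 normr_ge0.
pose de := ln (n.+2%:R : R) - ln n.+1%:R.
have de0 : 0 < de by rewrite subr_gt0 ltr_ln ?posrE ?ltr0n// ltr_nat.
pose C := 2 * D * npow 2 n.+1.
have h i : `|d n| * (1 + i%:R * de) <= C.
  have := dirichlet_leading_bound D0 dD IH (c i).
  have -> : npow (- i%:R) n.+2 = npow (- i%:R) n.+1 * expR (- (i%:R * de)).
    by rewrite /npow -expRD /de; congr expR; ring.
  rewrite (@npow_split _ (- i%:R) (- 2)); last by ring.
  rewrite mulrCA [leRHS]mulrCA ler_pM2l ?npow_gt0// (npowN 2) ler_pdivrMr ?npow_gt0// => h.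
  have e1 := expR_ge1Dx (i%:R * de).
  apply: le_trans (ler_wpM2l (ltW dn) e1) _.
  apply: le_trans (ler_wpM2r (expR_ge0 _) h) _.
  rewrite /C; have : expR (- (i%:R * de)) * expR (i%:R * de) = 1 by rewrite -expRD addNr expR0.
  set a := expR _; set b := expR _ => ab.
  have -> : 2 * D * a * npow 2 n.+1 * b = 2 * D * npow 2 n.+1 * (a * b) by ring.
  by rewrite ab mulr1.
have [i hi] : exists i, C / (`|d n| * de) < i%:R.
  by exists (Num.bound `|C / (`|d n| * de)|); apply: le_lt_trans (ler_norm _) (archi_boundP _); exact: normr_ge0.
have := h i; move: hi; rewrite ltr_pdivrMr ?mulr_gt0// => h1 h2.
have := lt_le_trans h1 (le_refl _); move: h2; rewrite mulrDr mulr1.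
have -> : `|d n| * (i%:R * de) = i%:R * (`|d n| * de) by ring.
lra.
Qed.

Lemma l2_bounded x : l2 x -> exists2 D : R, 0 <= D & forall k, `|x k| <= D.
Proof.
move=> [C hC]; exists (1 + C); first by have := l2_ge0 0 hC; lra.
move=> k; have := hC k.+1; rewrite big_ord_recr /=.
have : 0 <= \sum_(i < k) x i ^+ 2 by apply: sumr_ge0 => i _; exact: sqr_ge0.
have : 0 <= (`|x k| - 1) ^+ 2 by exact: sqr_ge0.
have : x k ^+ 2 = `|x k| ^+ 2 by rewrite real_normK ?num_real.
have := normr_ge0 (x k); move: `|x k| => y; nra.
Qed.

End dirichlet_uniqueness.

Section H2_norm.
Variable R : realType.
Implicit Types (x : nat -> R[i]) (f : R[i] -> R[i]).

Lemma cpow_real n (a : R) : cpow n (a%:C) = (npow a n)%:C.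
Proof. by rewrite /cpow -rmorphM /cexp /= cos0 sin0 mulr1. Qed.

Lemma H2_coeffs_unique f x y : H2_coeffs f x -> H2_coeffs f y -> x = y.
Proof.
move=> [/ell2P[xr xi] hx] [/ell2P[yr yi] hy].
have hp i : half_plane 2^-1 ((i%:R + 2 : R)%:C).
  change ((2^-1 : R) < i%:R + 2); have : (0 : R) <= i%:R by []. lra.
have key (p : R[i] -> R) : (p = complex.Re (R := R) \/ p = complex.Im (R := R)) ->
    l2 (p \o x) -> l2 (p \o y) -> forall k, p (x k) = p (y k).
  move=> hpp lx ly k; apply/eqP; rewrite -subr_eq0; apply/eqP; move: k.
  have [D D0 hD] := l2_bounded lx; have [D' D'0 hD'] := l2_bounded ly.
  apply: (@dirichlet_real_uniqueness R (fun k => p (x k) - p (y k)) (D + D')).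
  - exact: addr_ge0.
  - by move=> k; apply: le_trans (ler_normB _ _) _; apply: lerD; [exact: hD|exact: hD'].
  move=> i; have /cseries_toP[x1 x2] := hx _ (hp i); have /cseries_toP[y1 y2] := hy _ (hp i).
  have e z k : p (z * cpow k.+1 (- (i%:R + 2 : R)%:C)) = p z * npow (- (i%:R + 2)) k.+1.
    rewrite -rmorphN cpow_real; case: hpp => ->.
      by rewrite cReM (cReC (npow _ _)) (cImC (npow _ _)) mulr0 subr0.
    by rewrite cImM (cReC (npow _ _)) (cImC (npow _ _)) mulr0 add0r.
  have cc (u : nat -> R[i]) (l : R) : (fun N => \sum_(k < N) p (u k * cpow k.+1 (- (i%:R + 2 : R)%:C))) @ \oo --> l ->
     (fun N => \sum_(k < N) p (u k) * npow (- (i%:R + 2)) k.+1) @ \oo --> l.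
    by under eq_fun do under eq_bigr do rewrite e.
  have [l [c1 c2]] : exists l : R, (fun N => \sum_(k < N) p (x k * cpow k.+1 (- (i%:R + 2 : R)%:C))) @ \oo --> l /\
     (fun N => \sum_(k < N) p (y k * cpow k.+1 (- (i%:R + 2 : R)%:C))) @ \oo --> l.
    by case: hpp => ->; [exists (cRe (f (i%:R + 2)%:C))|exists (cIm (f (i%:R + 2)%:C))].
  have h := cvgB (cc _ _ c1) (cc _ _ c2); rewrite subrr in h.
  rewrite [X in X @ _ --> _](_ : _ = (fun N => \sum_(k < N) p (x k) * npow (- (i%:R + 2)) k.+1) -
    (fun N => \sum_(k < N) p (y k) * npow (- (i%:R + 2)) k.+1)); first exact: h.
  by apply/funext => N; rewrite !fctE -sumrB; apply: eq_bigr => k _; rewrite mulrBl.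
apply/funext => k; apply: c_eqP.
  by apply: (key (@complex.Re R)) => //; left.
by apply: (key (@complex.Im R)) => //; right.
Qed.

Lemma H2normE f x : H2_coeffs f x -> H2norm f = (Num.sqrt (csqnorm x))%:E.
Proof.
move=> h; rewrite /H2norm; case: asboolP => [_|[]]; last by exists x.
have -> : H2_coef f = x.
  exact: H2_coeffs_unique (xgetI _ h) h.
by apply: l2normE; case: h.
Qed.

End H2_norm.

(** * Composition with the symbol *)

Section sparse.
Variable R : realType.

(** The Dirichlet coefficients of the series of the a_k 2^(- k s). *)
Definition sparse (V : nmodType) (a : nat -> V) (j : nat) : V :=
  let k := trunc_log 2 j.+1 in if (2 ^ k == j.+1)%N then a k else 0.

Definition num_powers N : nat := if N is n.+1 then (trunc_log 2 n.+1).+1 else 0.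

Lemma num_powersS N : num_powers N.+1 =
  (num_powers N + (2 ^ trunc_log 2 N.+1 == N.+1))%N.
Proof.
case: N => [|N]; first by rewrite /num_powers trunc_log1 expn0.
rewrite /num_powers; set t := trunc_log 2 N.+1.
have /andP[t1 t2] : (2 ^ t <= N.+1 < 2 ^ t.+1)%N by exact: trunc_log_bounds.
have [e|ne] := eqVneq N.+2 (2 ^ t.+1)%N.
  by rewrite e trunc_expnK// eqxx addn1.
have -> : trunc_log 2 N.+2 = t.
  by apply: trunc_log_eq => //; rewrite (leq_trans t1)//= ltn_neqAle ne.
by rewrite [(_ == _)%N]ltn_eqF ?addn0// ltnS.
Qed.

Lemma sparse_sum (V : nmodType) (a : nat -> V) N :
  \sum_(j < N) sparse a j = \sum_(k < num_powers N) a k.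
Proof.
elim: N => [|N IH]; first by rewrite !big_ord0.
rewrite big_ord_recr num_powersS IH /sparse; case: eqP => [e|_]; last by rewrite addn0 /= addr0.
rewrite addn1 big_ord_recr /=; congr (_ + a _).
case: N e {IH} => [|N] e; first by rewrite trunc_log1.
rewrite /num_powers; case: (trunc_log 2 N.+2) e => [|u] e; first by [].
congr _.+1; apply/esym; apply: trunc_log_eq => //; rewrite e ltnSn andbT -ltnS.
by rewrite -[N.+2]e ltn_exp2l.
Qed.

Lemma num_powers_ge K N : (2 ^ K <= N)%N -> (K <= num_powers N)%N.
Proof.
case: N => [|N]; first by rewrite leqNgt expn_gt0.
by move=> h; rewrite /num_powers ltnW// ltnS trunc_log_max.
Qed.

Lemma sparse_cvg (b : nat -> R) (l : R) : (fun N => \sum_(k < N) b k) @ \oo --> l ->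
  (fun N => \sum_(k < N) sparse b k) @ \oo --> l.
Proof.
move=> /cvg_epsP h; apply/cvg_epsP => e e0; have [K hK] := h e e0; exists (2 ^ K)%N => N KN.
by rewrite sparse_sum; apply: hK; exact: num_powers_ge.
Qed.

Lemma sparse_cseries (b : nat -> R[i]) (l : R[i]) : cseries_to b l -> cseries_to (sparse b) l.
Proof.
move=> /cseries_epsP h; apply/cseries_epsP => e e0; have [K hK] := h e e0; exists (2 ^ K)%N => N KN.
by rewrite sparse_sum; apply: hK; exact: num_powers_ge.
Qed.

Lemma sparse_sqr (a : nat -> R) j : sparse a j ^+ 2 = sparse (fun k => a k ^+ 2) j.
Proof. by rewrite /sparse; case: eqP => // _; rewrite expr0n. Qed.

Lemma sparse_l2 (a : nat -> R) : l2 a -> l2 (sparse a).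
Proof.
move=> [C hC]; exists C => N.
by under eq_bigr do rewrite sparse_sqr; rewrite sparse_sum.
Qed.

Lemma sparse_sqnorm (a : nat -> R) : l2 a -> sqnorm (sparse a) = sqnorm a.
Proof.
move=> h; apply: cvg_lim => //.
have := @sparse_cvg (fun k => a k ^+ 2) _ (sqnorm_cvg h).
by under eq_fun do under eq_bigr do rewrite -sparse_sqr.
Qed.

End sparse.

Section l2_products.
Variable R : realType.
Implicit Types a b : nat -> R.

Lemma l2_le a b : (forall k, `|a k| <= `|b k|) -> l2 b -> l2 a.
Proof.
move=> h [C hC]; exists C => N; apply: le_trans (hC N); apply: ler_sum => k _.
by rewrite -[leLHS]real_normK ?num_real// -[leRHS]real_normK ?num_real// ler_sqr ?nnegrE.
Qed.

Lemma l2D a b : l2 a -> l2 b -> l2 (fun k => a k + b k).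
Proof.
move=> [C hC] [D hD]; exists (2 * C + 2 * D) => N.
apply: le_trans (lerD (ler_wpM2l (ler0n R 2) (hC N)) (ler_wpM2l (ler0n R 2) (hD N))).
rewrite !mulr_sumr -big_split; apply: ler_sum => k _ /=.
by have := sqr_ge0 (a k - b k); nra.
Qed.

Lemma l2_prod_cvg a b : l2 a -> l2 b -> cvgn (fun N => \sum_(k < N) a k * b k).
Proof.
move=> la lb; apply/cvg_ex; exists (2^-1 * (sqnorm (fun k => a k + b k) - sqnorm a - sqnorm b)).
have h : (fun N => \sum_(k < N) (a k + b k) ^+ 2 - \sum_(k < N) a k ^+ 2 - \sum_(k < N) b k ^+ 2) @ \oo -->
  sqnorm (fun k => a k + b k) - sqnorm a - sqnorm b := cvgB (cvgB (sqnorm_cvg (l2D la lb)) (sqnorm_cvg la)) (sqnorm_cvg lb).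
rewrite [X in X @ _ --> _](_ : _ = (fun N => 2^-1 * (\sum_(k < N) (a k + b k) ^+ 2 -
   \sum_(k < N) a k ^+ 2 - \sum_(k < N) b k ^+ 2))); first by apply: cvgMl_tmp; exact: h.
by apply/funext => N; rewrite -!sumrB mulr_sumr; apply: eq_bigr => k _; field.
Qed.

Lemma l2_geometric (r : R) : 0 <= r -> r < 1 -> l2 (fun k => r ^+ k).
Proof.
move=> r0 r1; exists (1 - r)^-1 => N.
apply: (@le_trans _ _ (\sum_(k < N) r ^+ k)).
  by apply: ler_sum => k _; rewrite expr2 ler_piMr ?exprn_ge0// exprn_ile1// ltW.
rewrite -[leRHS]mul1r ler_pdivlMr ?subr_gt0//.
by rewrite mulrC -[1 - r]opprB mulNr -subrX1 opprB lerBlDr lerDl exprn_ge0.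
Qed.

End l2_products.

Section composition.
Variables (R : realType) (al mu : R).
Hypotheses (al0 : 0 < al) (mup : 0 < mu) (adm : admissible al mu).
Implicit Types (x : nat -> R[i]) (f : R[i] -> R[i]) (s : R[i]).

Lemma cseries_toZ c (u : nat -> R[i]) l : cseries_to u l -> cseries_to (fun k => c * u k) (c * l).
Proof.
move=> /cseries_epsP h; apply/cseries_epsP => e e0.
have p : 0 < 1 + normc c by rewrite ltr_wpDr// normc_ge0.
have [|K hK] := h (e / (1 + normc c)); first exact: divr_gt0.
exists K => N KN; rewrite -mulr_sumr -mulrBr normcM.
have := hK N KN; rewrite ler_pdivlMr// => h1; apply: le_trans h1; rewrite mulrC.
by apply: ler_wpM2l; [exact: normc_ge0|rewrite lerDr].
Qed.

Lemma kvec_series n s : half_plane 2^-1 s ->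
  cseries_to (fun k => (kvec al n k)%:C * cpow 2 (- s) ^+ k) (cpow n.+1 (- phi_symbol al s)).
Proof.
move=> hs; rewrite cpow_phi//.
have b0 : 0 <= al * ln (n.+1%:R : R) by rewrite mulr_ge0 ?(ltW al0)// ln_ge0// ler1n.
have := @cseries_toZ (npow (- 2^-1) n.+1)%:C _ _ (generating_function (normc_cpow2 hs) b0).
by congr cseries_to; apply/funext => k; rewrite mulrA -rmorphM.
Qed.

Definition comp_coef x : nat -> R[i] := fun k => l2image al (re x) k +i* l2image al (im x) k.

Lemma l2_cpow s : 2^-1 < cRe s -> l2 (fun n => normc (cpow n.+1 (- s))).
Proof.
move=> hs; have := @kseq_l2 R (cRe s - 2^-1); rewrite subr_gt0 => /(_ hs).
apply: l2_le => k; rewrite normc_cpow cReN !ger0_norm ?npow_ge0//.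
by rewrite /kseq [- 2^-1 - _](_ : _ = - cRe s)//; ring.
Qed.

(** Expand n^(- phi) in powers of 2^(- s) and interchange the sums by
    [image_pair]. This is done for the real and imaginary parts of both factors,
    whose products are summable. *)
Lemma comp_series f x s : H2_coeffs f x -> half_plane 2^-1 s ->
  cseries_to (fun k => comp_coef x k * cpow 2 (- s) ^+ k) (f (phi_symbol al s)).
Proof.
move=> [/ell2P[xr xi] hx] hs.
have hphi := phi_symbol_half_plane al0 hs.
have /cseries_toP[f1 f2] := hx _ hphi.
pose E n := cpow n.+1 (- phi_symbol al s).
pose z := cpow 2 (- s).
have zl : l2 (fun k => normc z ^+ k) by apply: l2_geometric; [exact: normc_ge0|exact: normc_cpow2].
have zr : l2 (fun k => cRe (z ^+ k)).
  by apply: l2_le zl => k; rewrite -normcX [leRHS]ger0_norm ?normc_ge0// Re_le_normc.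
have zi : l2 (fun k => cIm (z ^+ k)).
  by apply: l2_le zl => k; rewrite -normcX [leRHS]ger0_norm ?normc_ge0// Im_le_normc.
have El : l2 (fun n => normc (E n)) by exact: l2_cpow.
have Er : l2 (fun n => cRe (E n)).
  by apply: l2_le El => k; rewrite [leRHS]ger0_norm ?normc_ge0// Re_le_normc.
have Ei : l2 (fun n => cIm (E n)).
  by apply: l2_le El => k; rewrite [leRHS]ger0_norm ?normc_ge0// Im_le_normc.
have kr n : (fun K => \sum_(k < K) kvec al n k * cRe (z ^+ k)) @ \oo --> cRe (E n).
  have /cseries_toP[c _] := @kvec_series n s hs; move: c.
  by under eq_fun do under eq_bigr => k _ do rewrite cReM (cReC (kvec al n k)) (cImC (kvec al n k)) mul0r subr0.
have ki n : (fun K => \sum_(k < K) kvec al n k * cIm (z ^+ k)) @ \oo --> cIm (E n).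
  have /cseries_toP[_ c] := @kvec_series n s hs; move: c.
  by under eq_fun do under eq_bigr => k _ do rewrite cImM (cReC (kvec al n k)) (cImC (kvec al n k)) mul0r addr0.
have pair a w F : l2 a -> l2 w -> l2 F ->
    (forall n, (fun K => \sum_(k < K) kvec al n k * w k) @ \oo --> F n) ->
    exists L : R, (fun N => \sum_(n < N) a n * F n) @ \oo --> L /\
      (fun K => \sum_(k < K) l2image al a k * w k) @ \oo --> L.
  move=> la lw lF h; have c := l2_prod_cvg la lF; exists (limn (fun N => \sum_(n < N) a n * F n)).
  by split => //; apply: (image_pair al0 mup adm la lw h).
have [L1 [a1 b1]] := pair _ _ _ xr zr Er kr.
have [L2 [a2 b2]] := pair _ _ _ xi zi Ei ki.
have [L3 [a3 b3]] := pair _ _ _ xr zi Ei ki.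
have [L4 [a4 b4]] := pair _ _ _ xi zr Er kr.
apply/cseries_toP; split.
  have -> : cRe (f (phi_symbol al s)) = L1 - L2.
    rewrite -(cvg_lim _ f1)//; apply: cvg_lim => //.
    under eq_fun do under eq_bigr do rewrite cReM.
    by under eq_fun do rewrite sumrB; exact: cvgB a1 a2.
  under eq_fun do under eq_bigr do rewrite cReM /=.
  by under eq_fun do rewrite sumrB; exact: cvgB b1 b2.
have -> : cIm (f (phi_symbol al s)) = L3 + L4.
  rewrite -(cvg_lim _ f2)//; apply: cvg_lim => //.
  under eq_fun do under eq_bigr do rewrite cImM.
  by under eq_fun do rewrite big_split /=; exact: cvgD a3 a4.
under eq_fun do under eq_bigr do rewrite cImM /=.
by under eq_fun do rewrite big_split /=; exact: cvgD b3 b4.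
Qed.

Lemma comp_H2 f x : H2_coeffs f x -> H2_coeffs (comp_op (phi_symbol al) f) (sparse (comp_coef x)).
Proof.
move=> h; have [/ell2P[xr xi] _] := h.
have er : re (sparse (comp_coef x)) = sparse (l2image al (re x)).
  by apply/funext => k; rewrite /re /sparse; case: eqP.
have ei : im (sparse (comp_coef x)) = sparse (l2image al (im x)).
  by apply/funext => k; rewrite /im /sparse; case: eqP.
split.
  apply/ell2P; rewrite er ei.
  by split; apply: sparse_l2; apply: image_l2 al0 mup adm _ _.
move=> s hs; have := sparse_cseries (comp_series h hs).
congr cseries_to; apply/funext => j; rewrite /sparse.
by case: eqP => [e|_]; [rewrite -cpow_exp2 e|rewrite mul0r].
Qed.

Lemma comp_H2norm f x : H2_coeffs f x -> H2norm (comp_op (phi_symbol al) f) =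
  (Num.sqrt (qlim al (re x) + qlim al (im x)))%:E.
Proof.
move=> h; have [/ell2P[xr xi] _] := h.
rewrite (H2normE (comp_H2 h)) /csqnorm.
have -> : re (sparse (comp_coef x)) = sparse (l2image al (re x)).
  by apply/funext => k; rewrite /re /sparse; case: eqP.
have -> : im (sparse (comp_coef x)) = sparse (l2image al (im x)).
  by apply/funext => k; rewrite /im /sparse; case: eqP.
by rewrite !sparse_sqnorm ?(image_sqnorm al0 mup adm)//; apply: image_l2 al0 mup adm _ _.
Qed.

End composition.

(** * Reproducing kernels *)

Section dirichlet_series.
Variable R : realType.
Implicit Types (x : nat -> R[i]) (f : R[i] -> R[i]) (w s : R[i]).

Lemma cseries_sumE (u : nat -> R[i]) l : cseries_to u l -> cseries_sum u = l.
Proof. move=> h; exact: (cvg_lim (@norm_hausdorff _ R[i]^o) (h : _ --> (l : R[i]^o))). Qed.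

Lemma dirichlet_cvg x s : ell2 x -> half_plane 2^-1 s ->
  exists l, cseries_to (fun k => x k * cpow k.+1 (- s)) l.
Proof.
move=> /ell2P[xr xi] hs.
have El : l2 (fun n => normc (cpow n.+1 (- s))) by exact: l2_cpow.
have Er : l2 (fun n => cRe (cpow n.+1 (- s))).
  by apply: l2_le El => k; rewrite [leRHS]ger0_norm ?normc_ge0// Re_le_normc.
have Ei : l2 (fun n => cIm (cpow n.+1 (- s))).
  by apply: l2_le El => k; rewrite [leRHS]ger0_norm ?normc_ge0// Im_le_normc.
have a1 := l2_prod_cvg xr Er; have a2 := l2_prod_cvg xi Ei.
have a3 := l2_prod_cvg xr Ei; have a4 := l2_prod_cvg xi Er.
exists ((limn (fun N => \sum_(k < N) re x k * cRe (cpow k.+1 (- s))) -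
         limn (fun N => \sum_(k < N) im x k * cIm (cpow k.+1 (- s)))) +i*
        (limn (fun N => \sum_(k < N) re x k * cIm (cpow k.+1 (- s))) +
         limn (fun N => \sum_(k < N) im x k * cRe (cpow k.+1 (- s))))).
apply/cseries_toP; split.
  rewrite [X in X @ _ --> _](_ : _ = fun N => \sum_(k < N) re x k * cRe (cpow k.+1 (- s)) -
    \sum_(k < N) im x k * cIm (cpow k.+1 (- s))); first exact: cvgB a1 a2.
  by apply/funext => N; rewrite -sumrB; apply: eq_bigr => k _; rewrite cReM.
rewrite [X in X @ _ --> _](_ : _ = fun N => \sum_(k < N) re x k * cIm (cpow k.+1 (- s)) +
  \sum_(k < N) im x k * cRe (cpow k.+1 (- s))); first exact: cvgD a3 a4.
by apply/funext => N; rewrite -big_split; apply: eq_bigr => k _; rewrite cImM.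
Qed.

Lemma H2_of_coeffs x : ell2 x ->
  H2_coeffs (fun s => cseries_sum (fun k => x k * cpow k.+1 (- s))) x.
Proof.
move=> h; split=> // s hs; have [l hl] := dirichlet_cvg h hs.
by rewrite (cseries_sumE hl).
Qed.

Definition kernel_coef w : nat -> R[i] := fun k => cpow k.+1 (- w^*).

Lemma normc_kernel_coef w k : normc (kernel_coef w k) = kseq (cRe w - 2^-1) k.
Proof.
rewrite /kernel_coef normc_cpow cReN cReJ /kseq.
by have -> : - cRe w = - 2^-1 - (cRe w - 2^-1) by ring.
Qed.

Lemma half_plane_gt0 w : half_plane 2^-1 w -> 0 < cRe w - 2^-1.
Proof. by rewrite subr_gt0. Qed.

Lemma kernel_ell2 w : half_plane 2^-1 w -> ell2 (kernel_coef w).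
Proof.
move=> /half_plane_gt0 h; apply/ell2P; split.
  apply: l2_le (kseq_l2 h) => k; rewrite -normc_kernel_coef [leRHS]ger0_norm ?normc_ge0//.
  exact: Re_le_normc.
apply: l2_le (kseq_l2 h) => k; rewrite -normc_kernel_coef [leRHS]ger0_norm ?normc_ge0//.
exact: Im_le_normc.
Qed.

Lemma kernel_coeffs w : half_plane 2^-1 w -> H2_coeffs (repr_kernel w) (kernel_coef w).
Proof.
move=> h; suff -> : repr_kernel w = fun s => cseries_sum (fun k => kernel_coef w k * cpow k.+1 (- s)).
  exact: H2_of_coeffs (kernel_ell2 h).
apply/funext => s; rewrite /repr_kernel /zeta.
suff -> : (fun k => cpow k.+1 (- (s + w^*))) = (fun k => kernel_coef w k * cpow k.+1 (- s)) by [].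
apply/funext => k; rewrite /kernel_coef /cpow -cexpD -mulrDl.
by have -> : - (s + w^*) = - w^* - s by ring.
Qed.

Lemma kernel_csqnorm w : half_plane 2^-1 w -> csqnorm (kernel_coef w) = sqnorm (kseq (cRe w - 2^-1)).
Proof.
move=> h; have [xr xi] := (ell2P _).1 (kernel_ell2 h).
apply/esym/cvg_lim => //.
rewrite [X in X @ _ --> _](_ : _ = fun N => \sum_(k < N) re (kernel_coef w) k ^+ 2 +
  \sum_(k < N) im (kernel_coef w) k ^+ 2); first exact: cvgD (sqnorm_cvg xr) (sqnorm_cvg xi).
by apply/funext => N; rewrite -sum_normc_sqr; apply: eq_bigr => k _; rewrite normc_kernel_coef.
Qed.

Lemma kernel_H2norm w : half_plane 2^-1 w ->
  H2norm (repr_kernel w) = (Num.sqrt (sqnorm (kseq (cRe w - 2^-1))))%:E.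
Proof. by move=> h; rewrite (H2normE (kernel_coeffs h)) kernel_csqnorm. Qed.

End dirichlet_series.

Section composed_kernels.
Variables (R : realType) (al mu : R).
Hypotheses (al0 : 0 < al) (mup : 0 < mu) (adm : admissible al mu).
Implicit Types (w : R[i]).

(** The entries of the matrix are positive, so the form increases when the
    coefficients are replaced by their moduli, which belong to a real kernel. *)
Lemma kernel_qlim_le w : half_plane 2^-1 w ->
  qlim al (re (kernel_coef w)) + qlim al (im (kernel_coef w)) <= qlim al (kseq (cRe w - 2^-1)).
Proof.
move=> h; have [xr xi] := (ell2P _).1 (kernel_ell2 h).
apply: (ler_cvg_to (cvgD (qform_cvg al0 mup adm xr) (qform_cvg al0 mup adm xi))
  (qform_cvg al0 mup adm (kseq_l2 (half_plane_gt0 h)))).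
near=> N; rewrite !fctE /qform -big_split; apply: ler_sum => i _ /=.
rewrite -big_split; apply: ler_sum => j _ /=; rewrite -mulrDr.
apply: ler_wpM2l; first by rewrite /kern mulr_ge0// npow_ge0.
rewrite -!normc_kernel_coef -normc_conj -normcM.
apply: le_trans (Re_le_normc _); apply: le_trans (ler_norm _).
by rewrite cReM cReJ cImJ mulNr opprK.
Unshelve. all: by end_near. Qed.

Lemma real_kernel_qlim (de : R) : 
  qlim al (re (kernel_coef (2^-1 + de)%:C)) + qlim al (im (kernel_coef (2^-1 + de)%:C)) =
  qlim al (kseq de).
Proof.
have e k : kernel_coef (2^-1 + de)%:C k = (kseq de k)%:C.
  rewrite /kernel_coef /kseq (_ : - (2^-1 + de)%:C^* = (- 2^-1 - de)%:C); first by rewrite cpow_real.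
  by apply: c_eqP => /=; ring.
have -> : re (kernel_coef (2^-1 + de)%:C) = kseq de by apply/funext => k; rewrite /re e.
have -> : im (kernel_coef (2^-1 + de)%:C) = fun=> 0 by apply/funext => k; rewrite /im e.
have -> : qlim al (fun=> 0) = 0.
  apply: cvg_lim => //.
  rewrite [X in X @ _ --> _](_ : _ = fun=> 0); first exact: cvg_cst.
  by apply/funext => N; rewrite /qform big1// => i _; rewrite big1// => j _; rewrite !mulr0.
by rewrite addr0.
Qed.

End composed_kernels.

(** * Eigenvalues of the matrix *)

Section eigenvalues.
Variables (R : realType) (al : R).
Hypothesis al0 : 0 < al.

Lemma KmatrixE i j : Kmatrix al i j = kern al i j.
Proof.
wlog ji : i j / (j <= i)%N => [h|].
  have [/h//|/ltnW/h e] := leqP j i.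
  by rewrite kernC -e /Kmatrix mulnC maxnC.
rewrite kern_le// /Kmatrix (maxn_idPl _)// !npow_powR ?muln_gt0//.
have -> : npow (- 2^-1 + al) (i.+1 * j.+1) = npow (- 2^-1 + al) i.+1 * npow (al - 2^-1) j.+1.
  by rewrite /npow natrM lnM ?posrE ?ltr0n// [al - _]addrC mulrDr expRD.
rewrite (@npow_split _ (- 2^-1 - al) (2 * al) (- 2^-1 + al)); last by ring.
by field; exact: npow_neq0.
Qed.

Lemma eigenvalue_number_eq0 (A : nat -> nat -> R) :
  eigenvalue_number A = 0%E <-> forall l, ~ eigenvalue_ell2 A l.
Proof.
rewrite /eigenvalue_number /counting; split=> [|h].
  case: asboolP => // fs [] /eqP; rewrite pnatr_eq0 finmap.cardfs_eq0 => /eqP e l el.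
  by have := in_fset_set fs l; rewrite e finmap.in_fset0 mem_set.
have -> : eigenvalue_ell2 A = set0 by apply/seteqP; split=> // l /h.
by case: asboolP => [_|[]]; [rewrite fset_set0 finmap.cardfs0|exact: finite_set0].
Qed.

Lemma no_eigenvalue_critical l : admissible al (al / 2) -> ~ eigenvalue_ell2 (Kmatrix al) l.
Proof.
move=> adm [x [/ell2P[xr xi] [k xk] hx]].
have e n m : (Kmatrix al n m)%:C * x m =
    (kern al n m * re x m) +i* (kern al n m * im x m).
  rewrite KmatrixE; apply: c_eqP; first by rewrite cReM (cReC (kern _ _ _)) (cImC (kern _ _ _)) mul0r subr0.
  by rewrite cImM (cReC (kern _ _ _)) (cImC (kern _ _ _)) mul0r addr0.
have [n|n|r0 i0] := @no_eigenvalue R al al0 (re x) (im x) (cRe l) (cIm l) adm xr xi _ _ k.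
- have /cseries_toP[h _] := hx n; rewrite cReM in h; move: h.
  by under eq_fun do under eq_bigr do rewrite e /=.
- have /cseries_toP[_ h] := hx n; rewrite cImM addrC in h; move: h.
  by under eq_fun do under eq_bigr do rewrite e /=.
by move/eqP: xk; apply; apply: c_eqP.
Qed.

Lemma eigenvalue_subcritical mu : subcritical al mu ->
  eigenvalue_ell2 (Kmatrix al) (mu^-1)%:C.
Proof.
move=> sub; exists (fun k => (ground al mu k)%:C); split.
- apply/ell2P; split; first exact: ground_l2 al0 sub.
  by exists 0 => N; rewrite big1// => k _; rewrite /im /= expr0n.
- exists 0%N; apply/eqP => /(congr1 (@complex.Re R)) /= h.
  by have := ground_gt0 sub 0; rewrite h ltxx.
move=> n; apply/cseries_toP; split.
  rewrite -rmorphM /=; rewrite [X in X @ _ --> _](_ : _ = fun M => \sum_(m < M) kern al n m * ground al mu m).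
    exact: (@ground_eigen _ _ _ al0 sub n).
  by apply/funext => N; apply: eq_bigr => m _; rewrite KmatrixE /= mul0r subr0.
rewrite -rmorphM /=.
rewrite [X in X @ _ --> _](_ : _ = fun=> 0); first exact: cvg_cst.
by apply/funext => N; rewrite big1// => k _; rewrite /= mulr0 mul0r addr0.
Qed.

(** Let t be the entry K(1,2) of the matrix. At the vector (1, t) the form is 1
    + 2 t^2 + t^2 / 2, which exceeds the squared norm. *)
Lemma large_not_critical : 2 <= al -> ~ admissible al (al / 2).
Proof.
move=> al2 adm; have p : 0 < al / 2 by rewrite divr_gt0.
pose K := npow (- 2^-1 - al) 2.
have K0 : 0 < K by exact: npow_gt0.
pose x k : R := if k is 0 then 1 else K.
have := qform_le (ltW p) adm p x 2.
have k00 : kern al 0 0 = 1 by rewrite /kern !npow_1 mulr1.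
have k10 : kern al 1 0 = K by rewrite /kern !npow_1 mulr1.
have k11 : kern al 1 1 = 2^-1.
  rewrite /kern -npowD (_ : _ + _ = -1); last by field.
  by rewrite npowN npow1.
rewrite /qform !big_ord_recr !big_ord0 /= (kernC al 0 1) k00 k10 k11.
set q := (X in _ * X); have -> : q = 1 + 5 / 2 * K ^+ 2 by rewrite /q; field.
have m1 : 1 <= al / 2 by lra.
have K2 : 0 < K ^+ 2 by exact: exprn_gt0.
rewrite add0r expr1n; move: (al / 2) m1 (K ^+ 2) K2 => m m1 y y0.
have : 0 <= (m - 1) * (1 + 5 / 2 * y) by apply: mulr_ge0; lra.
lra.
Qed.

End eigenvalues.

(** * The operator norm and the reproducing kernel thesis *)

Section operator_norm.
Variables (R : realType) (al mu : R).
Hypotheses (al0 : 0 < al) (mup : 0 < mu) (adm : admissible al mu).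
Implicit Types (w : R[i]) (v : nat -> R).

Lemma sqnorm_kseq_gt0 (de : R) : 0 < de -> 0 < sqnorm (kseq de).
Proof. by move=> d0; apply: lt_le_trans (sqnorm_kseq_ge d0); rewrite invr_gt0 mulr_gt0. Qed.

Lemma fin_div (a b : R) : 0 <= a -> 0 < b ->
  ((Num.sqrt a)%:E / (Num.sqrt b)%:E)%E = (Num.sqrt (a / b))%:E.
Proof.
move=> a0 b0; rewrite inver gt_eqF ?sqrtr_gt0// -EFinM.
by rewrite sqrtrM// sqrtrV// ltW.
Qed.

Lemma qlim_ge0 v : l2 v -> 0 <= qlim al v.
Proof.
move=> lv; rewrite -(image_sqnorm al0 mup adm lv); exact: sqnorm_ge0 (image_l2 al0 mup adm lv).
Qed.

Lemma ratio_le w : half_plane 2^-1 w ->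
  (H2norm (comp_op (phi_symbol al) (repr_kernel w)) / H2norm (repr_kernel w) <=
   (Num.sqrt (qlim al (kseq (cRe w - 2^-1)) / sqnorm (kseq (cRe w - 2^-1))))%:E)%E.
Proof.
move=> h; have d0 := half_plane_gt0 h; have [xr xi] := (ell2P _).1 (kernel_ell2 h).
rewrite (comp_H2norm al0 mup adm (kernel_coeffs h)) kernel_H2norm//.
rewrite fin_div ?sqnorm_kseq_gt0 ?addr_ge0 ?qlim_ge0// lee_fin ler_wsqrtr//.
apply: ler_wpM2r; first by rewrite invr_ge0 ltW// sqnorm_kseq_gt0.
exact: kernel_qlim_le al0 mup adm _ h.
Qed.

Lemma real_half_plane (de : R) : 0 < de -> half_plane 2^-1 (2^-1 + de)%:C.
Proof. by move=> d0; change ((2^-1 : R) < 2^-1 + de); rewrite ltrDl. Qed.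

Lemma real_ratio (de : R) : 0 < de ->
  (H2norm (comp_op (phi_symbol al) (repr_kernel (2^-1 + de)%:C)) /
   H2norm (repr_kernel (2^-1 + de)%:C : R[i] -> R[i]))%E =
   (Num.sqrt (qlim al (kseq de) / sqnorm (kseq de)))%:E.
Proof.
move=> d0; have h := real_half_plane d0.
have e : cRe (2^-1 + de)%:C - 2^-1 = de by rewrite cReC addrC addKr.
rewrite (comp_H2norm al0 mup adm (kernel_coeffs h)) kernel_H2norm// e.
by rewrite real_kernel_qlim fin_div ?sqnorm_kseq_gt0 ?qlim_ge0//; exact: kseq_l2.
Qed.

Lemma qformZ c v N : qform al (fun k => c * v k) N = c ^+ 2 * qform al v N.
Proof.
rewrite /qform mulr_sumr; apply: eq_bigr => i _; rewrite mulr_sumr.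
by apply: eq_bigr => j _; ring.
Qed.

(** Test the operator on the Dirichlet series with coefficients v / |v|. *)
Lemma comp_op_norm_ge v : l2 v -> 0 < sqnorm v ->
  ((Num.sqrt (qlim al v / sqnorm v))%:E <= comp_op_norm (phi_symbol al))%E.
Proof.
move=> lv n0; pose c := (Num.sqrt (sqnorm v))^-1.
have c2 : c ^+ 2 = (sqnorm v)^-1 by rewrite exprVn sqr_sqrtr// ltW.
pose x k : R[i] := (c * v k)%:C.
have xrE : re x = fun k => c * v k by [].
have xiE : im x = fun=> 0 by [].
have lcv : l2 (fun k => c * v k).
  case: lv => [C hC]; exists (c ^+ 2 * C) => N.
  under eq_bigr do rewrite exprMn; rewrite -mulr_sumr.
  by apply: ler_wpM2l => //; exact: sqr_ge0.
have l0 : l2 (fun=> 0 : R) by exists 0 => N; rewrite big1// => k _; rewrite expr0n.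
have xl : ell2 x by apply/ell2P; rewrite xrE xiE.
have ncv : sqnorm (fun k => c * v k) = 1.
  rewrite -[RHS](_ : c ^+ 2 * sqnorm v = 1); last by rewrite c2 mulVf// gt_eqF.
  apply: cvg_lim => //; rewrite [X in X @ _ --> _](_ : _ = fun N => c ^+ 2 * \sum_(k < N) v k ^+ 2).
    by apply: cvgMl_tmp; exact: sqnorm_cvg.
  by apply/funext => N; rewrite mulr_sumr; apply: eq_bigr => k _; rewrite exprMn.
have n00 : sqnorm (fun=> 0 : R) = 0.
  apply: cvg_lim => //; rewrite [X in X @ _ --> _](_ : _ = fun=> 0); first exact: cvg_cst.
  by apply/funext => N; rewrite big1// => k _; rewrite expr0n.
have qcv : qlim al (fun k => c * v k) = qlim al v / sqnorm v.
  rewrite mulrC -c2; apply: cvg_lim => //.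
  rewrite [X in X @ _ --> _](_ : _ = fun N => c ^+ 2 * qform al v N).
    by apply: cvgMl_tmp; have := qform_cvg al0 mup adm lv.
  by apply/funext => N; rewrite qformZ.
have q00 : qlim al (fun=> 0) = 0.
  apply: cvg_lim => //; rewrite [X in X @ _ --> _](_ : _ = fun=> 0); first exact: cvg_cst.
  by apply/funext => N; rewrite /qform big1// => i _; rewrite big1// => j _; rewrite !mulr0.
have hx := H2_of_coeffs xl.
apply: ereal_sup_ubound; exists (fun s => cseries_sum (fun k => x k * cpow k.+1 (- s))).
  by rewrite /= (H2normE hx) /csqnorm xrE xiE ncv n00 addr0 sqrtr1.
by rewrite (comp_H2norm al0 mup adm hx) xrE xiE qcv q00 addr0.
Qed.

Lemma comp_op_norm_le : (comp_op_norm (phi_symbol al) <= (Num.sqrt mu^-1)%:E)%E.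
Proof.
apply: ge_ereal_sup => _ [f /= f1 <-].
have [x hx] : H2 f by move: f1; rewrite /H2norm; case: asboolP.
have [/ell2P[xr xi] _] := hx.
rewrite (comp_H2norm al0 mup adm hx) lee_fin ler_wsqrtr//.
rewrite -[mu^-1]mul1r ler_pdivlMr// mulrC mulrDr.
apply: (@le_trans _ _ (csqnorm x)).
  by rewrite /csqnorm lerD// (qlim_le al0).
move: f1; rewrite (H2normE hx) lee_fin -[X in _ <= X]sqrtr1 ler_sqrt//.
Qed.

End operator_norm.

Section criterion.
Variables (R : realType) (al : R).
Hypothesis al0 : 0 < al.

(** The squared norm of the kernel is at least 1 / (2 de), so that the constant
    of [qform_kseq_lower] becomes negligible as de tends to 0. *)
Lemma kernel_ratio_sup (S : \bar R) :
  (forall de : R, (0 < de)%R -> (Num.sqrt (qlim al (kseq de) / sqnorm (kseq de)))%:E <= S)%E ->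
  admissible al (al / 2) -> ((Num.sqrt (al / 2)^-1)%:E <= S)%E.
Proof.
move=> hS adm; have p : 0 < al / 2 by rewrite divr_gt0.
have [C C0 hC] := qform_kseq_lower al0.
case: S hS => [r| |] hS; [|by rewrite leey|by have := hS 1 ltr01].
have r0 : 0 <= r by have := hS 1 ltr01; rewrite lee_fin; apply: le_trans; exact: sqrtr_ge0.
rewrite lee_fin -[r]ger0_norm// -sqrtr_sqr ler_sqrt ?sqr_ge0// invf_div.
apply/ler_addgt0Pr => e e0.
(* C is at most e times the squared norm of the kernel for this de. *)
pose de := Num.min (al / 2) (e / (2 * (1 + C))).
have d0 : 0 < de by rewrite lt_min p divr_gt0// mulr_gt0// ltr_wpDr.
have dC : 2 * de * C <= e.
  have : de <= e / (2 * (1 + C)) by rewrite ge_min lexx orbT.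
  rewrite ler_pdivlMr ?mulr_gt0 ?ltr_wpDr// => h; apply: le_trans h.
  by rewrite mulrDr mulr1 mulrDr mulrA [de * 2]mulrC lerDr mulr_ge0// ltW.
have ng := sqnorm_kseq_ge d0; have n0 := sqnorm_kseq_gt0 d0.
have lk := kseq_l2 d0.
have q : 2 / al * sqnorm (kseq de) - C <= qlim al (kseq de).
  have h1 : (fun N => 2 / al * \sum_(k < N) kseq de k ^+ 2 - C) @ \oo --> 2 / al * sqnorm (kseq de) - C.
    by apply: cvgB; [apply: cvgMl_tmp; exact: sqnorm_cvg|exact: cvg_cst].
  apply: (ler_cvg_to h1 (qform_cvg al0 p adm lk)); near=> N.
  by apply: hC => //; rewrite ge_min lexx.
have : qlim al (kseq de) / sqnorm (kseq de) <= r ^+ 2.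
  have := hS de d0; rewrite lee_fin -[r in _ <= r]ger0_norm// -sqrtr_sqr ler_sqrt ?sqr_ge0//.
rewrite ler_pdivrMr// => h.
have Ce : C <= e * sqnorm (kseq de).
  apply: le_trans (ler_wpM2l (ltW e0) ng).
  by rewrite ler_pdivlMr ?mulr_gt0// mulrC.
rewrite -(ler_pM2r n0) mulrDl.
by have := le_trans q h; lra.
Unshelve. all: by end_near. Qed.

Lemma critical_kernel_thesis : admissible al (al / 2) -> repr_kernel_thesis (phi_symbol al).
Proof.
move=> adm; have p : 0 < al / 2 by rewrite divr_gt0.
rewrite /repr_kernel_thesis.
have e : comp_op_norm (phi_symbol al) = (Num.sqrt (al / 2)^-1)%:E.
  apply/eqP; rewrite eq_le (comp_op_norm_le al0 p adm)/=.
  apply: kernel_ratio_sup => // de d0.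
  by apply: (comp_op_norm_ge al0 p adm); [exact: kseq_l2|exact: sqnorm_kseq_gt0].
rewrite e; apply/eqP; rewrite eq_le; apply/andP; split.
  apply: ge_ereal_sup => _ [w hw <-]; apply: le_trans (ratio_le al0 p adm hw) _.
  have d0 := half_plane_gt0 hw; rewrite lee_fin ler_wsqrtr//.
  rewrite ler_pdivrMr ?sqnorm_kseq_gt0// ler_pdivlMl//.
  exact: (qlim_le al0 p adm (kseq_l2 d0)).
apply: kernel_ratio_sup => // de d0; rewrite -(real_ratio al0 p adm d0).
by apply: ereal_sup_ubound; exists (2^-1 + de)%:C => //; exact: real_half_plane.
Qed.

(** The squared norm of the operator is at least 1 / mu, by the ground state,
    and the squared ratios of the kernels are at most (1 - e) / mu. *)
Lemma subcritical_kernel_thesis_fails mu : 1 < al -> subcritical al mu ->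
  ~ repr_kernel_thesis (phi_symbol al).
Proof.
move=> al1 sub; have [mup _ adm _] := sub; rewrite /repr_kernel_thesis => h.
have [e e0 gap] := kernel_gap al1 sub.
have gl := ground_l2 al0 sub.
have gr : sqnorm (ground al mu) = mu * qlim al (ground al mu).
  apply/eqP; rewrite -subr_eq0; apply/eqP.
  have cq : (fun N => mu * qform al (ground al mu) N) @ \oo --> mu * qlim al (ground al mu).
    by apply: cvgMl_tmp; have := qform_cvg al0 mup adm gl.
  rewrite -(cvg_lim _ (cvgB (sqnorm_cvg gl) cq))//; apply: cvg_lim => //.
  exact: ground_rayleigh al0 sub.
have gn : 0 < sqnorm (ground al mu).
  apply: lt_le_trans (sqnorm_ge 1 gl); rewrite big_ord1 exprn_gt0//.
  exact: ground_gt0 sub 0.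
have hi := comp_op_norm_ge al0 mup adm gl gn.
have e1 : qlim al (ground al mu) / sqnorm (ground al mu) = mu^-1.
  have q0 : qlim al (ground al mu) != 0.
    by apply: contraTneq gn => q0; rewrite gr q0 mulr0 ltxx.
  by rewrite gr invfM mulrCA divff// mulr1.
rewrite e1 -h in hi.
have lo : (ereal_sup [set (H2norm (comp_op (phi_symbol al) (repr_kernel w)) /
    H2norm (repr_kernel w))%E | w in half_plane 2^-1] <= (Num.sqrt ((1 - e) / mu))%:E)%E.
  apply: ge_ereal_sup => _ [w hw <-]; apply: le_trans (ratio_le al0 mup adm hw) _.
  have d0 := half_plane_gt0 hw; rewrite lee_fin ler_wsqrtr//.
  rewrite ler_pdivrMr ?sqnorm_kseq_gt0// mulrAC ler_pdivlMr// mulrC.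
  exact: gap.
have := le_trans hi lo; rewrite lee_fin leNgt ltr_sqrt ?invr_gt0//.
by rewrite -[ltRHS]mul1r ltr_pM2r ?invr_gt0// gtrBl e0.
Qed.

End criterion.

Local Close Scope complex_scope.
Local Close Scope classical_set_scope.

Theorem theoremD (R : realType) (alpha : R) (alpha_gt0 : 0 < alpha) :
  [/\ repr_kernel_thesis (phi_symbol alpha) <->
        eigenvalue_number (Kmatrix alpha) = 0%E,
      alpha <= 1 -> repr_kernel_thesis (phi_symbol alpha) &
      2 <= alpha -> ~ repr_kernel_thesis (phi_symbol alpha)].
Proof.
have crit : admissible alpha (alpha / 2) ->
    repr_kernel_thesis (phi_symbol alpha) /\ eigenvalue_number (Kmatrix alpha) = 0%E.
  move=> adm; split; first exact: critical_kernel_thesis.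
  by apply/eigenvalue_number_eq0 => l; exact: no_eigenvalue_critical.
have subc : ~ admissible alpha (alpha / 2) ->
    ~ repr_kernel_thesis (phi_symbol alpha) /\ eigenvalue_number (Kmatrix alpha) <> 0%E.
  move=> nadm; have [//|[mu sub]] := dichotomy alpha_gt0.
  have al1 : 1 < alpha.
    by rewrite ltNge; apply/negP => al1; apply: nadm; exact: admissible_small.
  split; first exact: subcritical_kernel_thesis_fails sub.
  by move=> /eigenvalue_number_eq0 h; exact: h _ (eigenvalue_subcritical alpha_gt0 sub).
split.
- by have [/crit[]|/subc[]] := pselect (admissible alpha (alpha / 2)).
- by move=> al1; apply: (crit _).1; exact: admissible_small.
- by move=> al2; apply: (subc _).1; exact: large_not_critical.
Qed.
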